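(* Let $d\ge2$. For all $\gamma,\lambda>0$, $$\xi_{d-1}(\gamma,\lambda)=\frac{\gamma^d\lambda^{1-d}}{2d}\int_0^1(1-s)^{\frac{d-3}{2}}\exp\!\Big(-\gamma\,\frac{\kappa_{d-1}}{d+1}\,s^{\frac{d+1}{2}}\,{}_2F_1\!\Big(\tfrac{d+1}{2},\tfrac{d+1}{2};\tfrac{d+3}{2};s\Big)\Big)\,I_d(s)\,ds,$$ where, for $s\in(0,1)$, $$I_d(s):=\int_{(\mathbb{R}^{d-1})^d}\Delta_{d-1}(z_1,\dots,z_d)\prod_{i=1}^d(1-\|z_i\|^2)^{-\frac{d+1}{2}}\,\mathbf 1\{\|z_i\|^2\le s\}\,dz_1\cdots dz_d .$$
   Context: Notation: $\kappa_m=\pi^{m/2}/\Gamma(1+m/2)$ is the volume of the $m$-dimensional Euclidean unit ball; ${}_2F_1$ is the Gauss hypergeometric function; $\Delta_{d-1}(z_1,\dots,z_d)$ is the $(d-1)$-dimensional Lebesgue volume of the simplex $[z_1,\dots,z_d]\subset\mathbb{R}^{d-1}$ (Euclidean convex hull). Let $\widetilde\eta_{\gamma,\lambda}$ be a Poisson point process on $\mathbb{R}^{d-1}\times(0,\infty)$ with intensity measure $\frac{\gamma}{2}h^{-(d+1)/2}\mathbf 1\{h\ge\lambda^2\}\,dv\,dh$. (It is the image under $(v,y)\mapsto(v,y^2)$ of a Poisson process in the upper halfspace model $\mathbb{R}^{d-1}\times(0,\infty)$ of hyperbolic space $\mathbb{H}^d$ with intensity measure $\gamma\,\mathrm{vol}_{\mathbb{H}^d}$,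 $d\mathrm{vol}_{\mathbb{H}^d}=y^{-d}dv\,dy$, restricted to the horoball $\{y\ge\lambda\}$.) For $z_i=(v_i,h_i)$, $i=1,\dots,d$, with $v_1,\dots,v_d$ affinely independent, $\Pi(z_1,\dots,z_d)$ is the unique downward paraboloid $\{(v,h)\in\mathbb{R}^{d-1}\times\mathbb{R}:h\le s-\|v-w\|^2\}$ whose boundary contains $z_1,\dots,z_d$, and $A(z_1,\dots,z_d):=w\in\mathbb{R}^{d-1}$ is the spatial coordinate of its apex $(w,s)$. The cell intensity of the tessellation $\mathcal{D}_{\gamma,\lambda}$ formed by all simplices $[v_1,\dots,v_d]$ with $z_i=(v_i,h_i)\in\widetilde\eta_{\gamma,\lambda}$, $v_1,\dots,v_d$ affinely independent and $\operatorname{int}\Pi(z_1,\dots,z_d)\cap\widetilde\eta_{\gamma,\lambda}=\varnothing$ is $$\xi_{d-1}(\gamma,\lambda):=\frac{1}{d!\,\mathrm{vol}_{\mathbb{R}^{d-1}}(W)}\,\mathbb{E}\sum_{(z_1,\dots,z_d)\in(\widetilde\eta_{\gamma,\lambda})^d_{\ne}}\mathbf 1\{A(z_1,\dots,z_d)\in W\}\,\mathbf 1\{\operatorname{int}\Pi(z_1,\dots,z_d)\cap\widetilde\eta_{\gamma,\lambda}=\varnothing\},$$ where $W\subset\mathbb{R}^{d-1}$ is any bounded Borel set with $0<\mathrm{vol}_{\mathbb{R}^{d-1}}(W)<\infty$ (by stationarity the value does not depend on $W$) and $(\cdot)^d_{\ne}$ denotes $d$-tuples of pairwise distinct points. *)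

(* Defs.v *)
From HB Require Import structures.
From mathcomp Require Import all_boot all_order all_algebra.
From mathcomp Require Import all_classical all_reals all_analysis.
From mathcomp Require Import measurable_realfun.

Set Implicit Arguments.
Unset Strict Implicit.
Unset Printing Implicit Defensive.

Import Order.TTheory GRing.Theory Num.Theory.
Import numFieldNormedType.Exports.

Local Open Scope classical_set_scope.
Local Open Scope ring_scope.

Definition measure_matrix_display : measure_display -> measure_display.
Proof. exact. Qed.

(* The product sigma-algebra of the entries. On ['rV[R]_n], with [R] carrying
   its Borel sigma-algebra, this is the Borel sigma-algebra of R^n. *)
Section measurable_matrix.
Context {d} {T : sigmaRingType d}.
Variables m n : nat.

Definition mx_measurable : set (set 'M[T]_(m, n)) :=
  <<s \bigcup_(ij in [set: 'I_m * 'I_n])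
        preimage_set_system setT (fun M : 'M[T]_(m, n) => M ij.1 ij.2)
          measurable >>.

Let mx_measurable0 : mx_measurable set0.
Proof. exact: sigma_algebra0. Qed.

Let mx_measurableC A : mx_measurable A -> mx_measurable (~` A).
Proof. exact: sigma_algebraC. Qed.

Let mx_measurable_bigcup (F : (set 'M[T]_(m, n))^nat) :
  (forall i, mx_measurable (F i)) -> mx_measurable (\bigcup_i (F i)).
Proof. exact: sigma_algebra_bigcup. Qed.

HB.instance Definition _ := @isMeasurable.Build (measure_matrix_display d)
  'M[T]_(m, n) mx_measurable mx_measurable0 mx_measurableC mx_measurable_bigcup.

End measurable_matrix.

Section sigma_finite_pushforward.
Context d1 d2 (T1 : measurableType d1) (T2 : measurableType d2) (R : realType).
Variables (mu : {measure set T1 -> \bar R}) (f : T1 -> T2) (g : T2 -> T1).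
Hypothesis mu_sigma_finite : sigma_finite setT mu.
Hypotheses (mf : measurable_fun setT f) (mg : measurable_fun setT g).
Hypothesis fK : cancel f g.

Let pf := pushforward mu f.

Let pf0 : pf set0 = 0%E. Proof. exact: measure0. Qed.

Let pf_ge0 A : (0 <= pf A)%E. Proof. exact: measure_ge0. Qed.

Let pf_sigma_additive : semi_sigma_additive pf.
Proof. exact: measure_semi_sigma_additive. Qed.

Let pf_sigma_finite : sigma_finite setT pf.
Proof.
have [F TF Foo] := mu_sigma_finite.
exists (fun k => g @^-1` F k).
  by rewrite -preimage_bigcup -TF preimage_setT.
move=> k; have [mFk Fkoo] := Foo k; split.
  by rewrite -[X in measurable X]setTI; exact: mg.
rewrite /pf /pushforward (_ : _ @^-1` _ = F k)//.
by apply/seteqP; split=> x /=; rewrite fK.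
Qed.

HB.instance Definition _ := isMeasure.Build _ _ _ pf
  pf0 pf_ge0 pf_sigma_additive.
HB.instance Definition _ := Measure_isSigmaFinite.Build _ _ _ pf
  pf_sigma_finite.

Lemma sigma_finite_pushforward :
  exists m : {sigma_finite_measure set T2 -> \bar R},
    (m : set T2 -> \bar R) = pushforward mu f.
Proof. by exists pf. Qed.

End sigma_finite_pushforward.

Lemma sigma_finite_product d1 d2 (T1 : measurableType d1)
    (T2 : measurableType d2) (R : realType)
    (m1 : {sigma_finite_measure set T1 -> \bar R})
    (m2 : {sigma_finite_measure set T2 -> \bar R}) :
  sigma_finite setT (m1 \x m2)%E.
Proof.
have /sigma_finiteP[F [TF ndF Foo]] := sigma_finiteT m1.
have /sigma_finiteP[G [TG ndG Goo]] := sigma_finiteT m2.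
exists (fun n => F n `*` G n).
  rewrite -setXTT TF TG predeqE => -[x y]; split.
    move=> [/= [n _ Fnx] [k _ Gky]]; exists (maxn n k) => //; split.
    - by move: x Fnx; exact/subsetPset/ndF/leq_maxl.
    - by move: y Gky; exact/subsetPset/ndG/leq_maxr.
  by move=> [n _ []/= ? ?]; split; exists n.
move=> k; have [? ?] := Foo k; have [? ?] := Goo k.
split; first exact: measurableX.
by rewrite product_measure1E// lte_mul_pinfty// ge0_fin_numE.
Qed.

(* The n-fold product of [mu] on n-tuples, by iterated integration. *)
Section tuple_measure.
Context d (T : measurableType d) (R : realType).
Variable mu : {sigma_finite_measure set T -> \bar R}.

Fixpoint tuple_measure (n : nat) : set (n.-tuple T) -> \bar R :=
  match n with
  | 0 => \d_[tuple]
  | k.+1 => fun A =>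
      (\int[mu]_x tuple_measure [set t : k.-tuple T | A [tuple of x :: t]])%E
  end.

Lemma tuple_measure_sigma_finite n :
  exists m : {sigma_finite_measure set (n.-tuple T) -> \bar R},
    (m : set (n.-tuple T) -> \bar R) = @tuple_measure n.
Proof.
elim: n => [|n [m mE]].
  by exists (\d_([tuple] : 0.-tuple T) : {finite_measure set _ -> \bar R}).
have mf : measurable_fun setT
    (fun p : T * n.-tuple T => [tuple of p.1 :: p.2] : n.+1.-tuple T).
  exact: measurable_cons.
have mg : measurable_fun setT
    (fun t : n.+1.-tuple T => (thead t, [tuple of behead t])).
  apply: measurable_fun_pair; first exact: measurable_tnth.
  exact: measurable_behead.
have fK : cancel
    (fun p : T * n.-tuple T => [tuple of p.1 :: p.2] : n.+1.-tuple T)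
    (fun t : n.+1.-tuple T => (thead t, [tuple of behead t])).
  by move=> [x t]; rewrite theadE; congr pair; exact/val_inj.
have [m' m'E] := sigma_finite_pushforward
  (sigma_finite_product mu m) mf mg fK.
exists m'; rewrite m'E; apply/funext => A /=.
rewrite /pushforward /product_measure1; apply: eq_integral => x _ /=.
by rewrite mE; congr tuple_measure; apply/seteqP; split => t /=;
  rewrite /xsection/= inE.
Qed.

Variable n : nat.

Let tuple_measure0 : @tuple_measure n set0 = 0%E.
Proof. by have [m <-] := tuple_measure_sigma_finite n; exact: measure0. Qed.

Let tuple_measure_ge0 A : (0 <= @tuple_measure n A)%E.
Proof. by have [m <-] := tuple_measure_sigma_finite n; exact: measure_ge0. Qed.

Let tuple_measure_sigma_additive : semi_sigma_additive (@tuple_measure n).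
Proof.
have [m <-] := tuple_measure_sigma_finite n.
exact: measure_semi_sigma_additive.
Qed.

Let tuple_measureT : sigma_finite setT (@tuple_measure n).
Proof. by have [m <-] := tuple_measure_sigma_finite n; exact: sigma_finiteT. Qed.

HB.instance Definition _ := isMeasure.Build _ _ _ (@tuple_measure n)
  tuple_measure0 tuple_measure_ge0 tuple_measure_sigma_additive.
HB.instance Definition _ := Measure_isSigmaFinite.Build _ _ _ (@tuple_measure n)
  tuple_measureT.

End tuple_measure.
Arguments tuple_measure {d T R} mu n.

(* [lebesgue_measure] is typed on [measurableTypeR R]; [lebesgue_rV] is its n-fold
   product moved to ['rV[R]_n]. *)
Section lebesgue_rV.
Context (R : realType) (n : nat).

Definition row_of_tuple (t : n.-tuple (measurableTypeR R)) : 'rV[R]_n :=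
  \row_i tnth t i.

Definition tuple_of_row (v : 'rV[R]_n) : n.-tuple (measurableTypeR R) :=
  [tuple v ord0 i | i < n].

Lemma row_of_tupleK : cancel row_of_tuple tuple_of_row.
Proof. by move=> t; apply: eq_from_tnth => i; rewrite tnth_mktuple mxE. Qed.

Lemma measurable_row_of_tuple : measurable_fun setT row_of_tuple.
Proof.
apply: (measurability (\bigcup_(ij in [set: 'I_1 * 'I_n])
  preimage_set_system setT (fun M : 'rV[R]_n => M ij.1 ij.2) measurable)) => //.
move=> _ [_ [[i j] _ [B mB <-]] <-]; rewrite !setTI.
rewrite (_ : _ @^-1` _ = (fun t : n.-tuple (measurableTypeR R) => tnth t j) @^-1` B).
  by rewrite -[X in measurable X]setTI; exact: measurable_tnth.
by apply/seteqP; split=> t /=; rewrite mxE.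
Qed.

Lemma measurable_tuple_of_row : measurable_fun setT tuple_of_row.
Proof.
apply/measurable_fun_tnthP => i _ B mB; apply: sub_sigma_algebra.
exists (ord0, i) => //; exists B => //; rewrite !setTI.
by apply/seteqP; split=> v /=; rewrite tnth_mktuple.
Qed.

Definition lebesgue_rV : set 'rV[R]_n -> \bar R :=
  pushforward (tuple_measure (@lebesgue_measure R) n) row_of_tuple.

Let lebesgue_rV_sigma_finite :
  exists m : {sigma_finite_measure set 'rV[R]_n -> \bar R},
    (m : set 'rV[R]_n -> \bar R) = lebesgue_rV.
Proof.
exact: (sigma_finite_pushforward (sigma_finiteT _) measurable_row_of_tuple
  measurable_tuple_of_row row_of_tupleK).
Qed.

Let lebesgue_rV0 : lebesgue_rV set0 = 0%E.
Proof. by have [m <-] := lebesgue_rV_sigma_finite; exact: measure0. Qed.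

Let lebesgue_rV_ge0 A : (0 <= lebesgue_rV A)%E.
Proof. by have [m <-] := lebesgue_rV_sigma_finite; exact: measure_ge0. Qed.

Let lebesgue_rV_sigma_additive : semi_sigma_additive lebesgue_rV.
Proof.
have [m <-] := lebesgue_rV_sigma_finite; exact: measure_semi_sigma_additive.
Qed.

Let lebesgue_rVT : sigma_finite setT lebesgue_rV.
Proof. by have [m <-] := lebesgue_rV_sigma_finite; exact: sigma_finiteT. Qed.

HB.instance Definition _ := isMeasure.Build _ _ _ lebesgue_rV
  lebesgue_rV0 lebesgue_rV_ge0 lebesgue_rV_sigma_additive.
HB.instance Definition _ := Measure_isSigmaFinite.Build _ _ _ lebesgue_rV
  lebesgue_rVT.

End lebesgue_rV.
Arguments lebesgue_rV {R n}.

Section special_functions.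
Context {R : realType}.

Definition Gamma (x : R) : R :=
  \int[@lebesgue_measure R]_(t in `]0%R, +oo[) (t `^ (x - 1) * expR (- t)).

Definition ball_volume (m : nat) : R :=
  pi `^ (m%:R / 2) / Gamma (1 + m%:R / 2).

Definition pochhammer (a : R) (n : nat) : R := \prod_(k < n) (a + k%:R).

(* Gauss's 2F1(a, b; c; x) as the sum of its power series, for |x| < 1. *)
Definition hypergeometric2F1 (a b c x : R) : R :=
  limn (series (fun n =>
    pochhammer a n * pochhammer b n / pochhammer c n * (x ^+ n / n`!%:R))).

End special_functions.

Section poisson_process.
Context d (T : measurableType d) d' (Omega : measurableType d') (R : realType).

Definition point_count (eta : Omega -> set T) (B : set T) (w : Omega) : \bar R :=
  counting (eta w `&` B).

(* A simple point process is given as a random set of points. No local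
   finiteness is assumed: it holds almost surely where [Lambda] is finite. *)
Definition is_poisson_process (P : probability Omega R)
    (Lambda : set T -> \bar R) (eta : Omega -> set T) : Prop :=
  [/\ forall B, measurable B -> measurable_fun setT (point_count eta B),
      forall B, measurable B -> (Lambda B < +oo)%E -> forall k : nat,
        P [set w | point_count eta B w = k%:R%:E] =
          (fine (Lambda B) ^+ k / k`!%:R * expR (- fine (Lambda B)))%:E,
      forall B, measurable B -> Lambda B = +oo%E ->
        P [set w | point_count eta B w = +oo%E] = 1%E
    & forall (m : nat) (B : 'I_m -> set T) (S : 'I_m -> set (\bar R)),
        (forall i, measurable (B i)) -> trivIset setT B ->
        (forall i, measurable (S i)) ->
        P [set w | forall i, S i (point_count eta (B i) w)] =
          (\prod_(i < m) P [set w | S i (point_count eta (B i) w)])%E].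

End poisson_process.

Section geometry.
Context {R : realType} {n : nat}.
Implicit Types v w : 'rV[R]_n.

(* The library norm on ['rV[R]_n] is the maximum norm. *)
Definition sqnorm v : R := \sum_(i < n) v ord0 i ^+ 2.

Definition affinely_independent k (v : 'I_k -> 'rV[R]_n) : Prop :=
  forall c : 'I_k -> R, \sum_i c i = 0 -> \sum_i c i *: v i = 0 ->
    forall i, c i = 0.

Definition simplex k (v : 'I_k -> 'rV[R]_n) : set 'rV[R]_n :=
  [set x | exists c : 'I_k -> R,
    [/\ forall i, 0 <= c i, \sum_i c i = 1 & x = \sum_i c i *: v i]].

Definition simplex_volume k (v : 'I_k -> 'rV[R]_n) : \bar R :=
  lebesgue_rV (simplex v).

Definition paraboloid (a : 'rV[R]_n * R) : set ('rV[R]_n * R) :=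
  [set p | p.2 <= a.2 - sqnorm (p.1 - a.1)].

(* The apex (w, s) of the unique downward paraboloid with z_1, ..., z_k on its
   boundary; a junk value unless there are n + 1 points z_i = (v_i, h_i) with
   affinely independent v_i. *)
Definition apex k (z : k.-tuple ('rV[R]_n * R)) : 'rV[R]_n * R :=
  xget 0 [set a | forall i,
    (closure (paraboloid a) `\` (paraboloid a)°) (tnth z i)].

(* The set of k-tuples of pairwise distinct points of [E] with affinely
   independent spatial coordinates. *)
Definition distinct_tuples k (E : set ('rV[R]_n * R)) :
    set (k.-tuple ('rV[R]_n * R)) :=
  [set z | [/\ forall i, E (tnth z i), uniq z
             & affinely_independent (fun i => (tnth z i).1)]].

End geometry.

Section cell_intensity.
Context {R : realType} (d : nat).

(* The state space R^(d-1) x (0, oo) is embedded in R^(d-1) x R; the measure gives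
   no mass to {h <= 0}. *)
Definition horoball_intensity (gamma lambda : R)
    (B : set ('rV[R]_d.-1 * R)) : \bar R :=
  (\int[lebesgue_rV \x @lebesgue_measure R]_(p in
      B `&` [set p | (0 < p.2)%R /\ (lambda ^+ 2 <= p.2)%R])
    (gamma / 2 * p.2 `^ (- ((d%:R + 1) / 2)))%:E)%E.

Definition cell_intensity d' (Omega : measurableType d')
    (P : probability Omega R) (eta : Omega -> set ('rV[R]_d.-1 * R))
    (W : set 'rV[R]_d.-1) : \bar R :=
  ((d`!%:R * fine (lebesgue_rV W))^-1%:E *
   \int[P]_w \esum_(z in @distinct_tuples R d.-1 d (eta w))
     (\1_W (apex z).1 *
      \1_[set z' | (paraboloid (apex z'))° `&` eta w = set0] z)%:E)%E.

Definition I_integral (s : R) : \bar R :=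
  (\int[tuple_measure (@lebesgue_rV R d.-1) d]_z
    (simplex_volume (tnth z) *
     (\prod_(i < d) ((1 - sqnorm (tnth z i)) `^ (- ((d%:R + 1) / 2)) *
        \1_[set x | sqnorm x <= s] (tnth z i)))%:E))%E.

End cell_intensity.
Arguments horoball_intensity {R} d.
Arguments cell_intensity {R} d {d' Omega} P eta W.
Arguments I_integral {R} d s.

(* Main.v *)
Require Import Defs.
From HB Require Import structures.
From mathcomp Require Import all_boot all_order all_algebra.
From mathcomp Require Import all_classical all_reals all_analysis.
From mathcomp Require Import measurable_realfun.
From mathcomp Require Import ring lra.

(** Write d = n + 1. The cells with apex in W are counted by a sum over
(n+1)-tuples z of points of the process, and its mean is given by the Mecke
formula: it is the integral over z, against the (n+1)-fold power of the
intensity, of the probability that no point falls below the paraboloid of z.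
That probability depends only on the height s of the apex (w, s) of z, so all
that remains is to use (w, s) as integration variables.

The Mecke formula is needed only for such void events, and in this form it
follows from independence over disjoint sets. On a product of pairwise disjoint
sets G_i, and for a fixed set B disjoint from them, it says that the mean of
prod N(G_i) 1{N(B) = 0} is prod Lambda(G_i) P(N(B) = 0); a pi-lambda argument
passes to measurable subsets of the product ([mecke_rect]), a limit to sets B
depending on z that are cut out by countably many product sets
([mecke_section_all]), and a countable cover of the tuples of distinct points by
products of disjoint balls to all such tuples ([mecke_separated]). The set of
pairs (z, p) with p below the paraboloid of z is cut out by rational balls because
it is open in the apex and in p ([apex_point_cellP]) and the apex is a rational
function of z ([measurable_apex_solution]).

For the change of variables, fix the sites v. The heights of the points of a
paraboloid over them, h_i = s - |v_i - w|^2, are an affine function of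
(s - |w|^2, 2 w), with linear part the matrix of rows (1, v_i). Hence
dh = 2^n |det| dw ds ([integral_apex]), where |det| is n! times the volume of the
simplex of the v_i ([lebesgue_rV_simplex]). Translating the sites by w splits off
the volume of W, and v = sqrt s u produces a power of s times
I_d(1 - lambda^2 / s) ([site_integralE]). The mass of a paraboloid of apex height s
is found by slicing it into balls: it is an incomplete beta integral up to
1 - lambda^2 / s ([paraboloid_massE]), which the binomial series turns into 2F1
([integral_beta_hypergeometric]). The formula is then the substitution
t = 1 - lambda^2 / s ([integral_inversion]). *)

Set Implicit Arguments.
Unset Strict Implicit.
Unset Printing Implicit Defensive.

Import Order.TTheory GRing.Theory Num.Theory.
Import numFieldNormedType.Exports.

Local Open Scope classical_set_scope.
Local Open Scope ring_scope.

(** * Images of measures and affine maps of the line *)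

Lemma integral_measure_image d1 d2 (T1 : measurableType d1)
    (T2 : measurableType d2) (R : realType) (phi : T1 -> T2)
    (m1 : {measure set T1 -> \bar R}) (m2 : {measure set T2 -> \bar R})
    (f : T2 -> \bar R) :
  measurable_fun setT phi ->
  (forall A, measurable A -> m2 A = m1 (phi @^-1` A)) ->
  measurable_fun setT f -> (forall y, 0 <= f y)%E ->
  (\int[m2]_y f y = \int[m1]_x f (phi x))%E.
Proof.
move=> mphi m12 mf f0.
rewrite -(preimage_setT phi) -(ge0_integral_pushforward mphi m1 measurableT mf)//.
by apply: eq_measure_integral => A mA _; rewrite m12.
Qed.

Section measurable_partial_integral.
Context d1 d2 (T1 : measurableType d1) (T2 : measurableType d2) (R : realType).
Variables (f : T1 * T2 -> \bar R) (mf : measurable_fun setT f)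
  (f0 : forall x, (0 <= f x)%E).

Lemma measurable_integral_snd (m : {sigma_finite_measure set T2 -> \bar R}) :
  measurable_fun setT (fun x => \int[m]_y f (x, y))%E.
Proof. exact: (@measurable_fun_fubini_tonelli_F _ _ _ _ _ m f mf f0). Qed.

Lemma measurable_integral_fst (m : {sigma_finite_measure set T1 -> \bar R}) :
  measurable_fun setT (fun y => \int[m]_x f (x, y))%E.
Proof. exact: (@measurable_fun_fubini_tonelli_G _ _ _ _ _ m f mf f0). Qed.

End measurable_partial_integral.

Section affine_line.
Context (R : realType).
Notation leb := (@lebesgue_measure R).

Lemma measurable_affine (a b : R) : measurable_fun setT (fun x : R => a * x + b).
Proof. by apply: measurable_funD => //; apply: measurable_funM. Qed.

Lemma lebesgue_measure_affine (a b : R) (A : set R) : 0 < a -> measurable A ->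
  leb A = (a%:E * leb ((fun x => (a * x + b)%R) @^-1` A))%E.
Proof.
move=> a0 mA.
pose phi : R -> measurableTypeR R := fun x => a * x + b.
have mphi : measurable_fun setT phi by exact: measurable_affine.
pose m := mscale (NngNum (ltW a0)) (pushforward leb phi).
rewrite (_ : (_ * _)%E = m mphi A)//.
apply: (@lebesgue_measure_unique _ (m mphi)) => //.
move=> _ [[u v] _ <-].
rewrite /m /= /mscale/= /pushforward.
rewrite (_ : phi @^-1` _ = `](u - b) / a, (v - b) / a]%classic); last first.
  apply/seteqP; split => x; rewrite /phi /= !in_itv/=;
  by rewrite ltr_pdivrMr// ler_pdivlMr// ltrBlDr lerBrDr mulrC.
rewrite !lebesgue_measure_itv/= !lte_fin ltr_pM2r ?invr_gt0// ltrD2r.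
case: ifP => uv; last by rewrite mule0.
by rewrite -!EFinD -EFinM; congr EFin; field; rewrite gt_eqF.
Qed.

Lemma integral_affine_pos (a b : R) (f : R -> \bar R) : 0 < a ->
  measurable_fun setT f -> (forall x, 0 <= f x)%E ->
  (\int[leb]_x f x = a%:E * \int[leb]_x f (a * x + b)%R)%E.
Proof.
move=> a0 mf f0.
pose phi : R -> measurableTypeR R := fun x => a * x + b.
have mphi : measurable_fun setT phi by exact: measurable_affine.
pose m := mscale (NngNum (ltW a0)) leb.
rewrite (@integral_measure_image _ _ (measurableTypeR R) (measurableTypeR R)
    R phi m)//.
  by rewrite ge0_integral_mscale//; exact: measurableT_comp.
by move=> A mA; exact: (lebesgue_measure_affine b a0 mA).
Qed.

Lemma integral_opp (f : R -> \bar R) :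
  measurable_fun setT f -> (forall x, 0 <= f x)%E ->
  (\int[leb]_x f x = \int[leb]_x f (- x)%R)%E.
Proof.
move=> mf f0.
apply: (@integral_measure_image _ _ _ _ R (-%R : measurableTypeR R -> measurableTypeR R)) => // A mA.
by rewrite -[LHS]lebesgue_measureN.
Qed.

Lemma integral_affine (a b : R) (f : R -> \bar R) : a != 0 ->
  measurable_fun setT f -> (forall x, 0 <= f x)%E ->
  (\int[leb]_x f x = `|a|%:E * \int[leb]_x f (a * x + b)%R)%E.
Proof.
move=> a0 mf f0; have [a_gt0|a_lt0|/eqP] := ltgtP 0 a; last by rewrite eq_sym (negbTE a0).
  by rewrite gtr0_norm//; exact: integral_affine_pos.
rewrite ltr0_norm// (@integral_affine_pos (- a) b) ?oppr_gt0//; congr (_ * _)%E.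
rewrite integral_opp//; last first.
  by apply: measurableT_comp => //; exact: measurable_affine.
by apply: eq_integral => x _; rewrite mulrNN.
Qed.

Lemma integral_translate (b : R) (f : R -> \bar R) :
  measurable_fun setT f -> (forall x, 0 <= f x)%E ->
  (\int[leb]_x f x = \int[leb]_x f (x + b)%R)%E.
Proof.
move=> mf f0; rewrite (@integral_affine 1 b)// normr1 mul1e.
by under eq_integral do rewrite mul1r.
Qed.

End affine_line.

(** * Integration over tuples *)

Section tuple_integral.
Context d (T : measurableType d) (R : realType).
Variable mu : {sigma_finite_measure set T -> \bar R}.

Lemma measurable_tuple_cons n :
  measurable_fun setT
    (fun p : T * n.-tuple T => [tuple of p.1 :: p.2] : n.+1.-tuple T).
Proof. exact: measurable_cons. Qed.

(** The fixpoint defining the tuple measure integrates out the first entry; read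
    as an image of a binary product, it inherits the Fubini theorem. *)
Lemma tuple_measureS n (A : set (n.+1.-tuple T)) :
  tuple_measure mu n.+1 A =
  pushforward (mu \x tuple_measure mu n)%E
    (fun p : T * n.-tuple T => [tuple of p.1 :: p.2] : n.+1.-tuple T) A.
Proof.
rewrite /pushforward /= /product_measure1; apply: eq_integral => x _ /=.
by congr tuple_measure; apply/seteqP; split => t /=; rewrite /xsection/= inE.
Qed.

Lemma integral_tuple_cons n (f : n.+1.-tuple T -> \bar R) :
  measurable_fun setT f -> (forall t, 0 <= f t)%E ->
  (\int[tuple_measure mu n.+1]_t f t =
   \int[mu]_x \int[tuple_measure mu n]_t f [tuple of x :: t])%E.
Proof.
move=> mf f0.
rewrite (integral_measure_image (@measurable_tuple_cons n)
  (m1 := (mu \x tuple_measure mu n)%E))//; last by move=> A _; exact: tuple_measureS.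
rewrite fubini_tonelli1//.
by apply: measurableT_comp => //; exact: measurable_tuple_cons.
Qed.

Lemma tuple_measure_rect n (A : 'I_n -> set T) :
  (forall i, measurable (A i)) ->
  tuple_measure mu n [set t | forall i, A i (tnth t i)] = (\prod_(i < n) mu (A i))%E.
Proof.
elim: n A => [|n IHn] A mA.
  rewrite big_ord0 /= /dirac indicE /= mem_set//=.
  by case.
rewrite /= big_ord_recl/=.
rewrite (eq_integral (fun x => (\prod_(i < n) mu (A (lift ord0 i))) *
    (\1_(A ord0) x)%:E)%E).
  rewrite ge0_integralZl//; last 2 first.
  - by apply/measurable_EFinP.
  - by apply: prode_ge0 => i _; exact: measure_ge0.
  by rewrite integral_indic// setIT muleC.
move=> x _; rewrite indicE; case: (boolP (x \in A ord0)) => xA.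
  rewrite mule1 -IHn//; congr tuple_measure; apply/seteqP; split => t /= h.
    by move=> i; have := h (lift ord0 i); rewrite tnthS.
  move=> i; case: (unliftP ord0 i) => [j ->|->]; first by rewrite tnthS.
  by rewrite tnth0; exact/set_mem.
rewrite mule0; rewrite [X in tuple_measure _ _ X](_ : _ = set0) ?measure0//.
apply/seteqP; split => t //= h; have := h ord0.
by rewrite tnth0 => /mem_set; rewrite (negbTE xA).
Qed.

End tuple_integral.

(** * Linear changes of variables on row vectors *)

Section row_integral.
Context (R : realType).
Notation leb := (@lebesgue_measure R).

Lemma measurable_rowP d (T : measurableType d) n (f : T -> 'rV[R]_n) :
  measurable_fun setT f <-> forall i, measurable_fun setT (fun x => f x ord0 i).
Proof.
split => [mf i|mf].
  have mc : measurable_fun setT (fun v : 'rV[R]_n => v ord0 i).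
    move=> _ B mB; apply: sub_sigma_algebra; exists (ord0, i) => //.
    by exists B.
  exact: measurableT_comp mc mf.
apply: (measurability (\bigcup_(ij in [set: 'I_1 * 'I_n])
  preimage_set_system setT (fun M : 'rV[R]_n => M ij.1 ij.2) measurable)) => //.
move=> _ [_ [[i j] _ [B mB <-]] <-]; rewrite (ord1 i)/= setTI.
exact: mf.
Qed.

Lemma measurable_row_coord n (i : 'I_n) :
  measurable_fun setT (fun v : 'rV[R]_n => v ord0 i).
Proof. by apply: (measurable_rowP _).1; exact: measurable_id. Qed.

(** Pairs, rather than two arguments, because integration over a product space
    ranges over pairs. *)
Definition row_cons n (p : R * 'rV[R]_n) : 'rV[R]_n.+1 :=
  row_mx (p.1)%:M p.2 : 'rV_(1 + n).

Lemma row_cons0 n (p : R * 'rV[R]_n) : row_cons p ord0 ord0 = p.1.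
Proof.
rewrite /row_cons mxE; case: splitP => j; last by [].
by rewrite (ord1 j) mxE eqxx mulr1n.
Qed.

Lemma row_consS n (p : R * 'rV[R]_n) i : row_cons p ord0 (lift ord0 i) = p.2 ord0 i.
Proof.
rewrite /row_cons mxE; case: splitP => j.
  by rewrite (ord1 j).
by rewrite /= /bump /= !add1n => -[ij]; congr (p.2 _ _); apply/val_inj.
Qed.

Lemma measurable_row_cons n : measurable_fun setT (@row_cons n).
Proof.
apply/measurable_rowP => i; case: (unliftP ord0 i) => [j ->|->].
  under eq_fun do rewrite row_consS.
  exact: measurableT_comp (measurable_row_coord j) measurable_snd.
by under eq_fun do rewrite row_cons0; exact: measurable_fst.
Qed.

Lemma integral_row_tuple n (f : 'rV[R]_n -> \bar R) :
  measurable_fun setT f -> (forall t, 0 <= f t)%E ->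
  (\int[lebesgue_rV]_t f t =
   \int[tuple_measure leb n]_t f (row_of_tuple t))%E.
Proof.
move=> mf f0.
by rewrite (integral_measure_image (@measurable_row_of_tuple R n)
  (m1 := tuple_measure leb n)).
Qed.

Lemma integral_row_cons n (f : 'rV[R]_n.+1 -> \bar R) :
  measurable_fun setT f -> (forall t, 0 <= f t)%E ->
  (\int[lebesgue_rV]_t f t =
   \int[leb]_x \int[lebesgue_rV]_t f (row_cons (x, t)))%E.
Proof.
move=> mf f0; rewrite integral_row_tuple// integral_tuple_cons//; last first.
  by apply: measurableT_comp => //; exact: measurable_row_of_tuple.
apply: eq_integral => x _.
rewrite (@integral_row_tuple n (fun t => f (row_cons (x, t))))//; last first.
  apply: measurableT_comp => //.
  exact: measurableT_comp (@measurable_row_cons n) (measurable_pair1 _).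
apply: eq_integral => t _; congr f; apply/rowP => i.
case: (unliftP ord0 i) => [j ->|->].
  by rewrite row_consS !mxE tnthS.
by rewrite row_cons0 !mxE tnth0.
Qed.

Lemma integral_row_cons_swap n (f : 'rV[R]_n.+1 -> \bar R) :
  measurable_fun setT f -> (forall t, 0 <= f t)%E ->
  (\int[lebesgue_rV]_t f t =
   \int[lebesgue_rV]_t \int[leb]_x f (row_cons (x, t)))%E.
Proof.
move=> mf f0; rewrite integral_row_cons//.
rewrite (@fubini_tonelli _ _ _ _ _ leb lebesgue_rV (fun p => f (row_cons p)))//.
by apply: measurableT_comp => //; exact: measurable_row_cons.
Qed.

Lemma measurable_row_add n (c : 'rV[R]_n) :
  measurable_fun setT (fun x : 'rV[R]_n => x + c).
Proof.
apply/measurable_rowP => i; under eq_fun do rewrite mxE.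
by apply: measurable_funD => //; exact: measurable_row_coord.
Qed.

Lemma measurable_fun_row_add n (c : 'rV[R]_n) (f : 'rV[R]_n -> \bar R) :
  measurable_fun setT f -> measurable_fun setT (fun x : 'rV[R]_n => f (x + c)).
Proof. by move=> mf; exact: (measurableT_comp mf (measurable_row_add c)). Qed.

Lemma measurable_mulmx n m (M : 'M[R]_(n, m)) :
  measurable_fun setT (fun v : 'rV[R]_n => v *m M).
Proof.
apply/measurable_rowP => i; under eq_fun do rewrite mxE.
apply: measurable_sum => j; apply: measurable_funM => //.
exact: measurable_row_coord.
Qed.

Lemma measurable_fun_row_mul n m (M : 'M[R]_(n, m)) (f : 'rV[R]_m -> \bar R) :
  measurable_fun setT f -> measurable_fun setT (fun x : 'rV[R]_n => f (x *m M)).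
Proof. by move=> mf; exact: (measurableT_comp mf (measurable_mulmx M)). Qed.

Lemma measurable_fun_row_cons n (f : 'rV[R]_n.+1 -> \bar R) :
  measurable_fun setT f -> measurable_fun setT (fun p => f (row_cons p)).
Proof. by move=> mf; exact: (measurableT_comp mf (@measurable_row_cons n)). Qed.

Lemma measurable_fun_row_cons1 n (f : 'rV[R]_n.+1 -> \bar R) x :
  measurable_fun setT f -> measurable_fun setT (fun t => f (row_cons (x, t))).
Proof.
move=> /measurable_fun_row_cons mf; exact: (measurableT_comp mf (measurable_pair1 x)).
Qed.

Lemma measurable_fun_row_cons2 n (f : 'rV[R]_n.+1 -> \bar R) t :
  measurable_fun setT f -> measurable_fun setT (fun x => f (row_cons (x, t))).
Proof.
move=> /measurable_fun_row_cons mf; exact: (measurableT_comp mf (measurable_pair2 t)).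
Qed.

Lemma measurable_integral_row_cons n (f : 'rV[R]_n.+1 -> \bar R) :
  measurable_fun setT f -> (forall x, 0 <= f x)%E ->
  measurable_fun setT (fun x : R => \int[lebesgue_rV]_t f (row_cons (x, t)))%E.
Proof.
move=> mf f0.
exact: (measurable_integral_snd (measurable_fun_row_cons mf) (fun=> f0 _)).
Qed.

Lemma integral_row_translate n (b : 'rV[R]_n) (f : 'rV[R]_n -> \bar R) :
  measurable_fun setT f -> (forall x, 0 <= f x)%E ->
  (\int[lebesgue_rV]_x f x = \int[lebesgue_rV]_x f (x + b)%R)%E.
Proof.
elim: n b f => [|n IHn] b f mf f0.
  by apply: eq_integral => x _; congr f; apply/rowP => -[].
have mfb := measurable_fun_row_add b mf.
rewrite (integral_row_cons mf f0) (integral_row_cons mfb (fun=> f0 _)).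
pose b' := \row_i b ord0 (lift ord0 i).
rewrite (integral_translate (b ord0 ord0)); first last.
- by move=> x; exact: integral_ge0.
- exact: measurable_integral_row_cons.
apply: eq_integral => x _.
rewrite (IHn b' _ (measurable_fun_row_cons1 _ mf) (fun=> f0 _)).
apply: eq_integral => t _; congr f; apply/rowP => i.
rewrite [RHS]mxE; case: (unliftP ord0 i) => [j ->|->].
  by rewrite !row_consS/= !mxE.
by rewrite !row_cons0.
Qed.

Definition change_of_variables n (M : 'M[R]_n) :=
  forall f : 'rV[R]_n -> \bar R,
  measurable_fun setT f -> (forall x, 0 <= f x)%E ->
  (\int[lebesgue_rV]_x f x =
   `|\det M|%:E * \int[lebesgue_rV]_x f (x *m M))%E.

Lemma change_of_variablesM n (M N : 'M[R]_n) :
  change_of_variables M -> change_of_variables N -> change_of_variables (M *m N).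
Proof.
move=> hM hN f mf f0.
rewrite (hN _ mf f0) (hM _ (measurable_fun_row_mul N mf) (fun=> f0 _)).
rewrite muleA -EFinM det_mulmx normrM mulrC; congr (_ * _)%E.
by apply: eq_integral => x _; rewrite mulmxA.
Qed.

Lemma row_cons_mul_ublock n (p : R * 'rV[R]_n) (a : R) (r : 'rV[R]_n) (M : 'M[R]_n) :
  row_cons p *m (block_mx a%:M r 0 M : 'M[R]_n.+1) =
  row_cons (a * p.1, p.2 *m M + p.1 *: r).
Proof.
apply: (etrans (mul_row_block (p.1)%:M p.2 a%:M r 0 M)).
rewrite /row_cons mulmx0 addr0/=.
by rewrite -scalar_mxM mul_scalar_mx addrC mulrC.
Qed.

Lemma row_cons_mul_lblock n (p : R * 'rV[R]_n) (c : 'cV[R]_n) :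
  row_cons p *m (block_mx 1%:M 0 c 1%:M : 'M[R]_n.+1) =
  row_cons (p.1 + (p.2 *m c) ord0 ord0, p.2).
Proof.
apply: (etrans (mul_row_block (p.1)%:M p.2 1%:M 0 c 1%:M)).
rewrite /row_cons !mulmx1 mulmx0 add0r/=.
congr (row_mx _ _); rewrite raddfD/=; congr (_ + _).
by apply/matrixP => i j; rewrite !ord1 [RHS]mxE eqxx mulr1n.
Qed.

(** Substitute x -> a x in the first coordinate; then, for fixed x, translate
    the others by x r and apply the formula for M. *)
Lemma change_of_variables_ublock n (a : R) (r : 'rV[R]_n) (M : 'M[R]_n) :
  a != 0 -> change_of_variables M ->
  change_of_variables (block_mx a%:M r 0 M : 'M[R]_n.+1).
Proof.
move=> a0 hM f mf f0.
set N := (block_mx _ _ _ _).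
have mfN := measurable_fun_row_mul N mf.
rewrite (integral_row_cons mf f0) (integral_row_cons mfN (fun=> f0 _)).
rewrite (integral_affine 0 a0); first last.
- by move=> x; exact: integral_ge0.
- exact: measurable_integral_row_cons.
rewrite [\det N](det_ublock a%:M r M) det_scalar1 normrM EFinM -muleA.
congr (_ * _)%E.
rewrite -ge0_integralZl_EFin; first last.
- by [].
- exact: (measurable_integral_row_cons mfN (fun=> f0 _)).
- by move=> x _; exact: integral_ge0.
- by [].
apply: eq_integral => x _; rewrite addr0.
have mg := measurable_fun_row_cons1 (a * x) mf.
rewrite (integral_row_translate (x *: r) mg (fun=> f0 _)).
rewrite (hM _ (measurable_fun_row_add _ mg) (fun=> f0 _)).
congr (_ * _)%E; apply: eq_integral => t _ /=.
by rewrite row_cons_mul_ublock.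
Qed.

(** A shear: for fixed remaining coordinates, the first one is translated. *)
Lemma change_of_variables_lblock n (c : 'cV[R]_n) :
  change_of_variables (block_mx 1%:M 0 c 1%:M : 'M[R]_n.+1).
Proof.
move=> f mf f0.
set N := (block_mx _ _ _ _).
have mfN := measurable_fun_row_mul N mf.
rewrite (integral_row_cons_swap mf f0) (integral_row_cons_swap mfN (fun=> f0 _)).
rewrite [\det N](det_lblock 1%:M c 1%:M) !det1 mulr1 normr1 mul1e.
apply: eq_integral => t _.
rewrite (integral_translate ((t *m c) ord0 ord0) (measurable_fun_row_cons2 t mf)
  (fun=> f0 _)).
by apply: eq_integral => x _ /=; rewrite row_cons_mul_lblock.
Qed.

(** Induction on the dimension: a matrix with nonzero corner entry is a lower
    times an upper block matrix, and the corner can be made nonzero by adding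
    another row to the first one. *)
Lemma change_of_variables_unit n (M : 'M[R]_n) :
  \det M != 0 -> change_of_variables M.
Proof.
elim: n M => [|n IHn] M detM.
  move=> f mf f0; rewrite det_mx00 normr1 mul1e.
  by apply: eq_integral => x _; congr f; apply/rowP => -[].
wlog a0 : M detM / M ord0 ord0 != 0 => [hwlog|].
  have [a0|a0] := eqVneq (M ord0 ord0) 0; last exact: hwlog.
  have [j Mj0] : exists j : 'I_n, M (lift ord0 j) ord0 != 0.
    apply: contrapT => /forallNP h; move/negP: detM; apply.
    rewrite (expand_det_col M ord0) big1// => i _.
    case: (unliftP ord0 i) => [j ->|->]; last by rewrite a0 mul0r.
    by have /negP := h j; rewrite negbK => /eqP ->; rewrite mul0r.
  pose E (e : R) : 'M[R]_n.+1 :=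
    block_mx (1%:M : 'M[R]_1) (e *: delta_mx ord0 j) 0 1%:M.
  have EE : E (-1) *m E 1 = 1%:M.
    apply: (etrans (@mulmx_block R 1 n 1 n 1 n 1%:M (-1 *: delta_mx ord0 j) 0 1%:M
      1%:M (1 *: delta_mx ord0 j) 0 1%:M)).
    rewrite !mulmx0 !mulmx1 !mul0mx mul1mx addr0 !add0r scaleN1r scale1r.
    by rewrite subrr -scalar_mx_block.
  have detE e : \det (E e) = 1.
    by rewrite [LHS](@det_ublock R 1 n 1%:M (e *: delta_mx ord0 j) 1%:M) !det1 mulr1.
  rewrite -(mul1mx M) -EE -mulmxA.
  apply: change_of_variablesM.
    apply: change_of_variables_ublock; rewrite ?oner_neq0//.
    by apply: IHn; rewrite det1 oner_neq0.
  apply: hwlog; first by rewrite det_mulmx detE mul1r.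
  rewrite mxE big_ord_recl a0 mulr0 add0r (bigD1 j)//= big1 ?addr0.
    rewrite /E /block_mx mxE; case: splitP => // k; rewrite (ord1 k) mxE => _.
    case: splitP => [k'|k']; first by rewrite (ord1 k').
    rewrite /= /bump !add1n => -[/ord_inj <-].
    by rewrite !mxE !eqxx mulr1 mul1r.
  move=> l lj; rewrite /E /block_mx mxE; case: splitP => // k; rewrite (ord1 k) mxE => _.
  case: splitP => [k'|k']; first by rewrite (ord1 k').
  rewrite /= /bump !add1n => -[/ord_inj <-].
  by rewrite !mxE eqxx (negbTE lj) mulr0 mul0r.
pose a := M ord0 ord0.
pose r : 'rV[R]_n := @ursubmx R 1 n 1 n M.
pose c : 'cV[R]_n := @dlsubmx R 1 n 1 n M.
pose D : 'M[R]_n := @drsubmx R 1 n 1 n M.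
have ME : M = block_mx (a%:M : 'M[R]_1) r c D.
  apply: (etrans (esym (@submxK R 1 n 1 n M))); congr block_mx.
  by rewrite [LHS]mx11_scalar !mxE; congr ((M _ _)%:M); exact/val_inj.
pose D' := D - a^-1 *: (c *m r).
have MLU : M = (block_mx (1%:M : 'M[R]_1) 0 (a^-1 *: c) 1%:M : 'M[R]_n.+1) *m
               (block_mx (a%:M : 'M[R]_1) r 0 D' : 'M[R]_n.+1).
  rewrite {1}ME; apply/esym/(etrans (mulmx_block 1%:M 0 (a^-1 *: c) 1%:M a%:M r 0 D')).
  rewrite !mul1mx !mul0mx !addr0 ?add0r; congr block_mx.
    by rewrite -scalemxAl mul_mx_scalar scalerA mulVf// scale1r.
  by rewrite -scalemxAl /D' addrC subrK.
rewrite MLU; apply: change_of_variablesM; first exact: change_of_variables_lblock.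
apply: change_of_variables_ublock => //; apply: IHn.
move: detM; rewrite MLU det_mulmx mulf_eq0 negb_or => /andP[_].
by rewrite [\det _](det_ublock a%:M r D') mulf_eq0 negb_or => /andP[].
Qed.

End row_integral.

(** * The volume of a simplex *)

Section integral_nonmeasurable.
Context d (T : measurableType d) (R : realType).
Variable mu : {measure set T -> \bar R}.

(** The integral of a nonnegative function is a supremum over simple functions,
    hence monotone without measurability. This matters for sets such as
    degenerate simplices, and for the random cell count. *)
Lemma le_nnintegral (f g : T -> \bar R) : (forall x, 0 <= f x)%E ->
  (forall x, f x <= g x)%E -> (\int[mu]_x f x <= \int[mu]_x g x)%E.
Proof.
move=> f0 fg; rewrite !ge0_integralTE//; last first.
  by move=> x; exact: le_trans (fg x).
apply: le_ereal_sup => _ [h /= hf <-]; exists h => //= x.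
exact: le_trans (fg x).
Qed.

End integral_nonmeasurable.

Section simplex.
Context (R : realType).
Notation leb := (@lebesgue_measure R).

(** Holds for arbitrary sets, whose measure is an iterated integral of possibly
    nonmeasurable functions. *)
Lemma le_tuple_measure d (T : measurableType d)
    (mu : {sigma_finite_measure set T -> \bar R}) n (A B : set (n.-tuple T)) :
  A `<=` B -> (tuple_measure mu n A <= tuple_measure mu n B)%E.
Proof.
elim: n A B => [|n IHn] A B AB.
  rewrite /= !diracE lee_fin ler_nat.
  by case: (boolP (_ \in A)) => //= /set_mem/AB/mem_set ->.
have SE (C : set (n.+1.-tuple T)) : tuple_measure mu n.+1 C =
  (\int[mu]_x tuple_measure mu n [set t : n.-tuple T | C [tuple of x :: t]])%E by [].
rewrite !SE; apply: le_nnintegral => x; first exact: measure_ge0.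
by apply: IHn => t /= /AB.
Qed.

Lemma le_lebesgue_rV n (A B : set 'rV[R]_n) :
  A `<=` B -> (lebesgue_rV A <= lebesgue_rV B)%E.
Proof. by move=> AB; apply: le_tuple_measure => t /= /AB. Qed.

Lemma lebesgue_rVE n (A : set 'rV[R]_n) : measurable A ->
  lebesgue_rV A = (\int[lebesgue_rV]_x (\1_A x)%:E)%E.
Proof. by move=> mA; rewrite integral_indic// setIT. Qed.

Lemma measurable_indicE d (T : measurableType d) (A : set T) : measurable A ->
  measurable_fun setT (fun x => (\1_A x : R)%:E).
Proof. by move=> mA; exact/measurable_EFinP/measurable_indic. Qed.

Lemma indic_ge0E T (A : set T) x : (0 <= (\1_A x : R)%:E)%E.
Proof. by rewrite lee_fin. Qed.

Lemma measurable_preimage d1 d2 (T1 : measurableType d1) (T2 : measurableType d2)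
  (f : T1 -> T2) (A : set T2) : measurable_fun setT f -> measurable A ->
  measurable (f @^-1` A).
Proof. by move=> mf mA; rewrite -[X in measurable X]setTI; exact: mf. Qed.

Lemma measurable_forall_ord d (T : measurableType d) n (A : 'I_n -> set T) :
  (forall i, measurable (A i)) -> measurable [set x | forall i, A i x].
Proof.
elim: n A => [|n IHn] A mA.
  by rewrite (_ : [set _ | _] = setT)//; apply/seteqP; split => x //= _ [].
rewrite (_ : [set _ | _] = A ord0 `&` [set x | forall i, A (lift ord0 i) x]).
  by apply: measurableI => //; exact: IHn.
apply/seteqP; split => x /=; first by move=> h; split => // i; exact: h.
by move=> [h0 h] i; case: (unliftP ord0 i) => [j ->|->].
Qed.

Lemma measurable_set_le d (T : measurableType d) (f g : T -> R) :
  measurable_fun setT f -> measurable_fun setT g ->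
  measurable [set x | f x <= g x].
Proof.
move=> mf mg.
rewrite (_ : [set _ | _] = (fun x => f x <= g x) @^-1` [set true]); last first.
  by apply/seteqP; split => x.
by apply: measurable_preimage => //; exact: measurable_fun_ler.
Qed.

Lemma measurable_set_lt d (T : measurableType d) (f g : T -> R) :
  measurable_fun setT f -> measurable_fun setT g ->
  measurable [set x | f x < g x].
Proof.
move=> mf mg.
rewrite (_ : [set _ | _] = (fun x => f x < g x) @^-1` [set true]); last first.
  by apply/seteqP; split => x.
by apply: measurable_preimage => //; exact: measurable_fun_ltr.
Qed.

Lemma measurable_hyperplane n (a : 'cV[R]_n) (b : R) :
  measurable [set x : 'rV[R]_n | (x *m a) ord0 ord0 = b].
Proof.
apply: (@measurable_preimage _ _ _ _ (fun x : 'rV[R]_n => (x *m a) ord0 ord0) [set b]) => //.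
exact: (measurableT_comp (measurable_row_coord ord0) (measurable_mulmx a)).
Qed.

(** Either the first coordinate has a nonzero coefficient, and then the lines
    parallel to it meet the hyperplane in one point, or the slices orthogonal to
    it are hyperplanes again. *)
Lemma lebesgue_rV_hyperplane n (a : 'cV[R]_n) (b : R) : a != 0 ->
  lebesgue_rV [set x : 'rV[R]_n | (x *m a) ord0 ord0 = b] = 0%E.
Proof.
elim: n a b => [|n IHn] a b a0.
  by move/eqP: a0; case; apply/matrixP => -[].
have mH := measurable_hyperplane a b.
rewrite (lebesgue_rVE mH).
have xaE x (t : 'rV[R]_n) : (row_cons (x, t) *m a) ord0 ord0 =
    x * a ord0 ord0 + (t *m \col_i a (lift ord0 i) ord0) ord0 ord0.
  rewrite !mxE big_ord_recl row_cons0; congr (_ + _).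
  by apply: eq_bigr => i _; rewrite row_consS !mxE.
have [a00|a00] := eqVneq (a ord0 ord0) 0.
  rewrite (integral_row_cons (measurable_indicE mH) (indic_ge0E _)).
  apply: integral0_eq => x _.
  rewrite -(IHn (\col_i a (lift ord0 i) ord0) b).
    rewrite (lebesgue_rVE (measurable_hyperplane _ _)).
    apply: eq_integral => t _; rewrite !indicE; congr (_%:R%:E); congr nat_of_bool.
    by apply/idP/idP => /set_mem /= h; apply/mem_set; move: h;
      rewrite /= xaE a00 mulr0 add0r.
  apply: contra_neq a0 => a'0; apply/matrixP => i j; rewrite (ord1 j) mxE.
  case: (unliftP ord0 i) => [k ->|->//].
  by move/matrixP: a'0 => /(_ k ord0); rewrite !mxE.
rewrite (integral_row_cons_swap (measurable_indicE mH) (indic_ge0E _)).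
apply: integral0_eq => t _.
set y := (b - (t *m \col_i a (lift ord0 i) ord0) ord0 ord0) / a ord0 ord0.
transitivity (\int[leb]_x (\1_[set y] x)%:E)%E; last first.
  by rewrite integral_indic// setIT; exact: lebesgue_measure_set1.
apply: eq_integral => x _; rewrite !indicE; congr (_%:R%:E); congr nat_of_bool.
apply/idP/idP => /set_mem /= h; apply/mem_set => /=; last first.
  by rewrite xaE h /y divfK// subrK.
by rewrite /y -h xaE addrK mulfK.
Qed.

(** The corner simplex, the model from which every simplex is obtained by an
    affine map. *)
Definition corner n (r : R) : set 'rV[R]_n :=
  [set y | (forall i, 0 <= y ord0 i) /\ \sum_i y ord0 i <= r].
Arguments corner : clear implicits.

Lemma measurable_corner n r : measurable (corner n r).
Proof.
have mS : measurable [set y : 'rV[R]_n | \sum_i y ord0 i <= r].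
  apply: measurable_set_le => //; apply: measurable_sum => i.
  exact: measurable_row_coord.
apply: measurableI => //; apply: measurable_forall_ord => i.
by apply: measurable_set_le => //; exact: measurable_row_coord.
Qed.

Lemma integral_FTC (f F : R -> R) (a b : R) : a <= b ->
  (forall x : R, is_derive x 1 F (f x)) -> continuous f ->
  (\int[leb]_(x in `[a, b]) (f x)%:E = (F b - F a)%:E)%E.
Proof.
rewrite le_eqVlt => /predU1P[->|ab] dF cf.
  by rewrite set_itv1 integral_set1 subrr.
rewrite (@continuous_FTC2 _ f F)//.
- exact: continuous_subspaceT.
- have cF : continuous F.
    by move=> x; apply/differentiable_continuous/derivable1_diffP/(@ex_derive _ _ _ _ _ _ _ (dF x)).
  split; first by move=> x _; exact: (@ex_derive _ _ _ _ _ _ _ (dF x)).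
  + by apply: cvg_at_right_filter; exact: cF.
  + by apply: cvg_at_left_filter; exact: cF.
- by move=> x _; rewrite derive1E; exact: (@derive_val _ _ _ _ _ _ _ (dF x)).
Qed.

Lemma integral_pow (n : nat) (r : R) : 0 <= r ->
  (\int[leb]_(x in `[0%R, r]) ((r - x) ^+ n)%:E = (r ^+ n.+1 / n.+1%:R)%:E)%E.
Proof.
move=> r0.
pose F : R -> R := (- (n.+1%:R)^-1) \*: ((cst r - (@idfun R : R -> R)) ^+ n.+1).
have FE x : F x = - (n.+1%:R)^-1 * (r - x) ^+ n.+1.
  by rewrite /F /= exprfctE.
have dF (x : R) : is_derive x 1 F ((r - x) ^+ n).
  apply: is_derive_eq; rewrite sub0r /=.
  change ((- n.+1%:R^-1) * ((n.+1%:R * (r - x) ^+ n) * -1) = (r - x) ^+ n :> R).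
  by field; rewrite addrC natr1.
rewrite (integral_FTC r0 dF).
  by rewrite !FE subrr subr0 expr0n/= mulr0 sub0r mulNr opprK mulrC.
move=> x; apply: (@continuous_comp _ _ _ (fun x => r - x) (fun y => y ^+ n)).
  by apply: cvgB => //; exact: cvg_cst.
exact: exprn_continuous.
Qed.

(** The slice at x of the corner of size r is the corner of size r - x in one
    dimension less. *)
Lemma lebesgue_rV_corner n (r : R) : 0 <= r ->
  lebesgue_rV (corner n r) = (r ^+ n / n`!%:R)%:E.
Proof.
elim: n r => [|n IHn] r r0.
  rewrite expr0 fact0 divr1 /lebesgue_rV/= /pushforward/= diracE mem_set//.
  split; first by case.
  by rewrite big_ord0.
rewrite (lebesgue_rVE (@measurable_corner n.+1 r)).
rewrite (integral_row_cons (measurable_indicE (@measurable_corner n.+1 r)) (indic_ge0E _)).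
transitivity (\int[leb]_(x in `[0%R, r]) ((n`!%:R)^-1%:E * ((r - x) ^+ n)%:E))%E.
  rewrite [RHS]integral_mkcond; apply: eq_integral => x _.
  rewrite patchE; case: ifPn => [|xr].
    rewrite inE/= in_itv/= => /andP[x0 xr].
    rewrite -EFinM mulrC -IHn ?subr_ge0// (lebesgue_rVE (@measurable_corner n (r - x))).
    apply: eq_integral => t _; rewrite !indicE; congr (_%:R%:E); congr nat_of_bool.
    apply/idP/idP => /set_mem [/= h1 h2]; apply/mem_set; split.
    + by move=> i; have := h1 (lift ord0 i); rewrite row_consS.
    + move: h2; rewrite big_ord_recl row_cons0/= lerBrDl.
      by under eq_bigr do rewrite row_consS.
    + by move=> i; case: (unliftP ord0 i) => [j ->|->]; rewrite ?row_consS ?row_cons0.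
    + rewrite big_ord_recl row_cons0/= -lerBrDl.
      by under eq_bigr do rewrite row_consS.
  rewrite -[RHS]/(0%E : \bar R).
  apply: integral0_eq => t _; rewrite indicE memNset// => -[h1 h2].
  move: xr; rewrite notin_setE /=; apply; rewrite in_itv/=.
  have := h1 ord0; rewrite row_cons0 /= => ->/=.
  apply: le_trans h2; rewrite big_ord_recl row_cons0/= lerDl; apply: sumr_ge0 => i _.
  exact: h1.
rewrite ge0_integralZl_EFin//; last 2 first.
- by move=> x /=; rewrite in_itv/= => /andP[_ xr]; rewrite lee_fin exprn_ge0// subr_ge0.
- apply/measurable_EFinP; apply: measurable_funX.
  by apply: measurable_funB.
rewrite integral_pow// -EFinM; congr EFin.
by rewrite factS natrM invfM mulrC -mulrA.
Qed.

Definition affine_mx n (v : 'I_n.+1 -> 'rV[R]_n) : 'M[R]_n.+1 :=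
  \matrix_(i < n.+1) row_cons (1, v i).

Definition edge_mx n (v : 'I_n.+1 -> 'rV[R]_n) : 'M[R]_n :=
  \matrix_(i < n) (v (lift ord0 i) - v ord0).

(** Row reduction by the first row, written as a matrix product. *)
Lemma det_affine_mx n (v : 'I_n.+1 -> 'rV[R]_n) :
  \det (affine_mx v) = \det (edge_mx v).
Proof.
pose L : 'M[R]_n.+1 := \matrix_(i < n.+1)
  row_cons (1, if unlift ord0 i is Some j then delta_mx ord0 j else 0).
pose U : 'M[R]_n.+1 := block_mx (1%:M : 'M[R]_1) (v ord0) 0 (edge_mx v).
have -> : affine_mx v = L *m U.
  apply/row_matrixP => i; rewrite rowK row_mul rowK row_cons_mul_ublock/= mul1r scale1r.
  congr (row_cons (_, _)); case: (unliftP ord0 i) => [j ->|->].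
    by rewrite -rowE rowK subrK.
  by rewrite mul0mx add0r.
have detU : \det U = \det (edge_mx v).
  by rewrite [LHS](@det_ublock R 1 n 1%:M (v ord0) (edge_mx v)) det1 mul1r.
rewrite det_mulmx detU det_trig ?big1 ?mul1r//.
  move=> i _; rewrite mxE; case: (unliftP ord0 i) => [j ->|->].
    by rewrite row_consS mxE !eqxx.
  by rewrite row_cons0.
apply/is_trig_mxP => i j; case: (unliftP ord0 j) => [j' ->|->]; last by rewrite ltn0.
rewrite mxE row_consS /=; case: (unliftP ord0 i) => [i' ->|->]; last by rewrite mxE.
by rewrite /= /bump !add1n ltnS mxE eqxx/= -val_eqE/= => /ltn_eqF; rewrite eq_sym => ->.
Qed.

(** The simplex is the image of the unit corner under the affine map with linear
    part the edge matrix. If the edge matrix is singular, the simplex lies in a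
    hyperplane, so the formula holds for degenerate simplices as well. *)
Lemma lebesgue_rV_simplex n (v : 'I_n.+1 -> 'rV[R]_n) :
  simplex_volume v = (`|\det (affine_mx v)| / n`!%:R)%:E.
Proof.
rewrite det_affine_mx /simplex_volume.
have simE x : simplex v x <-> exists2 y : 'rV[R]_n, corner n 1 y & x = v ord0 + y *m edge_mx v.
  split => [[c [c0 c1 ->]]|[y [y0 y1] ->]].
    exists (\row_i c (lift ord0 i)).
      split; first by move=> i; rewrite mxE.
      move: c1; rewrite big_ord_recl => c1.
      by under eq_bigr do rewrite mxE; rewrite -c1 lerDr.
    rewrite mulmx_sum_row.
    under [in RHS]eq_bigr do rewrite mxE rowK scalerBr.
    rewrite big_split/= sumrN -scaler_suml addrCA.
    rewrite (_ : v ord0 - _ = c ord0 *: v ord0); last first.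
      rewrite -[X in X - _]scale1r -scalerBl; congr (_ *: _).
      by rewrite -c1 big_ord_recl addrK.
    by rewrite big_ord_recl addrC.
  have [c cO cS] : exists2 c : 'I_n.+1 -> R, c ord0 = 1 - \sum_i y ord0 i &
      forall i : 'I_n, c (lift ord0 i) = y ord0 i.
    exists (fun i => if unlift ord0 i is Some j then y ord0 j else 1 - \sum_i y ord0 i).
      by rewrite unlift_none.
    move=> i; case: unliftP => [j /lift_inj ->//|/eqP].
    by rewrite eq_sym (negbTE (neq_lift _ _)).
  exists c; split.
  - by move=> i; case: (unliftP ord0 i) => [j ->|->]; rewrite ?cS ?cO// subr_ge0.
  - rewrite big_ord_recl cO.
    by under [X in _ + X]eq_bigr do rewrite cS; rewrite subrK.
  - rewrite big_ord_recl cO mulmx_sum_row.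
    under [X in _ = _ + X]eq_bigr do rewrite cS.
    under [in LHS]eq_bigr do rewrite rowK scalerBr.
    by rewrite big_split/= sumrN -scaler_suml addrCA scalerBl scale1r addrC.
have [detE|detE] := eqVneq (\det (edge_mx v)) 0.
  rewrite detE normr0 mul0r; apply/eqP; rewrite eq_le measure_ge0 andbT.
  have : \det (edge_mx v)^T == 0 by rewrite det_tr detE.
  move=> /det0P[a a0 aE].
  have aT0 : a^T != 0 by apply: contra_neq a0 => /(congr1 trmx); rewrite trmxK trmx0.
  rewrite -[0%:E](lebesgue_rV_hyperplane ((v ord0 *m a^T) ord0 ord0) aT0).
  apply: le_lebesgue_rV => x /simE[y _ ->] /=.
  rewrite mulmxDl -mulmxA (_ : edge_mx v *m a^T = 0) ?mulmx0 ?addr0//.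
  by rewrite -(trmxK (edge_mx v)) -trmx_mul aE trmx0.
have uE : edge_mx v \in unitmx by rewrite unitmxE unitfE.
have mS : measurable (simplex v).
  rewrite (_ : simplex v = (fun x => (x + - v ord0) *m invmx (edge_mx v)) @^-1` corner n 1).
    apply: measurable_preimage; last exact: measurable_corner.
    exact: (measurableT_comp (measurable_mulmx _) (measurable_row_add _)).
  apply/seteqP; split => x /=.
    by move=> /simE[y cy ->]; rewrite addrAC subrr add0r mulmxK.
  by move=> h; apply/simE; eexists; first exact: h;
    rewrite mulmxKV// addrC subrK.
rewrite (lebesgue_rVE mS).
rewrite (integral_row_translate (v ord0) (measurable_indicE mS) (indic_ge0E _)).
rewrite (change_of_variables_unit detE
  (measurable_fun_row_add (v ord0) (measurable_indicE mS)) (fun=> indic_ge0E _ _)).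
rewrite EFinM; congr (_ * _)%E.
rewrite -[RHS](_ : (1 ^+ n / n`!%:R)%:E = _); last by rewrite expr1n mul1r.
rewrite -lebesgue_rV_corner// (lebesgue_rVE (@measurable_corner n 1)).
apply: eq_integral => y _; rewrite !indicE; congr (_%:R%:E); congr nat_of_bool.
apply/idP/idP => /set_mem h; apply/mem_set.
  have /simE[z cz] := h; rewrite addrC => /addrI/(congr1 (mulmx^~ (invmx (edge_mx v)))).
  by rewrite !mulmxK// => ->.
by apply/simE; exists y => //; rewrite addrC.
Qed.

End simplex.

(** * Balls and the Gaussian integral *)

Section ball.
Context (R : realType).
Notation leb := (@lebesgue_measure R).

Lemma measurable_sqnorm n : measurable_fun setT (@sqnorm R n).
Proof.
apply: measurable_sum => i; apply: measurable_funX; exact: measurable_row_coord.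
Qed.

Lemma sqnorm_ge0 n (v : 'rV[R]_n) : 0 <= sqnorm v.
Proof. by apply: sumr_ge0 => i _; exact: sqr_ge0. Qed.

Lemma sqnormZ n (a : R) (v : 'rV[R]_n) : sqnorm (a *: v) = a ^+ 2 * sqnorm v.
Proof.
by rewrite /sqnorm mulr_sumr; apply: eq_bigr => i _; rewrite mxE exprMn.
Qed.

Lemma integral_row_scale n (a : R) (f : 'rV[R]_n -> \bar R) : a != 0 ->
  measurable_fun setT f -> (forall x, 0 <= f x)%E ->
  (\int[lebesgue_rV]_x f x = (`|a| ^+ n)%:E * \int[lebesgue_rV]_x f (a *: x))%E.
Proof.
move=> a0 mf f0; rewrite (@change_of_variables_unit _ _ a%:M) ?det_scalar ?expf_neq0//.
rewrite normrX; congr (_ * _)%E.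
by apply: eq_integral => x _; rewrite mul_mx_scalar.
Qed.

Lemma measurable_set_ball n (s : R) : measurable [set v : 'rV[R]_n | sqnorm v < s].
Proof. by apply: measurable_set_lt => //; exact: measurable_sqnorm. Qed.

Definition unit_ball_measure n := lebesgue_rV [set v : 'rV[R]_n | sqnorm v < 1].

Lemma powR_half_sqrt (s : R) n : 0 <= s -> Num.sqrt s ^+ n = s `^ (n%:R / 2).
Proof. by move=> s0; rewrite -powR12_sqrt// -powR_mulrn ?powR_ge0// -powRrM mulrC. Qed.

Lemma lebesgue_rV_ball n (s : R) : 0 < s ->
  lebesgue_rV [set v : 'rV[R]_n | sqnorm v < s] =
  ((s `^ (n%:R / 2))%:E * unit_ball_measure n)%E.
Proof.
move=> s0; have sq0 : Num.sqrt s != 0 by rewrite gt_eqF// sqrtr_gt0.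
rewrite (lebesgue_rVE (measurable_set_ball s)).
rewrite (integral_row_scale sq0 (measurable_indicE (measurable_set_ball s))
  (fun=> indic_ge0E _ _ _)).
rewrite ger0_norm ?sqrtr_ge0// powR_half_sqrt 1?ltW//; congr (_ * _)%E.
rewrite /unit_ball_measure (lebesgue_rVE (measurable_set_ball 1)).
apply: eq_integral => v _; rewrite !indicE; congr (_%:R%:E); congr nat_of_bool.
have E : (sqnorm (Num.sqrt s *: v) < s) = (sqnorm v < 1).
  rewrite sqnormZ sqr_sqrtr; last exact: ltW.
  by rewrite -{2}(mulr1 s) ltr_pM2l.
by apply/idP/idP => /set_mem /= h; apply/mem_set; move: h => /=; rewrite E.
Qed.

(** The Gaussian density factorizes over the coordinates. Evaluated through
    balls, the same integral identifies the volume of the unit ball, see below.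
    *)
Lemma integral_gauss_rV n :
  (\int[lebesgue_rV]_(v in [set: 'rV[R]_n]) (expR (- sqnorm v))%:E =
   (pi `^ (n%:R / 2))%:E)%E.
Proof.
have mg k : measurable_fun setT (fun v : 'rV[R]_k => (expR (- sqnorm v))%:E).
  apply/measurable_EFinP; apply: measurableT_comp => //.
  by apply: measurableT_comp => //; exact: measurable_sqnorm.
have g0 k (v : 'rV[R]_k) : (0 <= (expR (- sqnorm v))%:E)%E by rewrite lee_fin expR_ge0.
elim: n => [|n IHn].
  rewrite mul0r powRr0 -[RHS]mul1e.
  rewrite (eq_integral (cst 1%E)); last first.
    by move=> v _; rewrite /sqnorm big_ord0 oppr0 expR0.
  rewrite integral_cst// mul1e mul1e.
  by rewrite /= /lebesgue_rV/= /pushforward/= diracE mem_set.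
rewrite (integral_row_cons (mg _) (g0 _)).
transitivity (\int[leb]_x ((pi `^ (n%:R / 2))%:E * (gauss_fun x)%:E))%E.
  apply: eq_integral => x _; rewrite -IHn muleC.
  rewrite -(ge0_integralZl_EFin _ _ (fun v _ => g0 n v) (mg n))//; last exact: expR_ge0.
  apply: eq_integral => v _; rewrite -EFinM -expRD; congr (expR _)%:E.
  rewrite /sqnorm big_ord_recl row_cons0 opprD; congr (_ - _).
  by apply: eq_bigr => i _; rewrite row_consS.
rewrite ge0_integralZl_EFin ?powR_ge0//.
- rewrite integralT_gauss -EFinM; congr EFin.
  rewrite -powR12_sqrt ?pi_ge0// -powRD; last by rewrite gt_eqF ?pi_gt0// implybT.
  by rewrite -[n.+1%:R]natr1 mulrDl mul1r.
- by move=> x _; rewrite lee_fin expR_ge0.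
- by apply/measurable_EFinP; exact: measurable_gauss_fun.
Qed.

(** Gamma as an extended real, so that convergence of the integral can be a
    conclusion rather than a hypothesis. *)
Definition eGamma (x : R) : \bar R :=
  (\int[leb]_(t in `]0%R, +oo[) (t `^ (x - 1) * expR (- t))%:E)%E.

Lemma GammaE x : Gamma x = fine (eGamma x).
Proof. by []. Qed.

Lemma integral_expRN (a : R) :
  (\int[leb]_x ((expR (- x))%:E * (\1_[set x | a < x] x)%:E) = (expR (- a))%:E)%E.
Proof.
transitivity (\int[leb]_(x in `]a, +oo[) (expR (- x))%:E)%E.
  rewrite [RHS]integral_mkcond; apply: eq_integral => x _; rewrite patchE indicE.
  have -> : (x \in [set x | a < x]) = (x \in [set` `]a, +oo[]).
    by apply/idP/idP => /set_mem /= h; apply/mem_set; move: h; rewrite /= in_itv/= andbT.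
  by case: ifP; rewrite ?mule1 ?mule0.
rewrite integral_itv_obnd_cbnd; last first.
  by apply/measurable_EFinP/measurable_funTS; apply: measurableT_comp.
have dF (x : R) : is_derive x 1 (- (expR \o -%R) : R -> R) (expR (- x)).
  apply: is_derive_eq; first by rewrite mulrN1 opprK.
rewrite (@ge0_continuous_FTC2y _ (fun x => expR (- x)) (- (expR \o -%R)) a 0).
- by rewrite sub0e -EFinN /= -[(- _) a]/(- expR (- a)) opprK.
- by move=> x _; exact: expR_ge0.
- apply: continuous_subspaceT => x.
  apply: (@continuous_comp _ _ _ (-%R) expR); first exact: opp_continuous.
  exact: continuous_expR.
- rewrite -[X in _ --> X]oppr0; apply: cvgN.
  exact: cvgr_expR.
- by move=> x _; exact: (@ex_derive _ _ _ _ _ _ _ (dF x)).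
- apply: cvg_at_right_filter; apply: differentiable_continuous.
  by apply/derivable1_diffP; exact: (@ex_derive _ _ _ _ _ _ _ (dF a)).
- by move=> x _; rewrite derive1E; exact: (@derive_val _ _ _ _ _ _ _ (dF x)).
Qed.

Lemma powR_cvg0 (p : R) : 0 < p -> y `^ p @[y --> 0^'+] --> (0 : R).
Proof.
move=> p0; apply/cvgrPdist_lt => e e0; near=> y.
have y0 : 0 < y by [].
rewrite sub0r normrN ger0_norm ?powR_ge0//.
have -> : e = (e `^ p^-1) `^ p by rewrite -powRrM mulVf ?powRr1 ?gt_eqF// ltW.
rewrite gt0_ltr_powR// ?nnegrE ?powR_ge0 ?(ltW y0)//.
by near: y; apply: nbhs_right_lt; rewrite powR_gt0.
Unshelve. all: end_near.
Qed.

Lemma integral_powR (p t : R) : 0 < p -> 0 < t ->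
  (\int[leb]_(y in `[0%R, t]) (y `^ p)%:E = (t `^ (p + 1) / (p + 1))%:E)%E.
Proof.
move=> p0 t0; have p10 : 0 < p + 1 by rewrite addr_gt0.
have cvgp (q x : R) : 0 < x -> y `^ q @[y --> x] --> x `^ q.
  move=> x0.
  have : {for x, continuous (@powR R ^~ q)}; last exact.
  apply: differentiable_continuous.
  by apply/derivable1_diffP; apply: derivable_powR; rewrite in_itv/= andbT.
rewrite (@continuous_FTC2 _ (fun y => y `^ p) ((p + 1)^-1 \*: (@powR R ^~ (p + 1))) 0 t)//.
- by rewrite /= powR0 ?gt_eqF// scaler0 sube0 mulrC.
- apply/continuous_within_itvP => //; split.
  + by move=> x; rewrite in_itv/= => /andP[x0 _]; exact: cvgp.
  + by rewrite powR0 ?gt_eqF//; exact: powR_cvg0.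
  + by apply: cvg_at_left_filter; exact: cvgp.
- split.
  + move=> x; rewrite in_itv/= => /andP[x0 _].
    by apply: derivableZ; apply: derivable_powR; rewrite in_itv/= andbT.
  + rewrite /= powR0 ?gt_eqF//; apply: cvgZr.
    exact: powR_cvg0.
  + by apply: cvg_at_left_filter; apply: cvgZr; exact: cvgp.
- move=> x; rewrite in_itv/= => /andP[x0 _]; rewrite derive1E deriveZ/=.
    have [_ ->] := is_derive1_powR (p + 1) x0.
    by rewrite addrK scalerA mulVf ?gt_eqF// scale1r.
  by apply: derivable_powR; rewrite in_itv/= andbT.
Qed.

End ball.

(** * The Gamma function and the incomplete beta integral *)

Section gamma_function.
Context (R : realType).
Notation leb := (@lebesgue_measure R).

Lemma integral_mulindic d (T : measurableType d) (mu : {measure set T -> \bar R})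
    (D : set T) (f : T -> \bar R) :
  (\int[mu]_(x in D) f x = \int[mu]_x (f x * (\1_D x)%:E))%E.
Proof.
rewrite integral_mkcond; apply: eq_integral => x _; rewrite patchE indicE.
by case: ifP => _; rewrite ?mule1 ?mule0.
Qed.

Lemma measurable_lt_prod d (T : measurableType d) (f g : T -> R) :
  measurable_fun setT f -> measurable_fun setT g ->
  measurable_fun setT (fun p => (\1_[set x | f x < g x] p : R)%:E).
Proof. by move=> mf mg; apply: measurable_indicE; exact: measurable_set_lt. Qed.

Lemma indic_set (T : Type) (P : pred T) x : (\1_[set y | P y] x = (P x)%:R :> R)%R.
Proof. by rewrite indicE; congr (nat_of_bool _)%:R; apply/idP/idP; rewrite inE. Qed.

Lemma integral_itv0y (f : R -> \bar R) :
  (\int[leb]_(x in `]0%R, +oo[) f x = \int[leb]_x (f x * ((0 < x)%R%:R)%:E))%E.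
Proof.
rewrite integral_mulindic; apply: eq_integral => x _; congr (_ * (_ : R)%:E)%E.
rewrite indicE; congr (nat_of_bool _)%:R.
by apply/idP/idP; rewrite inE /= in_itv/= andbT.
Qed.

Lemma eGammaE (x : R) :
  (eGamma x = \int[leb]_t ((t `^ (x - 1) * expR (- t))%:E * ((0 < t)%R%:R)%:E))%E.
Proof. exact: integral_itv0y. Qed.

Lemma measurable_expRN : measurable_fun setT (fun x : R => expR (- x)).
Proof. exact: measurableT_comp. Qed.

Lemma measurable_bool_lt d (T : measurableType d) (f g : T -> R) :
  measurable_fun setT f -> measurable_fun setT g ->
  measurable_fun setT (fun p => ((f p < g p)%R%:R : R)%:E).
Proof.
move=> mf mg; have := measurable_lt_prod mf mg.
by apply: eq_measurable_fun => x _; rewrite indic_set.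
Qed.

Lemma eGamma_ge0 (x : R) : (0 <= eGamma x)%E.
Proof.
by apply: integral_ge0 => t _; rewrite lee_fin mulr_ge0 ?powR_ge0 ?expR_ge0.
Qed.

Lemma lebesgue_rV_ball0 n (s : R) : s <= 0 ->
  lebesgue_rV [set v : 'rV[R]_n | sqnorm v < s] = 0%E.
Proof.
move=> s0; rewrite (_ : [set _ | _] = set0) ?measure0//.
apply/seteqP; split => v //=; apply/negP; rewrite -leNgt.
exact: le_trans (sqnorm_ge0 v).
Qed.

(** Write exp(- |v|^2) as the integral of exp(- r) over r > |v|^2 and exchange
    the integrals: the Gaussian integral is a mean of volumes of balls. *)
Lemma unit_ball_eGamma n :
  (unit_ball_measure R n * eGamma (1 + n%:R / 2) = (pi `^ (n%:R / 2))%:E)%E.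
Proof.
rewrite -integral_gauss_rV.
have mf : measurable_fun setT (fun p : 'rV[R]_n * R =>
    ((expR (- p.2))%:E * ((sqnorm p.1 < p.2)%R%:R)%:E)%E).
  apply: emeasurable_funM.
    by apply/measurable_EFinP; exact: (measurableT_comp measurable_expRN).
  apply: measurable_bool_lt; last exact: measurable_snd.
  by apply: measurableT_comp; [exact: measurable_sqnorm|exact: measurable_fst].
transitivity (\int[lebesgue_rV]_(v in [set: 'rV[R]_n]) \int[leb]_r
    ((expR (- r))%:E * ((sqnorm v < r)%R%:R)%:E))%E; last first.
  apply: eq_integral => v _; rewrite -[RHS]integral_expRN.
  by apply: eq_integral => r _; rewrite indic_set.
rewrite (@fubini_tonelli _ _ _ _ _ lebesgue_rV leb _ mf); last first.
  by move=> p; rewrite mule_ge0// lee_fin ?expR_ge0.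
rewrite eGammaE -ge0_integralZl//; last 2 first.
- apply: emeasurable_funM; last by apply: measurable_bool_lt.
  apply/measurable_EFinP/measurable_funM; last exact: measurable_expRN.
  exact: measurable_powR.
- by move=> t _; rewrite mule_ge0// lee_fin ?mulr_ge0 ?powR_ge0 ?expR_ge0.
apply: eq_integral => r _.
apply/esym; rewrite /= ge0_integralZl//; last first.
  by apply: measurable_bool_lt => //; exact: measurable_sqnorm.
transitivity ((expR (- r))%:E * lebesgue_rV [set v : 'rV[R]_n | (sqnorm v < r)%R])%E.
  rewrite (lebesgue_rVE (measurable_set_ball r)); congr (_ * _)%E.
  by apply: eq_integral => v _; rewrite indic_set.
have [r0|r0] := ltP 0 r; last by rewrite lebesgue_rV_ball0// !mule0.
rewrite lebesgue_rV_ball// mule1 muleA -EFinM muleC; congr (_ * _%:E)%E.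
by rewrite mulrC [1 + _]addrC addrK.
Qed.

(** Both factors of the previous identity are nonnegative and their product is
    positive and finite, so neither can be zero or infinite. *)
Lemma unit_ball_fin n :
  exists2 u : R, 0 < u & unit_ball_measure R n = u%:E.
Proof.
have := unit_ball_eGamma n; have : (0 <= unit_ball_measure R n)%E by exact: measure_ge0.
have p0 : 0 < (pi : R) `^ (n%:R / 2) by rewrite powR_gt0// pi_gt0.
have g0 := eGamma_ge0 (1 + n%:R / 2).
case: (unit_ball_measure R n) => [u| |]//.
  rewrite lee_fin le_eqVlt => /predU1P[<-|u0 _]; last by exists u.
  by rewrite mul0e => -[/esym/eqP]; rewrite gt_eqF.
move=> _; move: g0; rewrite le_eqVlt => /predU1P[<-|g0].
  by rewrite mule0 => -[/esym/eqP]; rewrite gt_eqF.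
by rewrite gt0_mulye.
Qed.

Lemma eGamma_half_fin n :
  exists2 g : R, 0 < g & eGamma (1 + n%:R / 2 : R) = g%:E.
Proof.
have [u u0 uE] := unit_ball_fin n.
have := unit_ball_eGamma n; rewrite uE.
have p0 : 0 < (pi : R) `^ (n%:R / 2) by rewrite powR_gt0// pi_gt0.
have := eGamma_ge0 (1 + n%:R / 2).
case: (eGamma _) => [g| |]//.
  rewrite lee_fin le_eqVlt => /predU1P[<-|g0 _]; last by exists g.
  by rewrite mule0 => -[/esym/eqP]; rewrite gt_eqF.
by rewrite gt0_muley.
Qed.

Lemma unit_ball_measureE n : unit_ball_measure R n = (ball_volume n)%:E.
Proof.
have [u u0 uE] := unit_ball_fin n; have [g g0 gE] := eGamma_half_fin n.
have := unit_ball_eGamma n; rewrite uE gE => -[h].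
by rewrite /ball_volume GammaE gE/= -h mulfK// gt_eqF.
Qed.

Lemma integral_powR_oo (p t : R) : 0 < p -> 0 < t ->
  (\int[leb]_y ((y `^ p)%:E * ((0 < y < t)%R%:R)%:E) = (t `^ (p + 1) / (p + 1))%:E)%E.
Proof.
move=> p0 t0; rewrite -integral_powR//.
rewrite (@integral_itv_bndoo R 0 t); last first.
  apply/measurable_EFinP/measurable_funTS; exact: measurable_powR.
rewrite [RHS]integral_mulindic; apply: eq_integral => y _.
congr (_ * _%:E)%E; rewrite indicE; congr (nat_of_bool _)%:R.
by apply/idP/idP; rewrite inE /= in_itv.
Qed.

(** Instead of an integration by parts, write t^(p+1) as the integral of (p+1)
    y^p over 0 < y < t and exchange the integrals. This gives an identity of
    extended reals, without convergence to discuss. *)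
Lemma eGamma_rec (p : R) : 0 < p -> eGamma (p + 1 + 1) = ((p + 1)%:E * eGamma (p + 1))%E.
Proof.
move=> p0.
have p10 : 0 < p + 1 by rewrite addr_gt0.
pose f (q : R * R) : \bar R := (((p + 1) * (q.2 `^ p * expR (- q.1)))%:E *
  (((0 < q.2)%R%:R)%:E * ((q.2 < q.1)%R%:R)%:E))%E.
have mf : measurable_fun setT f.
  apply: emeasurable_funM.
    apply/measurable_EFinP; apply: measurable_funM => //; apply: measurable_funM.
      exact: (measurableT_comp (measurable_powR p) measurable_snd).
    exact: (measurableT_comp measurable_expRN measurable_fst).
  by apply: emeasurable_funM; apply: measurable_bool_lt.
have f0 q : (0 <= f q)%E.
  by rewrite /f !mule_ge0// lee_fin// !mulr_ge0 ?powR_ge0 ?expR_ge0// ltW.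
transitivity (\int[leb]_t \int[leb]_y f (t, y))%E.
  rewrite eGammaE; apply: eq_integral => t _.
  have [t0|t0] := ltP 0 t; last first.
    rewrite mule0 /f/= integral0_eq// => y _ /=.
    have [y0|] := ltP 0 y; last by rewrite mul0e mule0.
    by rewrite (lt_gtF (le_lt_trans t0 y0)) mule0 mule0.
  transitivity (((p + 1) * expR (- t))%:E *
      \int[leb]_y ((y `^ p)%:E * ((0 < y < t)%R%:R)%:E))%E.
    rewrite integral_powR_oo// mule1 -EFinM; congr EFin.
    rewrite addrK mulrC [X in _ = X]mulrAC mulrCA divff ?mulr1 1?mulrC//.
    by rewrite gt_eqF.
  rewrite -ge0_integralZl_EFin//; last 3 first.
  - by move=> y _; rewrite -EFinM lee_fin mulr_ge0// powR_ge0.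
  - apply: emeasurable_funM; first by apply/measurable_EFinP; apply: measurable_powR.
    rewrite (_ : (fun x => _) = (fun x => ((0 < x)%R%:R)%:E * ((x < t)%R%:R)%:E)%E).
      by apply: emeasurable_funM; apply: measurable_bool_lt.
    by apply/funext => x; rewrite -EFinM -natrM mulnb.
  - by rewrite mulr_ge0 ?expR_ge0// ltW.
  apply: eq_integral => y _; rewrite /f/= -!EFinM -natrM mulnb; congr EFin.
  by rewrite !mulrA; congr (_ * _); rewrite mulrAC.
rewrite (@fubini_tonelli _ _ _ _ _ leb leb _ mf f0).
rewrite eGammaE -ge0_integralZl_EFin//; last 3 first.
- by move=> t _; rewrite mule_ge0// lee_fin ?mulr_ge0 ?powR_ge0 ?expR_ge0.
- apply: emeasurable_funM; last by apply: measurable_bool_lt.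
  apply/measurable_EFinP/measurable_funM; last exact: measurable_expRN.
  exact: measurable_powR.
- exact: ltW.
apply: eq_integral => y _; rewrite addrK.
transitivity ((((p + 1) * y `^ p) * (0 < y)%R%:R)%:E *
    \int[leb]_t ((expR (- t))%:E * ((y < t)%R%:R)%:E))%E.
  rewrite -ge0_integralZl_EFin//; last 2 first.
  - apply: emeasurable_funM; first by apply/measurable_EFinP; apply: measurable_expRN.
    by apply: measurable_bool_lt.
  - by rewrite !mulr_ge0 ?powR_ge0// ltW.
  apply: eq_integral => t _; rewrite /f/= -!EFinM; congr EFin.
  by rewrite !mulrA; congr (_ * _); rewrite mulrAC.
rewrite (_ : (\int[leb]_t _)%E = (expR (- y))%:E); last first.
  by rewrite -integral_expRN; apply: eq_integral => r _; rewrite indic_set.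
by rewrite -!EFinM; congr EFin; rewrite -!mulrA; congr (_ * (_ * _)); rewrite mulrC.
Qed.

Lemma pochhammerS (a : R) k : pochhammer a k.+1 = pochhammer a k * (a + k%:R).
Proof. by rewrite /pochhammer big_ord_recr. Qed.

Lemma pochhammer_gt0 (a : R) k : 0 < a -> 0 < pochhammer a k.
Proof.
move=> a0; apply: prodr_gt0 => i _; rewrite ltr_pwDl//.
Qed.

Lemma pochhammer_shift (a : R) k :
  pochhammer (a + 1) k * a = pochhammer a k * (a + k%:R).
Proof.
elim: k => [|k IHk]; first by rewrite /pochhammer !big_ord0 !mul1r addr0.
by rewrite !pochhammerS mulrAC IHk -addrA (addrC 1) natr1.
Qed.

(** Iterated functional equation; it makes Pochhammer symbols appear as Gamma
    integrals. *)
Lemma eGamma_pochhammer (p : R) k : 0 < p ->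
  eGamma (p + 1 + k%:R) = ((pochhammer (p + 1) k)%:E * eGamma (p + 1))%E.
Proof.
move=> p0; elim: k => [|k IHk]; first by rewrite /pochhammer big_ord0 addr0 mul1e.
rewrite -natr1 addrA (_ : p + 1 + k%:R + 1 = (p + k%:R) + 1 + 1); last by ring.
have pk0 : 0 < p + k%:R by rewrite ltr_wpDr.
rewrite (eGamma_rec pk0) (_ : p + k%:R + 1 = p + 1 + k%:R); last by ring.
by rewrite IHk muleA -EFinM mulrC pochhammerS.
Qed.

Lemma nneseries_expR (x : R) : 0 <= x ->
  (\sum_(0 <= k <oo) (x ^+ k / k`!%:R)%:E)%E = (expR x)%:E.
Proof.
move=> x0; rewrite /expR -EFin_lim; last exact: is_cvg_series_exp_coeff.
by apply/congr_lim/funext => n; rewrite /= sumEFin.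
Qed.

Lemma eGamma_scale (x b : R) : 0 < b ->
  (\int[leb]_t ((t `^ (x - 1) * expR (- (b * t)))%:E * ((0 < t)%R%:R)%:E) =
   (b `^ (- x))%:E * eGamma x)%E.
Proof.
move=> b0; set f := fun t : R => ((t `^ (x - 1) * expR (- (b * t)))%:E * ((0 < t)%R%:R)%:E)%E.
have mf : measurable_fun setT f.
  apply: emeasurable_funM; last by apply: measurable_bool_lt.
  apply/measurable_EFinP/measurable_funM; first exact: measurable_powR.
  by apply: (measurableT_comp measurable_expRN); apply: measurable_funM.
have bV0 : 0 < b^-1 by rewrite invr_gt0.
rewrite (@integral_affine_pos _ b^-1 0 f bV0 mf); last first.
  by move=> t; rewrite mule_ge0// lee_fin ?mulr_ge0 ?powR_ge0 ?expR_ge0.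
transitivity (b^-1%:E * \int[leb]_t ((b `^ (1 - x))%:E *
    ((t `^ (x - 1) * expR (- t))%:E * ((0 < t)%R%:R)%:E)))%E.
  congr (_ * _)%E; apply: eq_integral => t _.
  rewrite addr0 /f mulrA mulfV ?gt_eqF// mul1r pmulr_rgt0//.
  have [t0|t0] := ltP 0 t; last by rewrite !mule0.
  rewrite !mule1 -EFinM mulrA powRM ?ltW//; congr (_ * _ * _)%:E.
  by rewrite -powR_inv1 ?ltW// -powRrM mulN1r opprB.
rewrite ge0_integralZl_EFin; first last.
- exact: powR_ge0.
- apply: emeasurable_funM; last by apply: measurable_bool_lt.
  by apply/measurable_EFinP; apply: measurable_funM; [exact: measurable_powR|exact: measurable_expRN].
- by move=> t _; rewrite mule_ge0// lee_fin ?mulr_ge0 ?powR_ge0 ?expR_ge0.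
- exact: measurableT.
rewrite -eGammaE muleA -EFinM -(powR_inv1 (ltW b0)) -powRD; last first.
  by rewrite (gt_eqF b0) implybT.
by congr ((_ `^ _)%:E * _)%E; ring.
Qed.

(** Multiply by Gamma(a): the coefficients become the integrals of t^(a+k-1)
    exp(-t) / k!, and summing under the integral replaces exp(-t) by exp(-(1-u)
    t). Half-integer exponents suffice, for which Gamma(a) is known to be finite
    from the volume of the ball. *)
Lemma binomial_series (n : nat) (u : R) : (0 < n)%N -> 0 <= u -> u < 1 ->
  let a := 1 + n%:R / 2 in
  (\sum_(0 <= k <oo) (pochhammer a k / k`!%:R * u ^+ k)%:E)%E = ((1 - u) `^ (- a))%:E.
Proof.
move=> n0 u0 u1 a.
have p0 : 0 < (n%:R / 2 : R) by rewrite divr_gt0// ltr0n.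
have aE : a = n%:R / 2 + 1 by rewrite addrC.
have a0 : 0 < a by rewrite aE addr_gt0.
have [g g0 gE] := eGamma_half_fin n.
suff : (g%:E * \sum_(0 <= k <oo) (pochhammer a k / k`!%:R * u ^+ k)%:E =
    g%:E * ((1 - u) `^ (- a))%:E)%E.
  move=> /(congr1 (mule (g^-1)%:E)).
  have gg : ((g^-1)%:E * g%:E = 1)%E by rewrite -EFinM mulVf ?gt_eqF.
  by rewrite !muleA gg !mul1e.
rewrite [RHS]muleC -gE -eGamma_scale ?subr_gt0// gE.
have ck0 k : 0 <= pochhammer a k / k`!%:R * u ^+ k.
  by rewrite mulr_ge0 ?exprn_ge0// divr_ge0 ?ler0n// ltW ?pochhammer_gt0.
rewrite -nneseriesZl; last by move=> k _; rewrite lee_fin.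
pose h k t := ((u ^+ k / k`!%:R)%:E * ((t `^ (a + k%:R - 1) * expR (- t))%:E * ((0 < t)%R%:R)%:E))%E.
have h0 k t : (0 <= h k t)%E.
  rewrite /h !mule_ge0// lee_fin ?mulr_ge0 ?powR_ge0 ?expR_ge0//.
  exact: exprn_ge0.
have mh0 k : measurable_fun setT (fun t => ((t `^ (a + k%:R - 1) * expR (- t))%:E * ((0 < t)%R%:R)%:E)%E).
  apply: emeasurable_funM; last by apply: measurable_bool_lt.
  by apply/measurable_EFinP; apply: measurable_funM; [exact: measurable_powR|exact: measurable_expRN].
have mh k : measurable_fun setT (h k) by exact: measurable_funeM.
transitivity (\sum_(0 <= k <oo) \int[leb]_t h k t)%E.
  apply: eq_eseriesr => k _.
  rewrite /h ge0_integralZl_EFin; first last.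
  - by rewrite divr_ge0 ?exprn_ge0// ler0n.
  - exact: mh0.
  - by move=> t _; rewrite mule_ge0// lee_fin ?mulr_ge0 ?powR_ge0 ?expR_ge0.
  - exact: measurableT.
  rewrite -eGammaE aE eGamma_pochhammer// -aE gE -!EFinM; congr EFin.
  by ring.
rewrite -integral_nneseries//.
apply: eq_integral => t _.
have [t0|t0] := ltP 0 t; last first.
  by rewrite mule0 eseries0// => k _ _; rewrite /h ltNge t0 mule0 mule0.
rewrite mule1.
transitivity (\sum_(0 <= k <oo) ((t `^ (a - 1) * expR (- t))%:E * ((u * t) ^+ k / k`!%:R)%:E))%E.
  apply: eq_eseriesr => k _; rewrite /h t0 mule1 -!EFinM; congr EFin.
  rewrite [a + _ - 1]addrAC [t `^ (_ + _)]powRD; last by rewrite (gt_eqF t0) implybT.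
  by rewrite powR_mulrn 1?ltW// exprMn; ring.
have ut0 : 0 <= u * t by rewrite mulr_ge0// ltW.
rewrite nneseriesZl; last by move=> k _; rewrite lee_fin divr_ge0 ?exprn_ge0 ?ler0n.
rewrite nneseries_expR// -EFinM -mulrA -expRD; congr (_ * expR _)%:E.
by ring.
Qed.

(** Expand (1 - u)^(-a) by the binomial series and integrate each power of u;
    the factor 1 / (a + k) produced by the integration is the ratio of the
    Pochhammer symbols of a and a + 1. All terms are nonnegative, so the
    exchange is free, and comparison with the binomial series shows that the
    hypergeometric series converges. *)
Lemma integral_beta_hypergeometric (n : nat) (t : R) : (0 < n)%N -> 0 < t -> t < 1 ->
  let a := 1 + n%:R / 2 in
  (\int[leb]_u ((u `^ (a - 1) * (1 - u) `^ (- a))%:E * ((0 < u < t)%R%:R)%:E) =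
   (t `^ a / a * hypergeometric2F1 a a (a + 1) t)%:E)%E.
Proof.
move=> n0 t0 t1 a.
have p0 : 0 < (n%:R / 2 : R) by rewrite divr_gt0// ltr0n.
have aE : a = n%:R / 2 + 1 by rewrite addrC.
have a0 : 0 < a by rewrite aE addr_gt0.
have a10 : 0 < a - 1 by rewrite aE addrK.
pose c k := pochhammer a k / k`!%:R.
have c0 k : 0 <= c k by rewrite divr_ge0 ?ler0n// ltW ?pochhammer_gt0.
pose e k := pochhammer a k * pochhammer a k / pochhammer (a + 1) k * (t ^+ k / k`!%:R).
have eE k : e k = a / (a + k%:R) * (c k * t ^+ k).
  have ak : a + k%:R != 0 by rewrite gt_eqF// ltr_pwDl.
  have pk : pochhammer (a + 1) k != 0 by rewrite gt_eqF// pochhammer_gt0// addr_gt0.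
  have -> : a / (a + k%:R) = pochhammer a k / pochhammer (a + 1) k.
    by apply/eqP; rewrite eqr_div// mulrC pochhammer_shift.
  by rewrite /e /c; ring.
have e0 k : 0 <= e k.
  rewrite eE; apply: mulr_ge0; last by rewrite mulr_ge0// exprn_ge0// ltW.
  by rewrite divr_ge0 ?addr_ge0 ?ler0n// ltW.
have ele k : e k <= c k * t ^+ k.
  rewrite eE ler_piMl//; first by apply: mulr_ge0 => //; exact/exprn_ge0/ltW.
  by rewrite ler_pdivrMr ?ltr_pwDl// mul1r lerDl.
have efin : (\sum_(0 <= k <oo) (e k)%:E < +oo)%E.
  apply: (@le_lt_trans _ _ (\sum_(0 <= k <oo) (c k * t ^+ k)%:E)%E).
    by apply: lee_nneseries => k _; rewrite lee_fin.
  by rewrite binomial_series// ?ltry// ltW.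
have -> : hypergeometric2F1 a a (a + 1) t = limn (series e) by [].
rewrite EFinM -EFin_lim; last exact: nnseries_is_cvg.
rewrite (_ : limn _ = \sum_(0 <= k <oo) (e k)%:E)%E; last first.
  by apply/congr_lim/funext => k; rewrite /= sumEFin.
rewrite -nneseriesZl; last by move=> k _; rewrite lee_fin.
transitivity (\int[leb]_u (\sum_(0 <= k <oo)
    ((c k)%:E * ((u `^ (a - 1 + k%:R))%:E * ((0 < u < t)%R%:R)%:E))))%E.
  apply: eq_integral => u _; have [/andP[u0 ut]|ut] := boolP (0 < u < t); last first.
    by rewrite mule0 eseries0// => k _ _; rewrite mule0 mule0.
  rewrite mule1 EFinM -binomial_series ?ltW ?(lt_trans ut)//.
  rewrite -nneseriesZl; last first.
    by move=> k _; rewrite lee_fin; apply: mulr_ge0; [exact: c0|exact/exprn_ge0/ltW].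
  apply: eq_eseriesr => k _; rewrite mule1 -!EFinM; congr EFin.
  rewrite [u `^ (a - 1 + k%:R)]powRD; last by rewrite (gt_eqF u0) implybT.
  by rewrite powR_mulrn 1?ltW// /c; ring.
have mu k : measurable_fun setT (fun u => ((u `^ (a - 1 + k%:R))%:E * ((0 < u < t)%R%:R)%:E)%E).
  apply: emeasurable_funM; first by apply/measurable_EFinP; exact: measurable_powR.
  rewrite (_ : (fun x => _) = (fun x => ((0 < x)%R%:R)%:E * ((x < t)%R%:R)%:E)%E).
    by apply: emeasurable_funM; apply: measurable_bool_lt.
  by apply/funext => x; rewrite -EFinM -natrM mulnb.
have u0 k u : (0 <= (u `^ (a - 1 + k%:R))%:E * ((0 < u < t)%R%:R)%:E)%E.
  by rewrite -EFinM lee_fin mulr_ge0// powR_ge0.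
rewrite integral_nneseries; first last.
- by move=> k u _; rewrite mule_ge0// lee_fin.
- by move=> k; apply: measurable_funeM; exact: mu.
- exact: measurableT.
apply: eq_eseriesr => k _.
rewrite ge0_integralZl_EFin; first last.
- exact: c0.
- exact: mu.
- by move=> u _; exact: u0.
- exact: measurableT.
rewrite integral_powR_oo//; last by rewrite ltr_pwDl.
rewrite eE -!EFinM; congr EFin.
rewrite (_ : a - 1 + k%:R + 1 = a + k%:R); last by ring.
rewrite powRD; last by rewrite (gt_eqF t0) implybT.
rewrite powR_mulrn 1?ltW//; field.
by rewrite !gt_eqF// ltr_pwDl.
Qed.

End gamma_function.

(** * Counting tuples of points *)

Section counting_tuples.
Context (R : realType).

(** The cardinality as a sum, which unlike a count splits and reindexes by the
    general lemmas on sums over sets. *)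
Definition ecard {T : choiceType} (A : set T) : \bar R := (\esum_(x in A) 1)%E.

Lemma counting_ecard d (T : measurableType d) (A : set T) :
  @counting T R A = ecard A.
Proof.
rewrite /ecard /counting; case: asboolP => finA.
  by rewrite finite_card_sum.
rewrite -(infinite_card_dirac R finA); apply: eq_esum => x Ax.
by rewrite diracE mem_set.
Qed.

Lemma ecard_ge0 (T : choiceType) (A : set T) : (0 <= ecard A)%E.
Proof. by apply: esum_ge0. Qed.

Lemma ecard0 (T : choiceType) : ecard (@set0 T) = 0%E.
Proof. exact: esum_set0. Qed.

Lemma le_ecard (T : choiceType) (A B : set T) : A `<=` B -> (ecard A <= ecard B)%E.
Proof.
move=> AB; rewrite /ecard (esumID A B)// setIidr//.
by rewrite leeDl//; exact: esum_ge0.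
Qed.

Lemma ecardID (T : choiceType) (C A : set T) :
  ecard A = (ecard (A `&` C) + ecard (A `&` ~` C))%E.
Proof. by rewrite /ecard (esumID C). Qed.

Lemma ecard_eq0 (T : choiceType) (A : set T) : ecard A = 0%E -> A = set0.
Proof.
move=> A0; apply/seteqP; split => // x Ax.
have : (ecard [set x] <= ecard A)%E by apply: le_ecard => _ ->.
by rewrite A0 /ecard esum_set1// lee_fin ler10.
Qed.

Lemma finite_ecard d (T : measurableType d) (A : set T) :
  (ecard A < +oo)%E -> finite_set A.
Proof.
by rewrite -counting_ecard /counting; case: asboolP.
Qed.

Lemma ecard_setX (T1 T2 : choiceType) (A : set T1) (B : set T2) :
  finite_set A -> ecard (A `*` B) = (ecard A * ecard B)%E.
Proof.
move=> finA.
have -> : ecard (A `*` B) = (\esum_(i in A) \esum_(j in B) 1)%E.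
  rewrite (_ : A `*` B = A `*`` (fun=> B)); last first.
    by apply/seteqP; split => -[x y].
  by rewrite (@esum_esum R T1 T2 A (fun=> B) (fun _ _ => 1%E)).
rewrite -/(ecard B) {2}/ecard esum_fset//; last by move=> i _; exact: ecard_ge0.
rewrite esum_fset// ge0_mule_fsuml//; apply: eq_fsbigr => x _.
by rewrite mul1e.
Qed.

Lemma ecard_rect (T : choiceType) k (A : 'I_k -> set T) :
  (forall i, finite_set (A i)) ->
  ecard [set z : k.-tuple T | forall i, A i (tnth z i)] = (\prod_(i < k) ecard (A i))%E.
Proof.
elim: k A => [|k IHk] A finA.
  rewrite big_ord0 (_ : [set _ | _] = [set [tuple]]); last first.
    by apply/seteqP; split => z //= _; [rewrite tuple0|case].
  by rewrite /ecard esum_set1.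
rewrite big_ord_recl -IHk// -ecard_setX//.
apply/esym/(reindex_esum _ _ (fun z : k.+1.-tuple T => (thead z, [tuple of behead z]))).
split.
- move=> z Az /=; split => /=; first exact: Az.
  by move=> i; have := Az (lift ord0 i); rewrite {1}(tuple_eta z) tnthS.
- move=> x y _ _ [xy1 xy2]; rewrite (tuple_eta x) (tuple_eta y) xy1.
  by apply/val_inj; rewrite /= xy2.
- move=> [x t] [/= Ax At]; exists [tuple of x :: t].
    move=> i; case: (unliftP ord0 i) => [j ->|->]; last by rewrite tnth0.
    by rewrite tnthS.
  by congr pair; exact/val_inj.
Qed.

End counting_tuples.
Arguments ecard R {T} A.

Lemma emeasurable_prod (R : realType) d (T : measurableType d) (D : set T)
    (I : Type) (r : seq I) (f : I -> T -> \bar R) :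
  (forall i, measurable_fun D (f i)) ->
  measurable_fun D (fun x => \prod_(i <- r) f i x)%E.
Proof.
move=> mf; elim: r => [|i r IHr].
  by under eq_fun do rewrite big_nil; exact: measurable_cst.
by under eq_fun do rewrite big_cons; exact: emeasurable_funM.
Qed.

(** * Counts of a Poisson process *)

Section poisson.
Context d (T : measurableType d) d' (Omega : measurableType d') (R : realType).
Variables (P : probability Omega R) (Lam : {sigma_finite_measure set T -> \bar R}).
Variable (eta : Omega -> set T).
Notation ecard := (ecard R).
Hypothesis eta_poisson : is_poisson_process P Lam eta.

Definition npoints (B : set T) (w : Omega) : \bar R := ecard (eta w `&` B).

Lemma point_countE B : point_count R eta B = npoints B.
Proof. by apply/funext => w; rewrite /point_count counting_ecard. Qed.

Lemma measurable_npoints B : measurable B -> measurable_fun setT (npoints B).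
Proof. by rewrite -point_countE; case: eta_poisson => h _ _ _; exact: h. Qed.

Lemma npoints_ge0 B w : (0 <= npoints B w)%E. Proof. exact: ecard_ge0. Qed.

Lemma npoints_nat B w : npoints B w = +oo%E \/ exists k : nat, npoints B w = k%:R%:E.
Proof.
rewrite /npoints -counting_ecard /counting; case: asboolP => _; [right|by left].
by eexists.
Qed.

Lemma measurable_npoints_preim B (S : set (\bar R)) : measurable B -> measurable S ->
  measurable [set w | S (npoints B w)].
Proof. by move=> mB mS; apply: (measurable_preimage (measurable_npoints mB) mS). Qed.

Lemma measurable_void B : measurable B -> measurable [set w | eta w `&` B = set0].
Proof.
move=> mB; rewrite (_ : [set _ | _] = [set w | [set 0%E] (npoints B w)]).
  exact: measurable_npoints_preim.
apply/seteqP; split => w /=; first by rewrite /npoints => ->; rewrite ecard0.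
exact: ecard_eq0.
Qed.

Lemma sum_pois (x : R) : 0 <= x ->
  (\sum_(0 <= k <oo) (k%:R%:E * (x ^+ k / k`!%:R * expR (- x))%:E) = x%:E)%E.
Proof.
move=> x0; rewrite (nneseries_split _ 1); last first.
  by move=> k _; rewrite -EFinM lee_fin !mulr_ge0 ?expR_ge0// exprn_ge0.
rewrite big_nat1 mul0e add0e add0n -(nneseries_addn 1); last first.
  by move=> k; rewrite -EFinM lee_fin !mulr_ge0 ?expR_ge0// exprn_ge0.
transitivity (\sum_(0 <= k <oo) ((x * expR (- x))%:E * (x ^+ k / k`!%:R)%:E))%E.
  apply: eq_eseriesr => k _; rewrite -!EFinM; congr EFin.
  rewrite addn1 factS natrM exprS; field.
  by rewrite nat1r !pnatr_eq0 -lt0n fact_gt0.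
rewrite nneseriesZl; last by move=> k _; rewrite lee_fin divr_ge0 ?exprn_ge0.
by rewrite nneseries_expR// -EFinM -mulrA -expRD addNr expR0 mulr1.
Qed.

Lemma void_probability B : measurable B -> (Lam B < +oo)%E ->
  P [set w | eta w `&` B = set0] = (expR (- fine (Lam B)))%:E.
Proof.
move=> mB LB; have [_ h2 _ _] := eta_poisson.
have := h2 _ mB LB 0%N; rewrite point_countE expr0 fact0 divr1 mul1r => <-.
congr (P _); apply/seteqP; split => w /=; first by rewrite /npoints => ->; rewrite ecard0.
exact: ecard_eq0.
Qed.

(** The Poisson probabilities of finite counts sum to one. *)
Lemma npoints_finite_ae B : measurable B -> (Lam B < +oo)%E -> P [set w | npoints B w = +oo%E] = 0%E.
Proof.
move=> mB LB.
have [_ h2 _ _] := eta_poisson; have := h2 _ mB LB; rewrite point_countE => {}h2.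
have x0 : 0 <= fine (Lam B) by rewrite fine_ge0.
pose F k := [set w | npoints B w = k%:R%:E].
have mF k : measurable (F k) by apply: (@measurable_npoints_preim B [set k%:R%:E]).
have -> : [set w | npoints B w = +oo%E] = ~` \bigcup_k F k.
  apply/seteqP; split => w /=; first by move=> Noo [k _]; rewrite /F/= Noo.
  move=> h; case: (npoints_nat B w) => // -[k Nk]; exfalso; apply: h; by exists k.
rewrite probability_setC; last exact: bigcupT_measurable.
rewrite measure_bigcup//; last first.
  apply/trivIsetP => i j _ _ ij; rewrite -subset0 => w [].
  by rewrite /F/= => -> [] /eqP; rewrite eqr_nat (negbTE ij).
rewrite (_ : (\sum_(_ <oo | _) _)%E = 1%E) ?subee//.
transitivity (\sum_(0 <= k <oo) ((expR (- fine (Lam B)))%:E *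
    (fine (Lam B) ^+ k / k`!%:R)%:E))%E.
  rewrite [LHS]eseries_mkcond; apply: eq_eseriesr => k _.
  by rewrite in_setT [LHS](h2 k) -EFinM mulrC.
rewrite nneseriesZl; last by move=> k _; rewrite lee_fin divr_ge0 ?exprn_ge0.
by rewrite nneseries_expR// -EFinM -expRD addNr expR0.
Qed.

Lemma integral_npoints B : measurable B -> (Lam B < +oo)%E -> (\int[P]_w npoints B w = Lam B)%E.
Proof.
move=> mB LB.
have [_ h2 _ _] := eta_poisson; have := h2 _ mB LB; rewrite point_countE => {}h2.
have mF k : measurable [set w | npoints B w = k%:R%:E].
  by apply: (@measurable_npoints_preim B [set k%:R%:E]).
have mg k : measurable_fun setT (fun w => k%:R%:E * (\1_[set w | npoints B w = k%:R%:E] w : R)%:E)%E.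
  by apply: measurable_funeM; exact: measurable_indicE.
have g0 k w : (0 <= k%:R%:E * (\1_[set w | npoints B w = k%:R%:E] w : R)%:E)%E.
  by rewrite mule_ge0// lee_fin.
transitivity (\int[P]_w \sum_(0 <= k <oo) (k%:R%:E * (\1_[set w | npoints B w = k%:R%:E] w)%:E))%E.
  apply: ge0_ae_eq_integral => //.
  - exact: measurable_npoints.
  - by apply: ge0_emeasurable_sum => // k w _ _; exact: g0.
  - by move=> w _; exact: npoints_ge0.
  - by move=> w _; apply: nneseries_ge0 => k _ _; exact: g0.
  exists [set w | npoints B w = +oo%E]; split.
  - exact: (@measurable_npoints_preim B [set +oo%E]).
  - exact: npoints_finite_ae.
  move=> w /= /not_implyP[_]; apply: contra_notP => Noo.
  have [//|[k Nk]] := npoints_nat B w.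
  rewrite (@nneseriesD1 _ _ k)//= (_ : \1__ w = 1); last by rewrite indicE mem_set.
  rewrite eseries0 ?adde0 ?mule1 ?Nk// => j _ jk.
  rewrite indicE memNset ?mule0//= Nk => -[] /eqP.
  by rewrite eqr_nat eq_sym (negbTE jk).
rewrite integral_nneseries//.
rewrite -[RHS]fineK ?ge0_fin_numE// -sum_pois ?fine_ge0//.
apply: eq_eseriesr => k _.
rewrite ge0_integralZl_EFin//; last exact: measurable_indicE.
rewrite integral_indic// setIT; congr (_ * _)%E; exact: h2.
Qed.

(** A count is the number of the integers j below it. This layer decomposition
    turns products of counts into sums of indicators, to which independence
    applies. *)
Lemma npoints_series B w :
  npoints B w = (\sum_(0 <= j <oo) (\1_[set x | (j%:R%:E < x)%E] (npoints B w) : R)%:E)%E.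
Proof.
have indE j : (\1_[set x | (j%:R%:E < x)%E] (npoints B w) : R) = ((j%:R%:E < npoints B w)%E : bool)%:R.
  by rewrite indicE; congr (nat_of_bool _)%:R; apply/idP/idP; rewrite inE.
have [Noo|[k Nk]] := npoints_nat B w.
  rewrite Noo; apply/esym/eqyP => A A0.
  apply: (@le_trans _ _ (\sum_(0 <= j < (Num.truncn A).+1) (1%:E : \bar R))%E).
    by rewrite sumEFin lee_fin big_const_nat subn0 iter_addr_0 ltW// truncnS_gt// ltW.
  apply: (le_trans _ (nneseries_lim_ge (Num.truncn A).+1 _)) => //.
  by apply: lee_sum => j _; rewrite -Noo indE Noo ltry.
rewrite (nneseries_split _ k)// add0n [X in (_ + X)%E]eseries0 ?adde0; last first.
  by move=> j kj _; rewrite indE Nk lte_fin ltr_nat ltnNge kj.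
rewrite Nk (eq_big_nat _ _ (F2 := fun=> 1%E)); last first.
  by move=> j /andP[_ jk]; rewrite -Nk indE Nk lte_fin ltr_nat jk.
by rewrite sumEFin big_const_nat subn0 iter_addr_0.
Qed.

Lemma nneseriesZr_ge0 (a : nat -> \bar R) (c : \bar R) :
  (forall j, 0 <= a j)%E -> (0 <= c)%E ->
  (\sum_(0 <= j <oo) (a j * c) = (\sum_(0 <= j <oo) a j) * c)%E.
Proof.
move=> a0 c0.
have ac0 j : (0 <= a j * c)%E by rewrite mule_ge0.
by rewrite -(@ge0_integral_count R _ ac0) -(@ge0_integral_count R _ a0) ge0_integralZr.
Qed.

(** Independence is assumed for events of counts; induction on l replaces the
    events of the first l factors by the counts themselves, one factor at a
    time, by layers. *)
Lemma integral_prod_npoints m (B : 'I_m -> set T) (S : 'I_m -> set (\bar R)) (l : nat) :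
  (forall i, measurable (B i)) -> trivIset setT B -> (forall i, measurable (S i)) ->
  (\int[P]_w \prod_(i < m) (if (i < l)%N then npoints (B i) w else (\1_(S i) (npoints (B i) w))%:E) =
   \prod_(i < m) (if (i < l)%N then \int[P]_w npoints (B i) w else P [set w | S i (npoints (B i) w)]))%E.
Proof.
move=> mB tB; elim: l S => [|l IHl] S mS.
  have [_ _ _ /(_ m B S mB tB mS)] := eta_poisson.
  under [X in _ = X -> _]eq_bigr do rewrite point_countE.
  rewrite (_ : [set w | forall i, _] = [set w | forall i, S i (npoints (B i) w)]); last first.
    by apply/seteqP; split => w /= h i; have := h i; rewrite point_countE.
  rewrite /= => <-.
  have mA : measurable [set w | forall i, S i (npoints (B i) w)].
    by apply: measurable_forall_ord => i; exact: measurable_npoints_preim.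
  transitivity (\int[P]_w (\1_[set w | forall i, S i (npoints (B i) w)] w)%:E)%E; last first.
    by rewrite integral_indic// setIT.
  apply: eq_integral => w _ /=; rewrite prodEFin; congr EFin.
  rewrite indicE; case: (boolP (w \in _)) => [/set_mem wA|wA].
    by apply: big1 => i _; rewrite indicE mem_set//; exact: wA.
  move: wA; rewrite notin_setE /= => /existsNP[i wi].
  by rewrite (bigD1 i)//= indicE memNset// mul0r.
have [lm|ml] := ltnP l m; last first.
  have e (i : 'I_m) : (i < l.+1)%N = (i < l)%N.
    by rewrite (leq_trans (ltn_ord i) ml) (leq_trans (ltn_ord i))// (leq_trans ml).
  under eq_integral do under eq_bigr do rewrite e.
  by under [RHS]eq_bigr do rewrite e; exact: IHl.
pose i0 := Ordinal lm.
pose S' j i : set (\bar R) := if i == i0 then [set x | (j%:R%:E < x)%E] else S i.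
have mgt j : measurable [set x : \bar R | (j%:R%:E < x)%E].
  rewrite (_ : [set _ | _] = `]j%:R%:E, +oo%E]%classic); first exact: emeasurable_itv.
  by apply/seteqP; split => x /=; rewrite in_itv/= leey andbT.
have mS' j i : measurable (S' j i) by rewrite /S'; case: eqP.
have ne (i : 'I_m) : i != i0 -> (i < l.+1)%N = (i < l)%N.
  by move=> ii0; rewrite ltnS leq_eqVlt; have := ii0; rewrite -val_eqE/= => /negbTE ->.
pose X j (i : 'I_m) w := (if (i < l)%N then npoints (B i) w else (\1_(S' j i) (npoints (B i) w))%:E)%E.
have X0 j i w : (0 <= X j i w)%E by rewrite /X; case: ifP => // _; exact: npoints_ge0.
have mX j i : measurable_fun setT (X j i).
  rewrite /X; case: (i < l)%N; first exact: measurable_npoints.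
  exact: (measurableT_comp (measurable_indicE (mS' j i)) (measurable_npoints (mB i))).
transitivity (\int[P]_w \sum_(0 <= j <oo) \prod_(i < m) X j i w)%E.
  apply: eq_integral => w _; rewrite (bigD1 i0)//= ltnSn npoints_series -nneseriesZr_ge0//.
  - apply: eq_eseriesr => j _; rewrite [RHS](bigD1 i0)//=; congr (_ * _)%E.
      by rewrite /X ltnn /S' eqxx.
    by apply: eq_bigr => i ii0; rewrite /X ne// /S' (negbTE ii0).
  - by apply: prode_ge0 => i _; case: ifP => // _; exact: npoints_ge0.
rewrite integral_nneseries//; last 2 first.
- by move=> j; apply: emeasurable_prod.
- by move=> j w _; apply: prode_ge0.
transitivity (\sum_(0 <= j <oo) (P [set w | (j%:R%:E < npoints (B i0) w)%E] *
   \prod_(i < m | i != i0) (if (i < l.+1)%N then \int[P]_w npoints (B i) w else P [set w | S i (npoints (B i) w)])))%E.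
  apply: eq_eseriesr => j _; rewrite IHl// (bigD1 i0)//= ltnn /S' eqxx.
  congr (_ * _)%E; apply: eq_bigr => i ii0; rewrite ne// (negbTE ii0)//.
rewrite nneseriesZr_ge0; first last.
- by apply: prode_ge0 => i _; case: ifP => _; [apply: integral_ge0 => w _; exact: npoints_ge0|exact: measure_ge0].
- by [].
rewrite [RHS](bigD1 i0)//= ltnSn; congr (_ * _)%E.
under [RHS]eq_integral do rewrite npoints_series.
rewrite integral_nneseries//; last first.
  move=> j; exact: (measurableT_comp (measurable_indicE (mgt j)) (measurable_npoints (mB i0))).
apply: eq_eseriesr => j _.
transitivity (\int[P]_w (\1_[set w | (j%:R%:E < npoints (B i0) w)%E] w)%:E)%E.
  by rewrite integral_indic// ?setIT//; exact: (@measurable_npoints_preim _ [set x | (j%:R%:E < x)%E]).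
by apply: eq_integral => w _; rewrite !indicE; congr (_%:R%:E); congr nat_of_bool;
  apply/idP/idP; rewrite !inE.
Qed.

(** The product formula for the k + 1 disjoint sets G_i and B, the last entering
    through the event that it is void. *)
Lemma integral_prod_npoints_void k (G : 'I_k -> set T) (B : set T) :
  (forall i, measurable (G i)) -> trivIset setT G -> measurable B ->
  (forall i, G i `&` B = set0) -> (forall i, Lam (G i) < +oo)%E ->
  (\int[P]_(w in [set w | eta w `&` B = set0]) \prod_(i < k) npoints (G i) w =
   \prod_(i < k) Lam (G i) * P [set w | eta w `&` B = set0])%E.
Proof.
move=> mG tG mB GB LG.
(* B is put last, so that [integral_prod_npoints] with l = k treats the G i as
   counts and B as an event. *)
pose F (i : 'I_k.+1) := if unlift ord_max i is Some j then G j else B.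
have FO : F ord_max = B by rewrite /F unlift_none.
have FS (j : 'I_k) : F (lift ord_max j) = G j by rewrite /F liftK.
have mF i : measurable (F i) by rewrite /F; case: unlift.
have tF : trivIset setT F.
  apply/trivIsetP => i j _ _; case: (unliftP ord_max i) => [i' ->|->];
    case: (unliftP ord_max j) => [j' ->|->]; rewrite ?FS ?FO ?eqxx//.
  - move=> ij; move/trivIsetP : tG; apply => //.
    by apply: contra_neq ij => ->.
  - by move=> _; rewrite setIC.
have := @integral_prod_npoints k.+1 F (fun=> [set 0%E]) k mF tF (fun=> emeasurable_set1 _).
rewrite big_ord_recr/= ltnn FO => h.
have FW (i : 'I_k) : F (widen_ord (leqnSn k) i) = G i.
  by rewrite -FS; congr F; apply/val_inj; rewrite /= /bump leqNgt ltn_ord.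
have vE : [set w | eta w `&` B = set0] = [set w | npoints B w = 0%E].
  apply/seteqP; split => w /=; first by rewrite /npoints => ->; rewrite ecard0.
  exact: ecard_eq0.
rewrite vE -[RHS](_ : (\prod_(i < k) (if (i < k)%N
      then \int[P]_w npoints (F (widen_ord (leqnSn k) i)) w
      else P [set w | npoints (F (widen_ord (leqnSn k) i)) w = 0%R]) *
   P [set w | npoints B w = 0%R])%E = _); last first.
  by congr (_ * _)%E; apply: eq_bigr => i _; rewrite ltn_ord FW integral_npoints.
rewrite -h integral_mulindic; apply: eq_integral => w _.
rewrite big_ord_recr/= ltnn FO; congr (_ * (_ : R)%:E)%E.
by apply: eq_bigr => i _; rewrite ltn_ord FW.
Qed.

(** * The Mecke formula for void events *)

Section mecke.
Variable k : nat.

Definition empty_tuples (A : set (k.-tuple T)) (S : k.-tuple T -> set T) (w : Omega) :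
    set (k.-tuple T) :=
  [set z | [/\ forall i, eta w (tnth z i), A z & eta w `&` S z = set0]].

Definition void_prob (S : k.-tuple T -> set T) (z : k.-tuple T) : \bar R :=
  P [set w | eta w `&` S z = set0].

Variable (Om0 : set Omega) (mOm0 : measurable Om0) (Om0_full : P (~` Om0) = 0%E).

(** The formula is bundled with the measurability of both integrands, since both
    are carried along in the same inductions. The domain Om0, of full measure,
    excludes the outcomes where the process is not locally finite, on which
    nothing is measurable a priori. *)
Definition mecke (A : set (k.-tuple T)) (S : k.-tuple T -> set T) :=
  [/\ measurable_fun Om0 (fun w => ecard (empty_tuples A S w)),
      measurable_fun A (void_prob S) &
      (\int[P]_(w in Om0) ecard (empty_tuples A S w) =
       \int[tuple_measure Lam k]_(z in A) void_prob S z)%E].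

Lemma mecke_ext A S S' : (forall z, A z -> S z = S' z) -> mecke A S -> mecke A S'.
Proof.
move=> SS' [h1 h2 h3].
have eE w : empty_tuples A S w = empty_tuples A S' w.
  by apply/seteqP; split => z [e Az h]; split => //; [rewrite -SS'|rewrite SS'].
have vE z : A z -> void_prob S z = void_prob S' z by move=> Az; rewrite /void_prob SS'.
split.
- by apply: eq_measurable_fun h1 => w _; rewrite eE.
- by apply: eq_measurable_fun h2 => z /set_mem Az; rewrite vE.
- transitivity (\int[P]_(w in Om0) ecard (empty_tuples A S w))%E.
    by apply: eq_integral => w _; rewrite eE.
  by rewrite h3; apply: eq_integral => z /set_mem Az; rewrite vE.
Qed.

Lemma mecke_bigcup (A : (set (k.-tuple T))^nat) S : trivIset setT A ->
  (forall j, measurable (A j)) -> (forall j, mecke (A j) S) -> mecke (\bigcup_j A j) S.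
Proof.
move=> tA mA gA.
have cE w : ecard (empty_tuples (\bigcup_j A j) S w) =
    (\sum_(0 <= j <oo) ecard (empty_tuples (A j) S w))%E.
  rewrite -nneseries_sum_bigcup//.
    congr (ecard _); apply/seteqP; split => z.
      by move=> [e [j _ Az] h]; exists j.
    by move=> [j _ [e Az h]]; split => //; exists j.
  apply/trivIsetP => i j _ _ ij; rewrite -subset0 => z [[_ Ai _] [_ Aj _]].
  by move/trivIsetP : tA => /(_ i j Logic.I Logic.I ij); rewrite -subset0; apply.
have mv : measurable_fun (\bigcup_j A j) (void_prob S).
  by apply/measurable_fun_bigcup => // j; case: (gA j).
split => //.
- under eq_fun do rewrite cE.
  by apply: ge0_emeasurable_sum => [j w _ _|j _]; [exact: ecard_ge0|case: (gA j)].
- under eq_integral do rewrite cE.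
  rewrite integral_nneseries//; last 2 first.
  + by move=> j; case: (gA j).
  + by move=> j w _; exact: ecard_ge0.
  rewrite ge0_integral_bigcup//.
  by apply: eq_eseriesr => j _; case: (gA j).
Qed.

Lemma mecke0 S : mecke set0 S.
Proof.
have cE w : ecard (empty_tuples set0 S w) = 0%E.
  by rewrite (_ : empty_tuples _ _ _ = set0) ?ecard0//; apply/seteqP; split => z // [].
split.
- by under eq_fun do rewrite cE; exact: measurable_cst.
- exact: measurable_fun_set0.
- by rewrite integral_set0; apply: integral0_eq => w _.
Qed.

Lemma mecke_setU A1 A2 S : A1 `&` A2 = set0 -> measurable A1 -> measurable A2 ->
  mecke A1 S -> mecke A2 S -> mecke (A1 `|` A2) S.
Proof.
move=> A12 m1 m2 g1 g2; rewrite -bigcup2E; apply: mecke_bigcup.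
- apply/trivIsetP => i j _ _; rewrite /bigcup2.
  case: i => [|[|i]]; case: j => [|[|j]] //=; rewrite ?setI0 ?set0I//.
  by rewrite setIC.
- by move=> [|[|j]]; rewrite /bigcup2//=.
- by move=> [|[|j]] //=; exact: mecke0.
Qed.

Definition rect (G : 'I_k -> set T) : set (k.-tuple T) :=
  [set z | forall i, G i (tnth z i)].

Lemma measurable_rect G : (forall i, measurable (G i)) -> measurable (rect G).
Proof.
move=> mG; apply: measurable_forall_ord => i.
by apply: (measurable_preimage (@measurable_tnth _ _ k i)).
Qed.

Lemma measurable_tuple_rect :
  @measurable _ (k.-tuple T) =
  <<s [set rect H | H in [set H | forall i, measurable (H i)]] >>.
Proof.
apply/seteqP; split.
- apply: smallest_sub; first exact: smallest_sigma_algebra.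
  move=> A; rewrite -bigcup_seq => -[i _] [Y mY <-].
  apply: sub_sigma_algebra.
  exists (fun j => if j == i then Y else setT).
    by move=> j /=; case: ifP.
  apply/seteqP; split => z /=.
    by move=> /(_ i); rewrite eqxx.
  by move=> [_ zY] j; case: eqP => // ->.
- apply: smallest_sub; first exact: sigma_algebra_measurable.
  by move=> _ [H mH <-]; exact: measurable_rect.
Qed.

Section mecke_rect.
Variables (G : 'I_k -> set T) (B : set T).
Hypotheses (mG : forall i, measurable (G i)) (tG : trivIset setT G)
  (LG : forall i, (Lam (G i) < +oo)%E)
  (finG : forall w i, Om0 w -> (npoints (G i) w < +oo)%E)
  (mB : measurable B) (GB : forall i, G i `&` B = set0).

Lemma ecard_empty_rect (H : 'I_k -> set T) w : Om0 w ->
  ecard (empty_tuples (rect H `&` rect G) (fun=> B) w) =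
  (\prod_(i < k) npoints (H i `&` G i) w * (\1_[set w | eta w `&` B = set0] w)%:E)%E.
Proof.
move=> Ow; rewrite indicE; case: (boolP (w \in _)) => [/set_mem wB|wB].
  rewrite mule1 -ecard_rect.
    congr (ecard _); apply/seteqP; split => z /=.
      by move=> [e [Hz Gz] _] i; split.
    by move=> h; split => //; [move=> i; case: (h i)|split => i; case: (h i) => _ []].
  move=> i; apply: (@finite_ecard R); apply: (@le_lt_trans _ _ (npoints (G i) w)); last exact: finG.
  by apply: le_ecard => x [? []].
rewrite mule0 (_ : empty_tuples _ _ _ = set0) ?ecard0//.
apply/seteqP; split => z // -[_ _ h].
by move: wB; rewrite notin_setE.
Qed.

(** On a product of disjoint sets the number of tuples with entries in the
    factors is the product of the counts. *)
Lemma mecke_rectI (H : 'I_k -> set T) : (forall i, measurable (H i)) ->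
  mecke (rect H `&` rect G) (fun=> B).
Proof.
move=> mH.
have mf : measurable_fun setT (fun w =>
    \prod_(i < k) npoints (H i `&` G i) w * (\1_[set w | eta w `&` B = set0] w : R)%:E)%E.
  apply: emeasurable_funM; last exact/measurable_indicE/measurable_void.
  by apply: emeasurable_prod => i; apply: measurable_npoints; exact: measurableI.
split.
- apply: (@eq_measurable_fun _ _ _ _ _ _ _ _ (measurable_funTS mf)) => w /set_mem Ow.
  by rewrite ecard_empty_rect.
- exact: measurable_cst.
- transitivity (\int[P]_(w in Om0)
    (\prod_(i < k) npoints (H i `&` G i) w * (\1_[set w | eta w `&` B = set0] w)%:E))%E.
    by apply: eq_integral => w /set_mem Ow; rewrite ecard_empty_rect.
  have f0 w : (0 <= \prod_(i < k) npoints (H i `&` G i) w *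
      (\1_[set w | eta w `&` B = set0] w : R)%:E)%E.
    by rewrite mule_ge0// prode_ge0// => i _; exact: npoints_ge0.
  have -> : Om0 = setT `\` ~` Om0 by rewrite setTD setCK.
  rewrite -ge0_negligible_integral//; last exact: measurableC.
  rewrite -integral_mulindic integral_prod_npoints_void//.
  + rewrite integral_cst; last by apply: measurableI; exact: measurable_rect.
    rewrite muleC; congr (_ * _)%E.
    rewrite -tuple_measure_rect; last by move=> i; exact: measurableI.
    congr tuple_measure; apply/seteqP; split => z /=.
      by move=> h; split => i; case: (h i).
    by move=> [h1 h2] i; split; [exact: h1|exact: h2].
  + by move=> i; exact: measurableI.
  + apply/trivIsetP => i j _ _ ij; rewrite -subset0 => x [[_ Gi] [_ Gj]].
    by move/trivIsetP : tG => /(_ i j Logic.I Logic.I ij); rewrite -subset0; apply.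
  + by move=> i; rewrite -setIA GB setI0.
  + move=> i; apply: le_lt_trans (LG i); apply: le_measure; rewrite ?inE//.
    exact: measurableI.
Qed.

Lemma ecard_empty_fin A S w : A `<=` rect G -> Om0 w ->
  (ecard (empty_tuples A S w) < +oo)%E.
Proof.
move=> AG Ow; apply: (@le_lt_trans _ _ (ecard [set z : k.-tuple T | forall i, (eta w `&` G i) (tnth z i)])).
  by apply: le_ecard => z [e /AG Az _] i; split.
have finE i : finite_set (eta w `&` G i) by apply: (@finite_ecard R); exact: finG.
rewrite (@ecard_rect R _ _ (fun i => eta w `&` G i))// -ge0_fin_numE; last by apply: prode_ge0 => i _; exact: ecard_ge0.
by apply: prode_fin_num => i _; rewrite ge0_fin_numE ?ecard_ge0//; exact: finG.
Qed.

(** The case of products H is a pi-system generating the tuples; complements are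
    differences of finite integrals, since Lam (G i) and the counts are finite.
    *)
Lemma mecke_rect A : measurable A -> mecke (A `&` rect G) (fun=> B).
Proof.
rewrite measurable_tuple_rect.
apply: (@dynkin_induction _ (k.-tuple T) _ (fun A => mecke (A `&` rect G) (fun=> B))).
- exact: measurable_tuple_rect.
- move=> _ _ [H mH <-] [H' mH' <-]; exists (fun i => H i `&` H' i).
    by move=> i; exact: measurableI.
  apply/seteqP; split => z /=; first by move=> h; split => i; case: (h i).
  by move=> [h1 h2] i; split; [exact: h1|exact: h2].
- have -> : [set: k.-tuple T] = rect (fun=> setT) by apply/seteqP; split.
  exact: mecke_rectI.
- by move=> _ [H mH <-]; exact: mecke_rectI.
- move=> C mC [h1 h2 h3].
  have [r1 r2 r3] : mecke (rect G) (fun=> B).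
    have -> : rect G = rect (fun=> setT) `&` rect G.
      by rewrite [X in X `&` _](_ : _ = setT) ?setTI//; apply/seteqP; split.
    exact: mecke_rectI.
  have mR := measurable_rect mG.
  have mCR : measurable (C `&` rect G) by exact: measurableI.
  have mCCR : measurable (~` C `&` rect G).
    by apply: measurableI => //; exact: measurableC.
  have RE : rect G = (C `&` rect G) `|` (~` C `&` rect G).
    by rewrite -setIUl setUv setTI.
  have disj : (C `&` rect G) `&` (~` C `&` rect G) = set0.
    by rewrite setIACA setICr set0I.
  have cE w : Om0 w -> ecard (empty_tuples (~` C `&` rect G) (fun=> B) w) =
      (ecard (empty_tuples (rect G) (fun=> B) w) -
       ecard (empty_tuples (C `&` rect G) (fun=> B) w))%E.
    move=> Ow; rewrite (ecardID _ C (empty_tuples (rect G) _ w)).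
    rewrite (_ : _ `&` C = empty_tuples (C `&` rect G) (fun=> B) w); last first.
      by apply/seteqP; split => z [] /=; [move=> []|move=> ? []].
    rewrite (_ : _ `&` ~` C = empty_tuples (~` C `&` rect G) (fun=> B) w); last first.
      by apply/seteqP; split => z [] /=; [move=> []|move=> ? []].
    rewrite addeAC subee ?add0e// ge0_fin_numE ?ecard_ge0//.
    by apply: ecard_empty_fin => // z [].
  have m1 : measurable_fun Om0 (fun w => ecard (empty_tuples (~` C `&` rect G) (fun=> B) w)).
    apply: (@eq_measurable_fun _ _ _ _ _ _ _ _ (emeasurable_funB r1 h1)) => w /set_mem Ow.
    by rewrite cE.
  split => //; first exact: measurable_cst.
  have rE : (\int[P]_(w in Om0) ecard (empty_tuples (rect G) (fun=> B) w) =
      \int[P]_(w in Om0) ecard (empty_tuples (C `&` rect G) (fun=> B) w) +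
      \int[P]_(w in Om0) ecard (empty_tuples (~` C `&` rect G) (fun=> B) w))%E.
    rewrite -ge0_integralD//; last 2 first.
    + by move=> w _; exact: ecard_ge0.
    + by move=> w _; exact: ecard_ge0.
    apply: eq_integral => w /set_mem Ow; rewrite cE// addeCA subee ?adde0//.
    by rewrite ge0_fin_numE ?ecard_ge0//; apply: ecard_empty_fin => // z [].
  have rE' : (\int[tuple_measure Lam k]_(z in rect G) void_prob (fun=> B) z =
      \int[tuple_measure Lam k]_(z in C `&` rect G) void_prob (fun=> B) z +
      \int[tuple_measure Lam k]_(z in ~` C `&` rect G) void_prob (fun=> B) z)%E.
    rewrite {1}RE ge0_integral_setU//.
    + exact: measurable_cst.
    + by rewrite disj_set2E; apply/eqP.
  have fin : (\int[tuple_measure Lam k]_(z in C `&` rect G) void_prob (fun=> B) z)%E \is a fin_num.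
    rewrite integral_cst// ge0_fin_numE; last by rewrite mule_ge0.
    apply: (@le_lt_trans _ _ (tuple_measure Lam k (rect G))).
      rewrite -[leRHS]mul1e; apply: lee_pmul => //; first by apply: probability_le1; exact: measurable_void.
      by apply: le_measure; rewrite ?inE// => z [].
    rewrite tuple_measure_rect// -ge0_fin_numE; last by apply: prode_ge0.
    by apply: prode_fin_num => i _; rewrite ge0_fin_numE.
  move: rE; rewrite r3 rE' h3 => /(congr1 (fun x => x - \int[tuple_measure Lam k]_(z in C `&` rect G) void_prob (fun=> B) z)%E).
  by rewrite [in LHS]addeAC [in RHS]addeAC !subee// !add0e => ->.
- move=> F mF tF gF; rewrite setI_bigcupl; apply: mecke_bigcup => //.
  + apply/trivIsetP => i j _ _ ij; rewrite setIACA.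
    by move/trivIsetP : tF => /(_ i j Logic.I Logic.I ij) ->; rewrite set0I.
  + by move=> j; apply: measurableI => //; exact: measurable_rect.
Qed.

End mecke_rect.
Lemma near_forall_finite (X : choiceType) (F : set X) (Q : X -> nat -> Prop) :
  finite_set F -> (forall x, F x -> \forall n \near \oo, Q x n) ->
  \forall n \near \oo, forall x, F x -> Q x n.
Proof.
move=> /finite_seqP[s ->]; elim: s => [_|x s IHs FQ]; first exact: nearW.
have FQs : \forall n \near \oo, forall y, [set` s] y -> Q y n.
  by apply: IHs => y ys; apply: FQ; rewrite /= inE ys orbT.
have := FQ x _; rewrite /= inE eqxx => /(_ isT).
apply: filterS2 FQs => n sQ xQ y; rewrite /= inE => /predU1P[->//|].
exact: sQ.
Qed.

Section mecke_limit.
Variables (G : 'I_k -> set T).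
Hypotheses (mG : forall i, measurable (G i)) (tG : trivIset setT G)
  (LG : forall i, (Lam (G i) < +oo)%E)
  (finG : forall w i, Om0 w -> (npoints (G i) w < +oo)%E).

Lemma mecke_cst A B : measurable A -> measurable B -> A `<=` rect G ->
  (forall z i, A z -> ~ B (tnth z i)) -> mecke A (fun=> B).
Proof.
move=> mA mB AG AB.
have -> : A = A `&` rect (fun i => G i `\` B).
  apply/seteqP; split => z //=; last by case.
  by move=> Az; split => // i; split; [exact: (AG z Az)|exact: AB].
apply: mecke_rect => //.
- by move=> i; exact: measurableD.
- apply/trivIsetP => i j _ _ ij; rewrite -subset0 => x [[Gi _] [Gj _]].
  by move/trivIsetP : tG => /(_ i j Logic.I Logic.I ij); rewrite -subset0; apply.
- move=> i; apply: le_lt_trans (LG i); apply: le_measure; rewrite ?inE//.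
  exact: measurableD.
- move=> w i Ow; apply: le_lt_trans (finG i Ow); apply: le_ecard.
  by move=> x [? []].
- by move=> i; rewrite -subset0 => x [[_ nB] /nB].
Qed.

Variables (U : nat -> set (k.-tuple T)) (V : nat -> set T).
Hypotheses (mU : forall j, measurable (U j)) (mV : forall j, measurable (V j)).

(** The void set at z when pairs (z, p) are cut out by the first n product sets
    U j x V j. *)
Definition section_lt n (z : k.-tuple T) : set T :=
  [set y | exists2 j, (j < n)%N & U j z /\ V j y].

Definition section_all (z : k.-tuple T) : set T := [set y | exists j, U j z /\ V j y].

Lemma measurable_section_lt n z : measurable (section_lt n z).
Proof.
have -> : section_lt n z = \bigcup_(j in [set j | (j < n)%N /\ U j z]) V j.
  apply/seteqP; split => y; first by move=> [j jn [Uz Vy]]; exists j.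
  by move=> [j [jn Uz] Vy]; exists j.
exact: bigcup_measurable.
Qed.

(** Induction on n: on U n the last set V n belongs to the void set for all z,
    off U n for none. The constant part B accumulates the decided sets, so that
    the induction ends with a void set that does not depend on z. *)
Lemma mecke_section_lt n A B : measurable A -> measurable B -> A `<=` rect G ->
  (forall z i, A z -> ~ (B `|` section_lt n z) (tnth z i)) ->
  mecke A (fun z => B `|` section_lt n z).
Proof.
elim: n A B => [|n IHn] A B mA mB AG h.
  apply: (@mecke_ext _ (fun=> B)).
    by move=> z Az; apply/seteqP; split => y; [left|move=> [//|[]]].
  by apply: mecke_cst => // z i Az Bz; apply: (h z i Az); left.
have coverU z : U n z -> B `|` section_lt n.+1 z = (B `|` V n) `|` section_lt n z.
  move=> Uz; apply/seteqP; split => y /=.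
    move=> [By|[j jn [Uj Vj]]]; first by left; left.
    move: jn; rewrite ltnS leq_eqVlt => /predU1P[jn|jn]; last by right; exists j.
    by left; right; rewrite -jn.
  move=> [[By|Vy]|[j jn [Uj Vj]]]; first by left.
    by right; exists n.
  by right; exists j => //; exact: ltnW.
have coverNU z : ~ U n z -> B `|` section_lt n.+1 z = B `|` section_lt n z.
  move=> Uz; apply/seteqP; split => y /=.
    move=> [By|[j jn [Uj Vj]]]; first by left.
    move: jn; rewrite ltnS leq_eqVlt => /predU1P[jn|jn]; last by right; exists j.
    by move: Uj; rewrite jn.
  move=> [By|[j jn [Uj Vj]]]; first by left.
  by right; exists j => //; exact: ltnW.
have -> : A = (A `&` U n) `|` (A `\` U n).
  by rewrite setDE -setIUr setUv setIT.
apply: mecke_setU.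
- by rewrite setDE setIACA setICr setI0.
- exact: measurableI.
- exact: measurableD.
- apply: (@mecke_ext _ (fun z => (B `|` V n) `|` section_lt n z)).
    by move=> z [_ Uz]; rewrite coverU.
  apply: IHn.
  + exact: measurableI.
  + exact: measurableU.
  + by move=> z [/AG].
  + by move=> z i [Az Uz]; rewrite -coverU//; exact: h.
- apply: (@mecke_ext _ (fun z => B `|` section_lt n z)).
    by move=> z [_ Uz]; rewrite coverNU.
  apply: IHn => //.
  + exact: measurableD.
  + by move=> z [/AG].
  + by move=> z i [Az Uz]; rewrite -coverNU//; exact: h.
Qed.

(** For each outcome only finitely many tuples are counted, so their sections
    avoid the process as soon as n is large: the counts are eventually constant.
    The void probabilities decrease to their limit. Both sides converge by
    domination, by the number of all tuples in the product and by 1. *)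
Lemma mecke_section_all A : measurable A -> A `<=` rect G ->
  (forall z i, A z -> ~ section_all z (tnth z i)) -> mecke A section_all.
Proof.
move=> mA AG h.
have gn n : mecke A (section_lt n).
  apply: (@mecke_ext _ (fun z => set0 `|` section_lt n z)).
    by move=> z _; rewrite set0U.
  apply: mecke_section_lt => // z i Az; rewrite set0U => -[j _ UV].
  by apply: (h z i Az); exists j.
have [r1 r2 r3] : mecke (rect G) (fun=> set0).
  by apply: (mecke_cst (measurable_rect mG) measurable0 (@subset_refl _ _)) => z i _ [].
pose F w : set (k.-tuple T) := empty_tuples (rect G) (fun=> set0) w.
have finF w : Om0 w -> finite_set (F w).
  by move=> Ow; apply: (@finite_ecard R); exact: (ecard_empty_fin finG _ (@subset_refl _ (rect G)) Ow).
have emptyF S w : empty_tuples A S w = F w `&` [set z | A z /\ eta w `&` S z = set0].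
  apply/seteqP; split => z /=.
    by move=> [e Az Sz]; split => //; split => //; [exact: AG|rewrite setI0].
  by move=> [[e _ _] [Az Sz]].
have section_lt_sub n z : section_lt n z `<=` section_all z by move=> y [j _ UV]; exists j.
have cvgc w : Om0 w ->
    ecard (empty_tuples A (section_lt n) w) @[n --> \oo] --> ecard (empty_tuples A section_all w).
  move=> Ow; apply: cvg_near_cst.
  have stab : \forall n \near \oo, forall z, F w z ->
      eta w `&` section_lt n z = set0 -> eta w `&` section_all z = set0.
    apply: near_forall_finite (finF w Ow) _ => z Fz.
    have [e|/eqP/set0P[y [ey [j UV]]]] := pselect (eta w `&` section_all z = set0).
      exact: nearW.
    exists j.+1 => // n /= jn e; exfalso.
    by have : (eta w `&` section_lt n z) y; [split => //; exists j|rewrite e].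
  apply: filterS stab => n hn.
  congr ecard; rewrite !emptyF; apply/seteqP; split => z /= [Fz [Az e]]; split => //; split => //.
    exact: hn.
  by rewrite -subset0 -e; apply: setIS; exact: section_lt_sub.
have mvoid B : measurable B -> measurable [set w | eta w `&` B = set0].
  exact: measurable_void.
have cvgv z : void_prob (section_lt n) z @[n --> \oo] --> void_prob section_all z.
  rewrite /void_prob.
  have mc n : measurable [set w | eta w `&` section_lt n z = set0].
    apply: mvoid.
    exact: measurable_section_lt.
  have -> : [set w | eta w `&` section_all z = set0] =
      \bigcap_n [set w | eta w `&` section_lt n z = set0].
    apply/seteqP; split => w /=.
      by move=> e n _ /=; rewrite -subset0 -e; exact: setIS.
    move=> e; rewrite -subset0 => y [ey [j UV]].
    by have <- := e j.+1 Logic.I; split => //; exists j.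
  apply: nonincreasing_cvg_mu => //.
  + by apply: le_lt_trans (probability_le1 P (mc 0%N)) _; rewrite ltry.
  + exact: bigcap_measurable.
  + move=> m n mn; apply/subsetPset => w /= e; rewrite -subset0 -e => y [ey [j jm UV]].
    by split => //; exists j => //; exact: leq_trans mn.
have m1 : measurable_fun Om0 (fun w => ecard (empty_tuples A section_all w)).
  apply: (emeasurable_fun_cvg (fun n w => ecard (empty_tuples A (section_lt n) w))) => //.
  by move=> n; case: (gn n).
have m2 : measurable_fun A (void_prob section_all).
  apply: (emeasurable_fun_cvg (fun n => void_prob (section_lt n))) => //.
  by move=> n; case: (gn n).
split => //.
pose c n := (\int[P]_(w in Om0) ecard (empty_tuples A (section_lt n) w))%E.
have Lfin : (tuple_measure Lam k (rect G) < +oo)%E.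
  rewrite tuple_measure_rect// -ge0_fin_numE; last by apply: prode_ge0.
  by apply: prode_fin_num => i _; rewrite ge0_fin_numE.
have AL : (tuple_measure Lam k A < +oo)%E.
  by apply: le_lt_trans Lfin; apply: le_measure; rewrite ?inE//; exact: measurable_rect.
have c1 : c n @[n --> \oo] --> (\int[P]_(w in Om0) ecard (empty_tuples A section_all w))%E.
  apply: (@dominated_cvg _ _ _ P _ mOm0 (fun n w => ecard (empty_tuples A (section_lt n) w)) _ (fun w => ecard (F w))).
  - by move=> n; case: (gn n).
  - by move=> w; exact: cvgc.
  - by move=> w Ow; rewrite ge0_fin_numE ?ecard_ge0//; exact: (ecard_empty_fin finG _ (@subset_refl _ (rect G)) Ow).
  - apply/integrableP; split => //.
    have -> : (\int[P]_(x in Om0) `|ecard (F x)| = \int[P]_(x in Om0) ecard (F x))%E.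
      by apply: eq_integral => w _; rewrite gee0_abs ?ecard_ge0.
    rewrite r3 integral_cst; last exact: measurable_rect.
    apply: lte_mul_pinfty => //.
    by rewrite ge0_fin_numE//; apply: le_lt_trans (probability_le1 P (mvoid _ measurable0)) _; rewrite ltry.
  - move=> n w Ow; rewrite gee0_abs ?ecard_ge0//; apply: le_ecard.
    by rewrite emptyF; exact: subIsetl.
have c2 : c n @[n --> \oo] --> (\int[tuple_measure Lam k]_(z in A) void_prob section_all z)%E.
  rewrite /c (_ : (fun n => _) = fun n => (\int[tuple_measure Lam k]_(z in A) void_prob (section_lt n) z)%E); last first.
    by apply/funext => n; case: (gn n).
  apply: (@dominated_cvg _ _ _ (tuple_measure Lam k) _ mA (fun n => void_prob (section_lt n)) _ (cst 1%E)).
  - by move=> n; case: (gn n).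
  - by move=> z _; exact: cvgv.
  - by [].
  - apply/integrableP; split; first exact: measurable_cst.
    rewrite (_ : (fun x => _) = cst 1%E); last by apply/funext => z; rewrite /= normr1.
    by rewrite integral_cst// mul1e.
  - move=> n z Az; rewrite gee0_abs//; apply: probability_le1.
    by apply: mvoid; exact: measurable_section_lt.
by apply: (cvg_unique _ c1 c2).
Qed.

End mecke_limit.
End mecke.

Section mecke_separated.
Variables (k : nat) (C : nat -> set T).
Hypotheses (mC : forall q, measurable (C q)) (LC : forall q, (Lam (C q) < +oo)%E).
Hypothesis C_separates : forall z : k.-tuple T, uniq z -> exists f : 'I_k -> nat,
  trivIset setT (fun i => C (f i)) /\ forall i, C (f i) (tnth z i).

(** Simultaneous finiteness on the countably many cells: the part of Omega where
    the counts of tuples are measurable. *)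
Definition finite_counts : set Omega := \bigcap_q [set w | (npoints (C q) w < +oo)%E].

Lemma setC_finite_count q :
  ~` [set w | (npoints (C q) w < +oo)%E] = [set w | npoints (C q) w = +oo%E].
Proof.
apply/seteqP; split => w /=.
  by move/negP; rewrite -leNgt leye_eq => /eqP.
by move=> ->; rewrite ltxx.
Qed.

Lemma measurable_infinite_count q : measurable [set w | npoints (C q) w = +oo%E].
Proof.
by apply: (@measurable_npoints_preim (C q) [set +oo%E] (mC q)); exact: emeasurable_set1.
Qed.

Lemma measurable_finite_counts : measurable finite_counts.
Proof.
apply: bigcap_measurable => // q _; rewrite -[X in measurable X]setCK setC_finite_count.
by apply: measurableC; exact: measurable_infinite_count.
Qed.

Lemma finite_counts_full : P (~` finite_counts) = 0%E.
Proof.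
rewrite /finite_counts setC_bigcap.
apply/eqP; rewrite eq_le measure_ge0 andbT.
under eq_bigcupr do rewrite setC_finite_count.
have mS := measurable_infinite_count.
apply: (le_trans (measure_sigma_subadditive _ mS (bigcup_measurable (fun q _ => mS q)) (@subset_refl _ _))).
by rewrite eseries0// => q _ _; exact: npoints_finite_ae.
Qed.

(** A tuple of distinct points lies in a product of disjoint cells; there are
    countably many such products, which are made disjoint in order to add up. *)
Lemma mecke_separated (U : nat -> set (k.-tuple T)) (V : nat -> set T) (A : set (k.-tuple T)) :
  (forall j, measurable (U j)) -> (forall j, measurable (V j)) ->
  measurable A -> (forall z : k.-tuple T, A z -> uniq z) ->
  (forall z i, A z -> ~ section_all U V z (tnth z i)) ->
  mecke finite_counts A (section_all U V).
Proof.
move=> mU mV mA Au AS.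
(* Families of cells that are not disjoint are replaced by empty ones. *)
pose G (f : k.-tuple nat) i := if `[< trivIset setT (fun i => C (tnth f i)) >]
  then C (tnth f i) else set0.
pose Rj j := if unpickle j is Some f then rect (G f) else set0.
have mG f i : measurable (G f i) by rewrite /G; case: ifP.
have mR j : measurable (Rj j).
  by rewrite /Rj; case: unpickle => // f; exact: measurable_rect.
have AE : A = \bigcup_j (A `&` seqDU Rj j).
  rewrite -setI_bigcupr -seqDU_bigcup_eq setIidl// => z Az.
  have [f [tf fz]] := C_separates (Au z Az).
  exists (pickle [tuple f i | i < k]) => //; rewrite /Rj pickleK => i.
  rewrite /G; case: asboolP => [_|]; first by rewrite tnth_mktuple.
  by move=> []; under eq_fun do rewrite tnth_mktuple.
have mD j : measurable (seqDU Rj j).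
  by apply: measurableD => //; apply: bigsetU_measurable.
rewrite AE; apply: mecke_bigcup => //.
- exact: measurable_finite_counts.
- by apply: trivIset_setIl; exact: trivIset_seqDU.
- by move=> j; exact: measurableI.
move=> j.
have := @subIsetl _ (Rj j) (~` \big[setU/set0]_(i < j) Rj i).
rewrite -setDE -/(seqDU Rj j) {2}/Rj.
case: (unpickle j) => [f DR|]; last first.
  by rewrite subset0 => ->; rewrite setI0; exact: mecke0.
apply: (@mecke_section_all k finite_counts measurable_finite_counts finite_counts_full (G f)) => //.
- apply/trivIsetP => a b _ _ ab; rewrite /G; case: asboolP; last by rewrite setI0.
  by move/trivIsetP; apply.
- by move=> i; rewrite /G; case: ifP => // _; rewrite measure0.
- move=> w i ow; rewrite /G; case: ifP => _; first exact: ow.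
  by rewrite /npoints setI0 ecard0.
- exact: measurableI.
- by move=> z [_ /DR].
- by move=> z i [Az _]; exact: AS.
Qed.

End mecke_separated.

End poisson.

(** * Measures with a density *)

Section full_measure.
Import HBNNSimple.
Context d (T : measurableType d) (R : realType) (mu : {measure set T -> \bar R}).

(** Without any measurability of f: each simple function below f may be cut off
    to D. The number of cells is only known to be measurable on a set of full
    measure. *)
Lemma integral_full_measure (D : set T) (f : T -> \bar R) :
  measurable D -> mu (~` D) = 0%E -> (forall x, 0 <= f x)%E ->
  (\int[mu]_x f x = \int[mu]_(x in D) f x)%E.
Proof.
move=> mD D0 f0; apply/eqP; rewrite eq_le; apply/andP; split; last first.
  rewrite integral_mulindic; apply: le_nnintegral => x.
    by rewrite mule_ge0// indic_ge0E.
  by rewrite indicE; case: (_ \in _); rewrite ?mule1 ?mule0.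
rewrite [X in (X <= _)%E]ge0_integralTE//; apply: ub_ereal_sup => _ [h /= hf <-].
rewrite -integralT_nnsfun.
have mh : measurable_fun setT (fun x => (h x)%:E) by apply/measurable_EFinP.
have h0 x : (0 <= (h x)%:E)%E by rewrite lee_fin.
have -> : (\int[mu]_x (h x)%:E = \int[mu]_(x in D) (h x)%:E)%E.
  rewrite [in RHS](_ : D = setT `\` ~` D); last by rewrite setTD setCK.
  by rewrite -ge0_negligible_integral//; exact: measurableC.
rewrite integral_mulindic [leRHS]integral_mulindic; apply: le_nnintegral => x.
  by rewrite mule_ge0// indic_ge0E.
by rewrite lee_wpmul2r// indic_ge0E.
Qed.

End full_measure.

Section density.
Context d (T : measurableType d) (R : realType).
Variables (mu : {measure set T -> \bar R}) (mu_sigma_finite : sigma_finite setT mu).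
Variables (f : T -> R) (mf : measurable_fun setT f) (f0 : forall x, 0 <= f x).

Let nu (A : set T) : \bar R := (\int[mu]_(x in A) (f x)%:E)%E.

Let nu0 : nu set0 = 0%E. Proof. exact: integral_set0. Qed.

Let nu_ge0 A : (0 <= nu A)%E.
Proof. by apply: integral_ge0 => x _; rewrite lee_fin. Qed.

Let nu_sigma_additive : semi_sigma_additive nu.
Proof.
move=> F mF tF mUF; rewrite /nu ge0_integral_bigcup//.
- by apply: is_cvg_ereal_nneg_natsum_cond => n _ _; exact: nu_ge0.
- by apply/measurable_EFinP/measurable_funTS.
- by move=> x _; rewrite lee_fin.
Qed.

Let nu_sigma_finite : sigma_finite setT nu.
Proof.
have [F FT Ffin] := mu_sigma_finite.
have mL n : measurable [set x | f x < n%:R].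
  by apply: measurable_set_lt => //; exact: measurable_cst.
pose G k := if unpickle k is Some p then F p.1 `&` [set x | f x < p.2%:R] else set0.
exists G.
  apply/esym/seteqP; split => // x _.
  have : [set: T] x by [].
  rewrite FT => -[i _ Fx].
  exists (pickle (i, (Num.bound (f x)))) => //; rewrite /G pickleK; split => //=.
  exact: archi_boundP.
move=> k; rewrite /G; case: unpickle => [[i j]|]; last by rewrite nu0.
have [mF muF] := Ffin i.
have mFL : measurable (F i `&` [set x | f x < j%:R]) by exact: measurableI.
split => //=.
apply: (@le_lt_trans _ _ (\int[mu]_(x in F i `&` [set x | (f x < j%:R)%R]) (cst j%:R%:E) x)%E).
  apply: ge0_le_integral => //.
  - by move=> x _; rewrite lee_fin.
  - by apply/measurable_EFinP/measurable_funTS.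
  - by move=> x [_ /ltW]; rewrite /= lee_fin.
rewrite integral_cst//; apply: lte_mul_pinfty; rewrite ?lee_fin//.
by apply: le_lt_trans muF; apply: le_measure; rewrite ?inE//; exact: subIsetl.
Qed.

HB.instance Definition _ := isMeasure.Build _ _ _ nu nu0 nu_ge0 nu_sigma_additive.
HB.instance Definition _ := Measure_isSigmaFinite.Build _ _ _ nu nu_sigma_finite.

(** Sets of finite measure on which the density is bounded exhaust the space. *)
Lemma sigma_finite_density : exists m : {sigma_finite_measure set T -> \bar R},
  (m : set T -> \bar R) = (fun A => \int[mu]_(x in A) (f x)%:E)%E.
Proof. by exists nu. Qed.

End density.

Section layer_cake.
Context d (T : measurableType d) (R : realType).
Notation leb := (@lebesgue_measure R).

(** Indicator of the region between 0 and the graph of g. *)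
Definition layer (g : T -> \bar R) (p : T * R) : R :=
  ((0 <= p.2) && (p.2%:E < g p.1)%E)%:R.

Lemma measurable_layer g : measurable_fun setT g ->
  measurable_fun setT (fun p : T * measurableTypeR R => (layer g p)%:E).
Proof.
move=> mg; apply/measurable_EFinP.
have -> : layer g = (\1_([set p : T * measurableTypeR R | 0 <= p.2] `&`
    [set p : T * measurableTypeR R | (p.2%:E < g p.1)%E]) : T * measurableTypeR R -> R).
  apply/funext => p; rewrite indicE /layer; congr (nat_of_bool _)%:R.
  by apply/idP/idP; [move=> /andP[? ?]; rewrite inE|rewrite inE => -[/= -> ->]].
apply: measurable_indic; apply: measurableI.
  by apply: measurable_set_le => //; exact: measurable_cst.
rewrite -[X in measurable X]setTI; apply: measurable_lte => //.
  by apply/measurable_EFinP; exact: measurable_snd.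
exact: (measurableT_comp mg measurable_fst).
Qed.

Lemma integral_layer g x : (0 <= g x)%E ->
  (\int[leb]_t (layer g (x, t))%:E = g x)%E.
Proof.
move=> g0.
have -> : (\int[leb]_t (layer g (x, t))%:E =
   \int[leb]_t (\1_[set t : R | 0 <= t /\ (t%:E < g x)%E] t)%:E)%E.
  apply: eq_integral => t _; rewrite indicE /layer/=; congr (_%:R%:E).
  by congr nat_of_bool; apply/idP/idP; [move=> /andP[? ?]; rewrite inE|rewrite inE => -[/= -> ->]].
case: (g x) g0 => [r|_|//].
- rewrite lee_fin => r0; have -> : [set t : R | 0 <= t /\ (t%:E < r%:E)%E] = `[0, r[%classic.
    by apply/seteqP; split => t /=; rewrite in_itv/= lte_fin; [move=> [-> ->]|move=> /andP].
  rewrite integral_indic// setIT; have := @lebesgue_measure_itv R `[0, r[ => /= ->.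
  by rewrite lte_fin sube0; case: ltgtP r0 => // <-.
- have -> : [set t : R | 0 <= t /\ (t%:E < +oo)%E] = `[0, +oo[%classic.
    by apply/seteqP; split => t /=; rewrite in_itv/= ltry andbT; [case|].
  rewrite integral_indic// setIT; have := @lebesgue_measure_itv R `[0, +oo[ => /= ->.
  by rewrite ltry.
Qed.

End layer_cake.

Section integral_density.
Context d (T : measurableType d) (R : realType).
Variables (mu nu : {sigma_finite_measure set T -> \bar R}).
Variables (f : T -> R) (mf : measurable_fun setT f) (f0 : forall x, 0 <= f x).
Hypothesis nuE : forall A, measurable A -> nu A = (\int[mu]_(x in A) (f x)%:E)%E.

(** Layer cake: g is the length of its layers, so after exchanging the integrals
    only the case of indicators remains, which is the definition of the density.
    *)
Lemma integral_density (g : T -> \bar R) : measurable_fun setT g ->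
  (forall x, 0 <= g x)%E -> (\int[nu]_x g x = \int[mu]_x (g x * (f x)%:E))%E.
Proof.
move=> mg g0.
have ml := measurable_layer mg.
have l0 p : (0 <= (layer g p)%:E)%E by rewrite lee_fin.
have mlf : measurable_fun setT (fun p : T * measurableTypeR R => (layer g p)%:E * (f p.1)%:E)%E.
  by apply: emeasurable_funM => //; apply/measurable_EFinP; exact: measurableT_comp mf measurable_fst.
have lf0 p : (0 <= (layer g p)%:E * (f p.1)%:E)%E by rewrite mule_ge0// lee_fin.
transitivity (\int[nu]_x \int[@lebesgue_measure R]_t (layer g (x, t))%:E)%E.
  by apply: eq_integral => x _; rewrite integral_layer.
rewrite (@fubini_tonelli _ _ _ _ _ nu (@lebesgue_measure R) (fun p => (layer g p)%:E) ml l0)/=.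
transitivity (\int[@lebesgue_measure R]_t \int[mu]_x ((layer g (x, t))%:E * (f x)%:E))%E.
  apply: eq_integral => t _.
  have mA : measurable [set x | (layer g (x, t))%:E = 1%E].
    apply: (@measurable_preimage _ _ _ _ (fun x => (layer g (x, t))%:E) [set 1%E]).
      exact: measurableT_comp ml (measurable_pair2 t).
    exact: emeasurable_set1.
  have lE x : (layer g (x, t))%:E = (\1_[set x | (layer g (x, t))%:E = 1%E] x : R)%:E.
    rewrite indicE /layer/=; case: (boolP (_ && _)) => h.
      by rewrite mem_set//= h.
    rewrite memNset//= (negbTE h) => -[] /esym/eqP.
    by rewrite oner_eq0.
  transitivity (\int[nu]_x (\1_[set x | (layer g (x, t))%:E = 1%E] x)%:E)%E.
    by apply: eq_integral => x _; rewrite -lE.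
  transitivity (nu [set x | (layer g (x, t))%:E = 1%E]).
    by rewrite integral_indic// setIT.
  rewrite (nuE mA) integral_mulindic.
  by apply: eq_integral => x _; rewrite muleC lE.
rewrite -(@fubini_tonelli _ _ _ _ _ mu (@lebesgue_measure R) (fun p => (layer g p)%:E * (f p.1)%:E)%E mlf lf0)/=.
apply: eq_integral => x _.
rewrite ge0_integralZr ?lee_fin// ?integral_layer//.
exact: measurableT_comp ml (measurable_pair1 x).
Qed.

End integral_density.

(** * Tuples of pairs *)

Section pair_tuple.
Context d1 d2 (T1 : measurableType d1) (T2 : measurableType d2) (R : realType).

Definition pair_tuple k (v : k.-tuple T1) (h : k.-tuple T2) : k.-tuple (T1 * T2) :=
  [tuple (tnth v i, tnth h i) | i < k].

Lemma pair_tuple_cons k x (v : k.-tuple T1) y (h : k.-tuple T2) :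
  pair_tuple [tuple of x :: v] [tuple of y :: h] = [tuple of (x, y) :: pair_tuple v h].
Proof.
apply: eq_from_tnth => i; rewrite tnth_mktuple.
by case: (unliftP ord0 i) => [j ->|->]; rewrite ?tnth0// !tnthS tnth_mktuple.
Qed.

Lemma measurable_pair_tuple k : measurable_fun setT
  (fun p : k.-tuple T1 * k.-tuple T2 => pair_tuple p.1 p.2).
Proof.
apply/measurable_fun_tnthP => i.
have -> : (@tnth k (T1 * T2)%type ^~ i) \o
    (fun p : k.-tuple T1 * k.-tuple T2 => pair_tuple p.1 p.2) =
    (fun p => (tnth p.1 i, tnth p.2 i)).
  by apply/funext => p; rewrite /= tnth_mktuple.
by apply: measurable_fun_pair; apply: measurableT_comp (@measurable_tnth _ _ k i) _.
Qed.

Variables (m1 : {sigma_finite_measure set T1 -> \bar R})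
  (m2 : {sigma_finite_measure set T2 -> \bar R})
  (nu : {sigma_finite_measure set (T1 * T2)%type -> \bar R}).
Variables (f : T1 * T2 -> R) (mf : measurable_fun setT f) (f0 : forall x, 0 <= f x).
Hypothesis nuE : forall A, measurable A -> nu A = (\int[m1 \x m2]_(x in A) (f x)%:E)%E.

Lemma integral_density_product (g : T1 * T2 -> \bar R) : measurable_fun setT g ->
  (forall x, 0 <= g x)%E ->
  (\int[nu]_p g p = \int[m1]_x \int[m2]_y (g (x, y) * (f (x, y))%:E))%E.
Proof.
move=> mg g0.
have [mu muE] := sigma_finite_pushforward (@sigma_finite_product _ _ _ _ _ m1 m2)
  (@measurable_id _ _ setT) (@measurable_id _ _ setT) (fun _ => erefl).
have mgf : measurable_fun setT (fun p => g p * (f p)%:E)%E.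
  by apply: emeasurable_funM => //; exact/measurable_EFinP.
transitivity (\int[mu]_p (g p * (f p)%:E))%E.
  apply: integral_density => // A mA; rewrite nuE//.
  apply: eq_measure_integral => B mB _.
  exact: (esym (congr1 (fun m => m B) muE)).
transitivity (\int[m1 \x m2]_p (g p * (f p)%:E))%E.
  apply: eq_measure_integral => B mB _.
  exact: (congr1 (fun m => m B) muE).
rewrite fubini_tonelli1// => p.
by rewrite mule_ge0// lee_fin.
Qed.

Section integral_tuple_density.
Variables (k : nat) (F : k.-tuple (T1 * T2) -> \bar R).
Hypotheses (mF : measurable_fun setT F) (F0 : forall z, (0 <= F z)%E).

Definition tuple_integrand (p : k.-tuple T1 * k.-tuple T2) : \bar R :=
  (F (pair_tuple p.1 p.2) * (\prod_(i < k) f (tnth p.1 i, tnth p.2 i))%:E)%E.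

Lemma measurable_tuple_integrand : measurable_fun setT tuple_integrand.
Proof.
apply: emeasurable_funM; first exact: measurableT_comp (@measurable_pair_tuple k).
apply/measurable_EFinP; apply: measurable_prod => i _.
apply: measurableT_comp mf _; apply: measurable_fun_pair.
  exact: measurableT_comp (@measurable_tnth _ _ k i) measurable_fst.
exact: measurableT_comp (@measurable_tnth _ _ k i) measurable_snd.
Qed.

Lemma tuple_integrand_ge0 p : (0 <= tuple_integrand p)%E.
Proof. by rewrite mule_ge0// lee_fin prodr_ge0. Qed.

End integral_tuple_density.

(** Induction on the length; the sites and the heights, which alternate in a
    tuple of points, are sorted by exchanging integrals. *)
Lemma integral_tuple_density k (F : k.-tuple (T1 * T2) -> \bar R) :
  measurable_fun setT F -> (forall z, 0 <= F z)%E ->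
  (\int[tuple_measure nu k]_z F z =
   \int[tuple_measure m1 k]_v \int[tuple_measure m2 k]_h tuple_integrand F (v, h))%E.
Proof.
elim: k F => [|k IHk] F mF F0.
  have mH := measurable_tuple_integrand mF.
  rewrite /= integral_dirac//.
  rewrite integral_dirac//; last first.
    exact: (measurable_integral_snd mH (tuple_integrand_ge0 F0) (tuple_measure m2 0)).
  rewrite integral_dirac//; last exact: measurableT_comp mH (measurable_pair1 _).
  rewrite !diracT !mul1e /tuple_integrand big_ord0 mule1; congr F.
  by apply: eq_from_tnth => -[].
have mH := measurable_tuple_integrand mF.
have H0 := tuple_integrand_ge0 F0.
have mFc : measurable_fun setT (fun q : (T1 * T2) * k.-tuple (T1 * T2) => F [tuple of q.1 :: q.2]).
  by apply: measurableT_comp => //; exact: measurable_tuple_cons.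
rewrite (integral_tuple_cons nu mF F0) integral_density_product; last 2 first.
- exact: (measurable_integral_snd mFc (fun _ => F0 _) (tuple_measure nu k)).
- by move=> p; apply: integral_ge0 => z _.
rewrite (integral_tuple_cons m1); last 2 first.
- exact: (measurable_integral_snd mH H0).
- by move=> v; apply: integral_ge0 => h _.
apply: eq_integral => x _.
have mHx : measurable_fun setT (fun q : T2 * k.-tuple T1 * k.-tuple T2 =>
    tuple_integrand F ([tuple of x :: q.1.2], [tuple of q.1.1 :: q.2])).
  apply: measurableT_comp mH _; apply: measurable_fun_pair.
    apply: measurable_cons; first exact: measurable_cst.
    exact: measurableT_comp measurable_snd measurable_fst.
  apply: measurable_cons; last exact: measurable_snd.
  exact: measurableT_comp measurable_fst measurable_fst.
transitivity (\int[m2]_y \int[tuple_measure m1 k]_v \int[tuple_measure m2 k]_h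
    tuple_integrand F ([tuple of x :: v], [tuple of y :: h]))%E.
  apply: eq_integral => y _.
  have mFy : measurable_fun setT (fun z : k.-tuple (T1 * T2) => F [tuple of (x, y) :: z]).
    exact: measurableT_comp mFc (measurable_pair1 (x, y)).
  have mHy := measurable_tuple_integrand mFy.
  have Hy0 := tuple_integrand_ge0 (fun z => F0 [tuple of (x, y) :: z]).
  rewrite (IHk _ mFy (fun _ => F0 _)) -ge0_integralZr//; last 3 first.
  - exact: (measurable_integral_snd mHy Hy0).
  - by move=> v _; apply: integral_ge0 => h _.
  - by rewrite lee_fin.
  apply: eq_integral => v _; rewrite -ge0_integralZr//; last 2 first.
  - exact: measurableT_comp mHy (measurable_pair1 v).
  - by rewrite lee_fin.
  apply: eq_integral => h _; rewrite /tuple_integrand/= pair_tuple_cons.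
  rewrite -muleA -EFinM big_ord_recl/= !tnth0 mulrC; congr (_ * (_ * _)%:E)%E.
  by apply: eq_bigr => i _; rewrite !tnthS.
rewrite (@fubini_tonelli _ _ _ _ _ m2 (tuple_measure m1 k)
  (fun q => \int[tuple_measure m2 k]_h tuple_integrand F ([tuple of x :: q.2], [tuple of q.1 :: h]))%E); last 2 first.
- exact: (measurable_integral_snd mHx (fun _ => H0 _) (tuple_measure m2 k)).
- by move=> q; apply: integral_ge0 => h _.
apply: eq_integral => v _ /=; rewrite (integral_tuple_cons m2)//.
exact: measurableT_comp mH (measurable_pair1 _).
Qed.

End pair_tuple.

(** * Paraboloids *)

Section paraboloids.
Context (R : realType) (n : nat).
Notation pt := ('rV[R]_n * R)%type.

Lemma continuous_sqnorm : continuous (@sqnorm R n).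
Proof.
suff cs (r : seq 'I_n) :
  continuous (fun v : 'rV[R]_n => \sum_(i <- r) v ord0 i ^+ 2 : R^o) by exact: cs.
elim: r => [|i r IHr] v.
  by under eq_fun do rewrite big_nil; exact: cst_continuous.
under [X in continuous_at _ X]eq_fun do rewrite big_cons.
apply: (@continuousD _ R^o _ (fun v : 'rV[R]_n => v ord0 i ^+ 2)); last exact: IHr.
apply: (@continuous_comp _ _ _ (fun v : 'rV[R]_n => v ord0 i) (fun x : R => x ^+ 2)).
  exact: coord_continuous.
exact: exprn_continuous.
Qed.

(** Signed vertical distance from the point up to the paraboloid with the given
    apex. *)
Definition depth (ap : pt * pt) : R := ap.1.2 - sqnorm (ap.2.1 - ap.1.1) - ap.2.2.

Lemma continuous_depth : continuous depth.
Proof.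
move=> ap.
suff : {for ap, continuous (fun ap : pt * pt => ap.1.2 - sqnorm (ap.2.1 - ap.1.1) - ap.2.2 : R^o)} by [].
apply: continuousB.
  apply: continuousB.
    by apply: (@continuous_comp _ _ _ fst snd); [exact: cvg_fst|exact: cvg_snd].
  apply: (@continuous_comp _ _ _ (fun ap : pt * pt => ap.2.1 - ap.1.1)); last exact: continuous_sqnorm.
  apply: continuousB.
    by apply: (@continuous_comp _ _ _ snd fst); [exact: cvg_snd|exact: cvg_fst].
  by apply: (@continuous_comp _ _ _ fst fst); exact: cvg_fst.
by apply: (@continuous_comp _ _ _ snd snd); exact: cvg_snd.
Qed.

Lemma continuous_depth1 a : continuous (fun p => depth (a, p)).
Proof.
move=> p; apply: (@continuous_comp _ _ _ (fun p => (a, p)) depth).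
  by apply: (@cvg_pair _ _ _ (nbhs p) (nbhs a) (nbhs p) _ _ _ (fun=> a) id); [exact: cvg_cst|exact: cvg_id].
exact: continuous_depth.
Qed.

Lemma paraboloidE a : paraboloid a = [set p | 0 <= depth (a, p)].
Proof. by apply/seteqP; split => p; rewrite /paraboloid /depth/= subr_ge0. Qed.

(** A point of zero depth leaves the paraboloid by an arbitrarily small vertical
    move. *)
Lemma interior_paraboloid a : (paraboloid a)° = [set p | 0 < depth (a, p)].
Proof.
rewrite paraboloidE; apply/seteqP; split => p.
  move=> /nbhs_ballP[e /= e0 pe].
  have /pe : ball p e (p.1, p.2 + e / 2).
    split => /=; first exact: ballxx.
    rewrite /ball/= opprD addrA subrr sub0r normrN gtr0_norm ?divr_gt0//.
    by rewrite ltr_pdivrMr// ltr_pMr// ltr1n.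
  rewrite /depth/=; have : 0 < e / 2 by rewrite divr_gt0.
  lra.
rewrite [X in _ -> X]/= => p0.
have : open [set p | 0 < depth (a, p)].
  by apply: (@open_comp _ _ (fun p => depth (a, p)) [set x | 0 < x]); [move=> q _; exact: continuous_depth1|exact: open_gt].
rewrite openE => /(_ p p0); apply: filterS => q /=; exact: ltW.
Qed.

Lemma boundary_paraboloid a :
  closure (paraboloid a) `\` (paraboloid a)° = [set p | depth (a, p) = 0].
Proof.
rewrite interior_paraboloid (_ : closure _ = paraboloid a); last first.
  rewrite paraboloidE; apply/esym/closure_id.
  by apply: (@closed_comp _ _ (fun p => depth (a, p)) [set x | 0 <= x]); [move=> q _; exact: continuous_depth1|exact: closed_ge].
rewrite paraboloidE; apply/seteqP; split => p /=.
  by move=> [h1 /negP]; rewrite -leNgt => h2; apply/eqP; rewrite eq_le h1 h2.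
by move=> ->; rewrite ltxx.
Qed.

End paraboloids.

(** The inverse is x times the power -1 of x^2, at 0 too because inverses of 0
    are 0. *)
Lemma measurable_inverse (R : realType) : measurable_fun setT (fun x : R => x^-1).
Proof.
rewrite (_ : (fun x => _) = fun x : R => x * (x ^+ 2) `^ (-1)).
  apply: measurable_funM => //; apply: (measurableT_comp (measurable_powR _)).
  exact: measurable_funX.
apply/funext => x; rewrite powR_inv1 ?sqr_ge0//.
have [->|x0] := eqVneq x 0; first by rewrite invr0 mul0r.
by rewrite expr2 invfM mulVKf.
Qed.

Section measurable_determinant.
Context (R : realType) d (T : measurableType d).

Lemma measurable_det k (A : T -> 'M[R]_k) :
  (forall i j, measurable_fun setT (fun x => A x i j : measurableTypeR R)) ->
  measurable_fun setT (fun x => \det (A x) : measurableTypeR R).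
Proof.
move=> mA; apply: measurable_sum => s.
apply: measurable_funM; first exact: measurable_cst.
by apply: measurable_prod => i _; exact: mA.
Qed.

Lemma measurable_adj k (A : T -> 'M[R]_k) i j :
  (forall i j, measurable_fun setT (fun x => A x i j : measurableTypeR R)) ->
  measurable_fun setT (fun x => (\adj (A x)) i j : measurableTypeR R).
Proof.
move=> mA; under eq_fun do rewrite mxE.
apply: measurable_funM; first exact: measurable_cst.
apply: measurable_det => i' j'; rewrite (_ : (fun x => _) = (fun x => A x (lift j i') (lift i j'))).
  exact: mA.
by apply/funext => x; rewrite !mxE.
Qed.

End measurable_determinant.

(** * The apex of a tuple of points *)

Section apex_solution.
Context (R : realType) (n : nat).
Notation pt := ('rV[R]_n * R)%type.
Implicit Types z : n.+1.-tuple pt.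

Definition site_mx z : 'M[R]_n.+1 := affine_mx (fun i => (tnth z i).1).

Lemma site_mx0 z i : site_mx z i ord0 = 1.
Proof. by rewrite mxE row_cons0. Qed.

Lemma site_mxS z i j : site_mx z i (lift ord0 j) = (tnth z i).1 ord0 j.
Proof. by rewrite mxE row_consS. Qed.

Definition lifted_heights z : 'rV[R]_n.+1 :=
  \row_i ((tnth z i).2 + sqnorm (tnth z i).1).

(** In these coordinates the heights of a paraboloid over given sites are
    affine. *)
Definition apex_coords (a : pt) : 'rV[R]_n.+1 := row_cons (a.2 - sqnorm a.1, 2 *: a.1).

Definition coords_apex (y : 'rV[R]_n.+1) : pt :=
  let w := 2^-1 *: (\row_j y ord0 (lift ord0 j)) in (w, y ord0 ord0 + sqnorm w).

Lemma apex_coordsK : cancel apex_coords coords_apex.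
Proof.
move=> [w s]; rewrite /coords_apex /apex_coords.
have -> : 2^-1 *: (\row_j row_cons (s - sqnorm w, 2 *: w) ord0 (lift ord0 j)) = w.
  by apply/rowP => j; rewrite mxE mxE row_consS mxE mulKf.
by rewrite row_cons0/= subrK.
Qed.

Lemma coords_apexK : cancel coords_apex apex_coords.
Proof.
move=> y; apply/rowP => i; rewrite /apex_coords /coords_apex.
case: (unliftP ord0 i) => [j ->|->].
  by rewrite row_consS mxE mxE mxE mulVKf.
by rewrite row_cons0 addrK.
Qed.

Lemma sqnormB (v w : 'rV[R]_n) :
  sqnorm (v - w) = sqnorm v - \sum_i v ord0 i * (2 *: w) ord0 i + sqnorm w.
Proof.
rewrite /sqnorm -sumrB -big_split/=; apply: eq_bigr => i _.
by rewrite !mxE; ring.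
Qed.

(** Expand |v_i - w|^2: the quadratic term in w goes into the coordinate s -
    |w|^2, and |v_i|^2 does not depend on the apex. *)
Lemma apex_coords_affine (v : 'I_n.+1 -> 'rV[R]_n) (a : pt) i :
  (apex_coords a *m (affine_mx v)^T) ord0 i = a.2 - sqnorm (v i - a.1) + sqnorm (v i).
Proof.
rewrite mxE big_ord_recl/= row_cons0 mxE [affine_mx _ _ _]mxE row_cons0 mulr1 sqnormB.
rewrite (eq_bigr (fun j => v i ord0 j * (2 *: a.1) ord0 j))/=; first by set S := \sum_(j < n) _; ring.
by move=> j _; rewrite row_consS [(affine_mx v)^T _ _]mxE [affine_mx _ _ _]mxE row_consS mulrC.
Qed.

Lemma depth0_coords z a : (forall i, depth (a, tnth z i) = 0) <->
  apex_coords a *m (site_mx z)^T = lifted_heights z.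
Proof.
split=> [h|h i].
  apply/rowP => i; rewrite apex_coords_affine [in RHS]mxE.
  by have := h i; rewrite /depth/=; lra.
have := congr1 (fun r : 'rV_n.+1 => r ord0 i) h.
by rewrite apex_coords_affine [in RHS]mxE /depth/=; lra.
Qed.

(** Solution of the linear system of depth0_coords by Cramer's rule, which has a
    value for singular systems also and is visibly measurable in z. *)
Definition apex_solution z : pt :=
  coords_apex ((\det (site_mx z)^T)^-1 *: (lifted_heights z *m \adj (site_mx z)^T)).

Lemma apex_solutionP z a : \det (site_mx z) != 0 ->
  (forall i, depth (a, tnth z i) = 0) <-> a = apex_solution z.
Proof.
move=> dz; have uz : (site_mx z)^T \in unitmx by rewrite unitmxE det_tr unitfE.
have -> : apex_solution z = coords_apex (lifted_heights z *m invmx (site_mx z)^T).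
  by rewrite /apex_solution /invmx uz scalemxAr.
rewrite depth0_coords; split => [h|->].
  by rewrite -h mulmxK// apex_coordsK.
by rewrite coords_apexK mulmxKV.
Qed.

(** Over affinely independent sites, exactly one paraboloid has all points on
    its boundary. *)
Lemma apexE z : \det (site_mx z) != 0 -> apex z = apex_solution z.
Proof.
move=> dz; rewrite /apex.
have -> : [set a | forall i, (closure (paraboloid a) `\` (paraboloid a)°) (tnth z i)] =
    [set apex_solution z].
  apply/seteqP; split => a /=.
    move=> h; apply/(apex_solutionP a dz) => i.
    suff : [set p | depth (a, p) = 0] (tnth z i) by [].
    by rewrite -boundary_paraboloid; exact: h.
  move=> /(apex_solutionP a dz) h i.
  suff : (closure (paraboloid a) `\` (paraboloid a)°) (tnth z i) by [].
  by rewrite boundary_paraboloid; exact: h.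
by case: xgetP => [? -> //|/(_ (apex_solution z))[]].
Qed.

(** The conditions on c in the definition of affine independence say that c is
    in the left kernel of the matrix with rows (1, v_i). *)
Lemma site_mx_free z :
  affinely_independent (fun i => (tnth z i).1) <-> \det (site_mx z) != 0.
Proof.
have mulE (c : 'rV[R]_n.+1) : c *m site_mx z =
    row_cons (\sum_i c ord0 i, \sum_i c ord0 i *: (tnth z i).1).
  apply/rowP => j; rewrite mxE; case: (unliftP ord0 j) => [j' ->|->].
    rewrite row_consS summxE; apply: eq_bigr => i _.
    by rewrite site_mxS mxE.
  by rewrite row_cons0; apply: eq_bigr => i _; rewrite site_mx0 mulr1.
split => [h|dz c c0 cv].
  rewrite -unitfE -unitmxE -row_free_unit -kermx_eq0; apply/eqP/row_matrixP => r.
  rewrite row0; apply/rowP => i; rewrite [in RHS]mxE.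
  have : row r (kermx (site_mx z)) *m site_mx z = 0 by rewrite -row_mul mulmx_ker row0.
  rewrite mulE => h0; apply: (h (fun i => (row r (kermx (site_mx z))) ord0 i)).
    by have := congr1 (fun x : 'rV_n.+1 => x ord0 ord0) h0; rewrite row_cons0 mxE.
  apply/rowP => j; have := congr1 (fun x : 'rV_n.+1 => x ord0 (lift ord0 j)) h0.
  by rewrite row_consS mxE => ->; rewrite mxE.
have : (\row_i c i) *m site_mx z = 0.
  rewrite mulE; apply/rowP => j; rewrite [in RHS]mxE; case: (unliftP ord0 j) => [j' ->|->].
    rewrite row_consS/=; under eq_bigr do rewrite mxE.
    by rewrite cv mxE.
  by rewrite row_cons0/=; under eq_bigr do rewrite mxE.
move=> h i; have uz : site_mx z \in unitmx by rewrite unitmxE unitfE.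
have := congr1 (fun r => r *m invmx (site_mx z)) h; rewrite mulmxK// mul0mx.
by move=> /rowP/(_ i); rewrite !mxE.
Qed.

(** Two equal points would give two equal rows. *)
Lemma site_mx_uniq z : \det (site_mx z) != 0 -> uniq z.
Proof.
move=> dz; apply/tuple_uniqP => i j zij; apply/eqP; apply: contraNT dz => ij.
apply/eqP; apply: (determinant_alternate ij) => l.
by rewrite !mxE zij.
Qed.

Lemma distinct_tuplesE (E : set pt) : distinct_tuples (k := n.+1) E =
  [set z | (forall i, E (tnth z i)) /\ \det (site_mx z) != 0].
Proof.
apply/seteqP; split => z /=.
  by move=> [Ez _ /site_mx_free].
by move=> [Ez dz]; split => //; [exact: site_mx_uniq|exact/site_mx_free].
Qed.

End apex_solution.

(** * Countable covers by rational balls *)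

Section rational_balls.
Context (R : realType) (n : nat).
Notation pt := ('rV[R]_n * R)%type.

Lemma measurable_pt_ball (p : pt) e : 0 < e -> measurable (ball p e : set pt).
Proof.
move=> e0; have -> : ball p e = [set q : pt | forall i, `|p.1 ord0 i - q.1 ord0 i| < e] `&`
    [set q : pt | `|p.2 - q.2| < e].
  apply/seteqP; split => q /=.
    by move=> [[_ h1] h2]; split => // i; exact: h1.
  by move=> [h1 h2]; split => //; split => // i j; rewrite (ord1 i); exact: h1.
apply: measurableI.
  apply: measurable_forall_ord => i; apply: measurable_set_lt; last exact: measurable_cst.
  apply: measurableT_comp => //; apply: measurable_funB; first exact: measurable_cst.
  exact: measurableT_comp (measurable_row_coord i) measurable_fst.
apply: measurable_set_lt; last exact: measurable_cst.
by apply: measurableT_comp => //; apply: measurable_funB.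
Qed.

Definition rational_pt (q : 'rV[rat]_n * rat) : pt := (map_mx ratr q.1, ratr q.2).

Lemma dense_rational_pt (p : pt) e : 0 < e -> exists q, ball (rational_pt q) e p.
Proof.
move=> e0.
have near_rat (x : R) : exists q : rat, ball (ratr q : R) e x.
  have xe : x < x + e by rewrite ltrDl.
  have [q] := rat_in_itvoo xe.
  rewrite in_itv/= => /andP[q1 q2]; exists q.
  by rewrite /ball/= ger0_norm ?subr_ge0 ?ltW// ltrBlDl.
have [f fP] := choice (fun i => near_rat (p.1 ord0 i)).
have [g gP] := near_rat p.2.
exists (\row_i f i, g); split => //; split => //= i j.
by rewrite !mxE (ord1 i); exact: fP.
Qed.

Definition rational_ball (c : ('rV[rat]_n * rat) * nat) : set pt :=
  ball (rational_pt c.1) c.2.+1%:R^-1.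

Lemma measurable_rational_ball c : measurable (rational_ball c).
Proof. by apply: measurable_pt_ball; rewrite invr_gt0. Qed.

(** Intersecting with a sequence of sets of finite measure makes the cells
    finite for every sigma-finite intensity. *)
Definition separating_cell (F : nat -> set pt) (j : nat) : set pt :=
  if unpickle j is Some (c, i) then rational_ball c `&` F i else set0.

Lemma near_inv_lt (e : R) : 0 < e -> \forall m \near \oo, m.+1%:R^-1 < e.
Proof.
move=> e0; have : (m.+1%:R^-1 : R) @[m --> \oo] --> (0 : R) by exact: cvg_harmonic.
by move=> /cvgrPdist_lt/(_ _ e0); apply: filterS => m; rewrite sub0r normrN gtr0_norm ?invr_gt0.
Qed.

(** Balls around distinct points are disjoint once their radius is small
    compared with the smallest distance. *)
Lemma separating_cellP (F : nat -> set pt) k (z : k.-tuple pt) :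
  \bigcup_i F i = setT -> uniq z -> exists f : 'I_k -> nat,
    trivIset setT (fun i => separating_cell F (f i)) /\
    forall i, separating_cell F (f i) (tnth z i).
Proof.
move=> FT /tuple_uniqP uz.
have [m hm] : exists m, forall ij : 'I_k * 'I_k, [set ij | ij.1 != ij.2] ij ->
    (m.+1%:R^-1 : R) < `|tnth z ij.1 - tnth z ij.2| / 4.
  have finS : finite_set [set ij : 'I_k * 'I_k | ij.1 != ij.2] by exact: finite_finset.
  have := @near_forall_finite _ _ (fun ij m => (m.+1%:R^-1 : R) < `|tnth z ij.1 - tnth z ij.2| / 4) finS.
  case=> [[i j]/= ij|m _ hm].
    apply: near_inv_lt; rewrite divr_gt0// normr_gt0 subr_eq0.
    by apply: contra ij => /eqP/uz ->.
  by exists m => ij Sij; apply: (hm m) => //=.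
have m0 : 0 < (m.+1%:R^-1 : R) by rewrite invr_gt0.
have [q qP] := choice (fun i => dense_rational_pt (tnth z i) m0).
have zF i : exists l, F l (tnth z i).
  have : (\bigcup_i F i) (tnth z i) by rewrite FT.
  by move=> [l _ Fl]; exists l.
have [g gP] := choice zF.
exists (fun i => pickle ((q i, m), g i)); split => [|i]; last first.
  by rewrite /separating_cell pickleK; split; [exact: qP|exact: gP].
apply/trivIsetP => i j _ _ ij; rewrite -subset0 /separating_cell !pickleK.
move=> p [[pi _] [pj _]].
have := hm (i, j) ij; rewrite ltNge => /negP; apply => /=.
have bn (x y y' : pt) e : ball x e y -> ball x e y' -> `|y - y'| <= e + e.
  move=> xy xy'; apply: ltW.
  have := ball_triangle (ball_sym xy) xy'.
  by rewrite -ball_normE.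
have h1 := bn _ _ _ _ (qP i) pi; have h2 := bn _ _ _ _ pj (qP j).
rewrite ler_pdivrMr//; apply: (le_trans (ler_distD p _ _)).
apply: (le_trans (lerD h1 h2)) => /=; set e := m.+1%:R^-1.
by rewrite -!mulr2n -mulrnA mulr_natr.
Qed.

(** The apices in the first ball, provided that every point of the second ball
    is strictly below every paraboloid with apex in the first one. *)
Definition covered_apex (c : (('rV[rat]_n * rat) * ('rV[rat]_n * rat)) * nat) : set pt :=
  [set a | rational_ball (c.1.1, c.2) a /\
    forall a' p, rational_ball (c.1.1, c.2) a' -> rational_ball (c.1.2, c.2) p ->
      0 < depth (a', p)].

Definition apex_cell j : set pt := if unpickle j is Some c then covered_apex c else set0.
Definition point_cell j : set pt :=
  if unpickle j is Some c then let c : (('rV[rat]_n * rat) * ('rV[rat]_n * rat)) * nat := c in rational_ball (c.1.2, c.2) else set0.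

Lemma measurable_apex_cell j : measurable (apex_cell j).
Proof.
rewrite /apex_cell; case: unpickle => // c.
have [h|h] := pselect (forall a' p, rational_ball (c.1.1, c.2) a' ->
    rational_ball (c.1.2, c.2) p -> 0 < depth (a', p)).
  rewrite (_ : covered_apex c = rational_ball (c.1.1, c.2)); first exact: measurable_rational_ball.
  by apply/seteqP; split => a; [case|].
by rewrite (_ : covered_apex c = set0)//; apply/seteqP; split => a // [].
Qed.

Lemma measurable_point_cell j : measurable (point_cell j).
Proof.
by rewrite /point_cell; case: unpickle => // c; exact: measurable_rational_ball.
Qed.

(** Positivity of the depth is an open condition on the apex and the point
    together, so it holds on a product of two small rational balls. *)
Lemma apex_point_cellP a p : 0 < depth (a, p) <-> exists j, apex_cell j a /\ point_cell j p.
Proof.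
split=> [h|[j]]; last first.
  rewrite /apex_cell /point_cell; case: unpickle => [c|[]//].
  by move=> [[ac h] pc]; exact: h.
have : nbhs (a, p) [set x | 0 < depth x].
  apply: (@continuous_depth R n (a, p) [set x | 0 < x]).
  by apply: open_nbhs_nbhs; split => //; exact: open_gt.
move=> /nbhs_ballP[e /= e0 he].
have [m _ /(_ m (leqnn _)) hm] : \forall m \near \oo, (m.+1%:R^-1 : R) < e / 2.
  by apply: near_inv_lt; rewrite divr_gt0.
have m0 : 0 < (m.+1%:R^-1 : R) by rewrite invr_gt0.
have [q qP] := dense_rational_pt a m0.
have [q' qP'] := dense_rational_pt p m0.
exists (pickle ((q, q'), m)); rewrite /apex_cell /point_cell pickleK; split => //; split => //.
move=> a' p' ha hp; apply: he.
have tri x y y' : ball x m.+1%:R^-1 y -> ball x m.+1%:R^-1 y' -> ball (y : pt) e y'.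
  move=> xy xy'; rewrite (splitr e); apply: (@ball_triangle _ _ x).
    by apply: ball_sym; apply: le_ball xy; exact: ltW.
  by apply: le_ball xy'; exact: ltW.
by split; [exact: (tri (rational_pt q))|exact: (tri (rational_pt q'))].
Qed.

End rational_balls.

Section measurable_apex.
Context (R : realType) (n : nat).
Notation pt := ('rV[R]_n * R)%type.

Lemma measurable_tnth_site (i : 'I_n.+1) :
  measurable_fun setT (fun z : n.+1.-tuple pt => (tnth z i).1).
Proof. exact: measurableT_comp measurable_fst (@measurable_tnth _ _ _ i). Qed.

Lemma measurable_tnth_height (i : 'I_n.+1) :
  measurable_fun setT (fun z : n.+1.-tuple pt => (tnth z i).2).
Proof. exact: measurableT_comp measurable_snd (@measurable_tnth _ _ _ i). Qed.

Lemma measurable_affine_mx d (T : measurableType d) (v : T -> 'I_n.+1 -> 'rV[R]_n) i j :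
  (forall i, measurable_fun setT (v ^~ i)) ->
  measurable_fun setT (fun x => affine_mx (v x) i j).
Proof.
move=> mv; case: (unliftP ord0 j) => [j' ->|->].
  rewrite (_ : (fun x => _) = fun x => v x i ord0 j').
    exact: measurableT_comp (measurable_row_coord j') (mv i).
  by apply/funext => x; rewrite mxE row_consS.
rewrite (_ : (fun x => _) = cst 1); first exact: measurable_cst.
by apply/funext => x; rewrite mxE row_cons0.
Qed.

Lemma measurable_det_affine d (T : measurableType d) (v : T -> 'I_n.+1 -> 'rV[R]_n) :
  (forall i, measurable_fun setT (v ^~ i)) ->
  measurable_fun setT (fun x => \det (affine_mx (v x))).
Proof. by move=> mv; apply: measurable_det => i j; exact: measurable_affine_mx. Qed.

Lemma measurable_site_mx i j :
  measurable_fun setT (fun z : n.+1.-tuple pt => site_mx z i j).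
Proof. by apply: measurable_affine_mx => k; exact: measurable_tnth_site. Qed.

Lemma measurable_det_site : measurable_fun setT (fun z : n.+1.-tuple pt => \det (site_mx z)).
Proof. by apply: measurable_det_affine => k; exact: measurable_tnth_site. Qed.

Lemma measurable_apex_solution : measurable_fun setT (@apex_solution R n).
Proof.
have mtr i j : measurable_fun setT (fun z : n.+1.-tuple pt => (site_mx z)^T i j).
  by under eq_fun do rewrite mxE; exact: measurable_site_mx.
apply: (@measurableT_comp _ _ _ _ _ _ (@coords_apex R n)); last first.
  apply/measurable_rowP => i; under eq_fun do rewrite mxE.
  apply: measurable_funM.
    apply: (@measurableT_comp _ _ _ _ _ _ (fun x : R => x^-1)); first exact: measurable_inverse.
    exact: measurable_det.
  rewrite (_ : (fun _ => _) = fun z : n.+1.-tuple pt =>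
      \sum_j ((tnth z j).2 + sqnorm (tnth z j).1) * (\adj (site_mx z)^T) j i).
    apply: measurable_sum => j; apply: measurable_funM; last exact: measurable_adj.
    apply: measurable_funD; first exact: measurable_tnth_height.
    exact: measurableT_comp (@measurable_sqnorm R n) (measurable_tnth_site j).
  by apply/funext => z; rewrite mxE; apply: eq_bigr => j _; rewrite mxE.
have mw : measurable_fun setT (fun y : 'rV[R]_n.+1 =>
    2^-1 *: (\row_j y ord0 (lift ord0 j)) : 'rV[R]_n).
  apply/measurable_rowP => i.
  rewrite (_ : (fun _ => _) = fun y : 'rV[R]_n.+1 => 2^-1 * y ord0 (lift ord0 i)).
    by apply: measurable_funM; [exact: measurable_cst|exact: measurable_row_coord].
  by apply/funext => y; rewrite !mxE.
apply: measurable_fun_pair; first exact: mw.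
apply: measurable_funD; first exact: measurable_row_coord.
exact: measurableT_comp (@measurable_sqnorm R n) mw.
Qed.

End measurable_apex.

(** * The substitution t = 1 - b / s *)

Section inversion.
Context (R : realType).
Notation leb := (@lebesgue_measure R).

Lemma integral_inverse_square (b c : R) : 0 < b -> 0 < c ->
  (\int[leb]_s ((b / s ^+ 2)%:E * ((c < s)%R%:R)%:E) = (b / c)%:E)%E.
Proof.
move=> b0 c0.
have dV (s : R) : 0 < s -> is_derive s 1 (fun s : R => - b *: (s^-1 : R^o)) (b / s ^+ 2).
  move=> s0; have sn0 : s != 0 by rewrite gt_eqF.
  apply: is_derive_eq; first by apply: is_deriveZ; exact: is_deriveV.
  by rewrite /GRing.scale/= mulr1 mulrNN.
have s_gt0 (s : R) : c <= s -> 0 < s by move=> cs; rewrite (lt_le_trans c0).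
have cf (s : R) : 0 < s -> {for s, continuous (fun s : R => b / s ^+ 2)}.
  move=> s0; apply: (@continuousM _ _ (fun=> b) (fun s : R => (s ^+ 2)^-1)).
    exact: cst_continuous.
  apply: (@continuousV _ _ (fun s : R => s ^+ 2)); last exact: exprn_continuous.
  by rewrite gt_eqF// exprn_gt0.
have cF (s : R) : 0 < s -> {for s, continuous (fun s : R => - b *: (s^-1 : R^o))}.
  move=> s0; apply: differentiable_continuous; apply/derivable1_diffP.
  by have [] := dV s s0.
have mf : measurable_fun setT (fun s : R => b / s ^+ 2).
  apply: measurable_funM; first exact: measurable_cst.
  by apply: (measurableT_comp (@measurable_inverse R)); exact: measurable_funX.
transitivity (\int[leb]_(s in `[c, +oo[) (b / s ^+ 2)%:E)%E.
  rewrite -integral_itv_obnd_cbnd; last exact/measurable_EFinP/measurable_funTS.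
  rewrite [RHS]integral_mulindic; apply: eq_integral => s _; congr (_ * _%:E)%E.
  by rewrite indicE; congr (nat_of_bool _)%:R; apply/idP/idP; rewrite inE /= in_itv/= andbT.
have -> : (b / c)%:E = (0%:E - (- b *: (c^-1 : R^o))%:E)%E.
  by rewrite sub0e -EFinN /GRing.scale/= mulNr opprK.
apply: (@ge0_continuous_FTC2y _ _ (fun s : R => - b *: (s^-1 : R^o)) c 0).
- by move=> s cs; rewrite divr_ge0 ?sqr_ge0 ?ltW.
- apply: continuous_in_subspaceT => s; rewrite inE/= in_itv/= andbT => cs.
  exact/cf/s_gt0.
- rewrite -(scaler0 _ (- b)); apply: cvgZr.
  apply/gtr0_cvgV0; last exact: cvg_id.
  by near=> s.
- by move=> s cs; have [] := dV s (s_gt0 s (ltW cs)).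
- by apply: cvg_at_right_filter; exact: cF.
- move=> s; rewrite in_itv/= andbT => cs.
  by rewrite derive1E; have [_ ->] := dV s (s_gt0 s (ltW cs)).
Unshelve. all: by end_near. Qed.

Definition inversion (b s : R) : R := 1 - b / s.

Lemma measurable_inversion b : measurable_fun setT (inversion b).
Proof.
apply: measurable_funB; first exact: measurable_cst.
apply: measurable_funM; first exact: measurable_cst.
exact: measurable_inverse.
Qed.

Lemma measurable_inversionK b : measurable_fun setT (fun t : R => b / (1 - t)).
Proof.
apply: measurable_funM; first exact: measurable_cst.
apply: (measurableT_comp (@measurable_inverse R)).
by apply: measurable_funB; first exact: measurable_cst.
Qed.

Lemma inversionK b : 0 < b -> cancel (inversion b) (fun t => b / (1 - t)).
Proof.
move=> b0 s; rewrite /inversion opprB addrC subrK invfM invrK mulrA divff ?mul1r//.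
by rewrite gt_eqF.
Qed.

End inversion.

Section integral_inversion.
Context (R : realType).
Notation leb := (@lebesgue_measure R).

Lemma unit_ray (x : R) : (\int[leb]_(t in `]x, +oo[) ((0 < t < 1)%R%:R)%:E =
  (if Num.max x 0 < 1 then 1 - Num.max x 0 else 0)%:E)%E.
Proof.
rewrite integral_mulindic.
transitivity (\int[leb]_t (\1_(`]Num.max x 0, 1[%classic) t)%:E)%E.
  apply: eq_integral => t _; rewrite !indicE -EFinM -natrM mulnb; congr (_%:R%:E).
  congr nat_of_bool; apply/idP/idP.
    move=> /andP[/andP[t0 t1]]; rewrite inE /= in_itv/= andbT => xt.
    by rewrite inE /= in_itv/= gt_max xt t0.
  rewrite inE /= in_itv/= gt_max => /andP[/andP[xt t0] t1].
  by rewrite t0 t1/= inE /= in_itv/= xt.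
rewrite integral_indic// setIT; have := @lebesgue_measure_itv R `]Num.max x 0, 1[ => /= ->.
by rewrite lte_fin; case: ifP.
Qed.

Lemma inversion_ray (b x : R) : 0 < b ->
  (\int[leb]_(s in inversion b @^-1` `]x, +oo[) (b / s ^+ 2 * (b < s)%R%:R)%:E =
  (if Num.max x 0 < 1 then 1 - Num.max x 0 else 0)%:E)%E.
Proof.
move=> b0; rewrite integral_mulindic.
have sE (s : R) : b < s -> (x < inversion b s) = (b < (1 - x) * s).
  move=> bs; have s0 : 0 < s by exact: lt_trans bs.
  by rewrite /inversion -ltr_pdivrMr//; apply/idP/idP => h; lra.
set y := Num.max x 0.
have yE (s : R) : b < s -> (b < (1 - x) * s) = (b < (1 - y) * s).
  move=> bs; have s0 : 0 < s by exact: lt_trans bs.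
  rewrite /y; case: (leP x 0) => // x0; rewrite subr0 mul1r bs.
  have xs : x * s <= 0 by rewrite mulr_le0_ge0// ltW.
  by rewrite mulrBl mul1r; lra.
case: ifPn => [y1|]; last first.
  rewrite -leNgt => y1; apply: integral0_eq => s _; rewrite indicE.
  case: (ltP b s) => [bs|]; last by rewrite mulr0 mul0e.
  rewrite memNset ?mule0//= in_itv/= andbT sE// yE//; apply/negP; rewrite -leNgt.
  have s0 : 0 < s by exact: lt_trans bs.
  by apply: (@le_trans _ _ 0); [rewrite mulr_le0_ge0 ?subr_le0// ltW|exact: ltW].
have c0 : 0 < b / (1 - y) by rewrite divr_gt0// subr_gt0.
have <- : (b / (b / (1 - y)))%:E = (1 - y)%:E.
  by rewrite invf_div mulrC divfK// gt_eqF.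
rewrite -(integral_inverse_square b0 c0); apply: eq_integral => s _.
rewrite indicE EFinM -muleA; congr (_ * _)%E.
rewrite -EFinM -natrM mulnb; congr (_%:R)%:E; congr nat_of_bool.
have y0 : 0 <= y by rewrite le_max lexx orbT.
have inE' : (s \in inversion b @^-1` `]x, +oo[) = (x < inversion b s).
  by apply/idP/idP; rewrite inE /= in_itv/= andbT.
rewrite inE' ltr_pdivrMr ?subr_gt0// [s * _]mulrC.
case: (ltP b s) => [bs|sb]/=; first by rewrite sE// yE.
apply/esym/negbTE; rewrite -leNgt; have [s0|s0] := leP 0 s.
  by apply: le_trans sb; rewrite ler_piMl// lerBlDr lerDl.
by apply: (@le_trans _ _ 0); [rewrite mulr_ge0_le0 ?subr_ge0// ltW|exact: ltW].
Qed.

(** The integrand is only measurable, so this is proved as an equality of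
    measures. Both the image of b / s^2 ds on s > b and the uniform measure on
    (0, 1) are finite, so they need only be compared on the half-lines. *)
Lemma integral_inversion (b : R) (f : R -> \bar R) : 0 < b ->
  measurable_fun setT f -> (forall x, 0 <= f x)%E ->
  (\int[leb]_s (f (inversion b s) * (b / s ^+ 2 * (b < s)%R%:R)%:E) =
   \int[leb]_t (f t * ((0 < t < 1)%R%:R)%:E))%E.
Proof.
move=> b0 mf f0.
have md : measurable_fun setT (fun s : R => b / s ^+ 2 * (b < s)%R%:R : R).
  apply: measurable_funM; last first.
    by apply/measurable_EFinP; apply: measurable_bool_lt => //; exact: measurable_cst.
  apply: measurable_funM; first exact: measurable_cst.
  by apply: (measurableT_comp (@measurable_inverse R)); exact: measurable_funX.
have d0 (s : R) : 0 <= b / s ^+ 2 * (b < s)%R%:R.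
  by rewrite mulr_ge0// divr_ge0 ?sqr_ge0// ltW.
have mu01 : measurable_fun setT (fun t : R => (0 < t < 1)%R%:R : R).
  rewrite (_ : (fun t => _) = fun t : R => (0 < t)%R%:R * (t < 1)%R%:R).
    by apply: measurable_funM; apply/measurable_EFinP; apply: measurable_bool_lt => //; exact: measurable_cst.
  by apply/funext => t; rewrite -natrM mulnb.
have [nu nuE] := sigma_finite_density (sigma_finiteT leb) md d0.
have [U UE] := sigma_finite_density (sigma_finiteT leb) mu01 (fun _ => ler0n _ _).
have [m mE] : exists m : {sigma_finite_measure set (measurableTypeR R) -> \bar R},
    (m : set _ -> \bar R) =
    pushforward nu (inversion b : measurableTypeR R -> measurableTypeR R).
  exact: (@sigma_finite_pushforward _ _ (measurableTypeR R) (measurableTypeR R) R nu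
    (inversion b) (fun t => b / (1 - t)) (sigma_finiteT nu) (measurable_inversion b)
    (measurable_inversionK b) (inversionK b0)).
have mU A : measurable A -> U A = m A.
  apply: (@measure_unique _ R (measurableTypeR R) (@RGenOInfty.G R)
    (fun k => `](- k%:R), +oo[%classic)).
  - exact: RGenOInfty.measurableE.
  - move=> _ _ [x ->] [y ->]; exists (Num.max x y).
    apply/seteqP; split => t /=; rewrite !in_itv/= !andbT gt_max.
      by move=> [-> ->].
    by move=> /andP.
  - by move=> i; exists (- i%:R).
  - apply/seteqP; split => // x _; exists (Num.bound `|x|) => //=.
    rewrite in_itv/= andbT ltrNl; apply: le_lt_trans (_ : `|x| < _).
      by rewrite -normrN ler_norm.
    exact: archi_boundP.
  - move=> _ [x ->].
    transitivity (\int[leb]_(t in `]x, +oo[) ((0 < t < 1)%R%:R)%:E)%E.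
      exact: (congr1 (fun g => g _) UE).
    rewrite unit_ray -(inversion_ray x b0).
    transitivity (nu (inversion b @^-1` `]x, +oo[)).
      exact: (esym (congr1 (fun g => g _) nuE)).
    exact: (esym (congr1 (fun g => g _) mE)).
  - move=> k.
    apply: (@le_lt_trans _ _ (\int[leb]_(t in `](- k%:R)%R, +oo[) ((0 < t < 1)%R%:R)%:E)%E).
      by rewrite le_eqVlt; apply/orP; left; apply/eqP; exact: (congr1 (fun g => g _) UE).
    by rewrite unit_ray ltry.
transitivity (\int[U]_t f t)%E; last first.
  rewrite (integral_density (mu := leb) mu01)//.
  move=> A mA; exact: (congr1 (fun g => g _) UE).
transitivity (\int[nu]_s f (inversion b s))%E.
  rewrite (integral_density (mu := leb) md)//.
  - by move=> A mA; exact: (congr1 (fun g => g _) nuE).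
  - exact: measurableT_comp mf (measurable_inversion b).
rewrite -(@integral_measure_image _ _ _ _ _ _ nu m f (measurable_inversion b))//.
  by apply: eq_measure_integral => A mA _; rewrite -[LHS]mU.
by move=> A mA; exact: (congr1 (fun g => g _) mE).
Qed.

End integral_inversion.

(** * Changes of variables on tuples *)

Section tuple_map.
Context d (T : measurableType d) (R : realType).
Variables (mu : {sigma_finite_measure set T -> \bar R}) (phi : T -> T) (c : R).
Hypotheses (mphi : measurable_fun setT phi) (c0 : 0 <= c).
Hypothesis phiE : forall f : T -> \bar R, measurable_fun setT f ->
  (forall x, 0 <= f x)%E -> (\int[mu]_x f x = c%:E * \int[mu]_x f (phi x))%E.

Lemma measurable_tuple_map k : measurable_fun setT (map_tuple phi : k.-tuple T -> k.-tuple T).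
Proof.
apply/measurable_fun_tnthP => i.
rewrite (_ : _ \o _ = phi \o (fun t : k.-tuple T => tnth t i)).
  exact: measurableT_comp mphi (@measurable_tnth _ _ k i).
by apply/funext => t /=; rewrite tnth_map.
Qed.

(** A change of variables in one entry, by a map with constant Jacobian c, gives
    one in all entries. *)
Lemma integral_tuple_map k (f : k.-tuple T -> \bar R) : measurable_fun setT f ->
  (forall x, 0 <= f x)%E ->
  (\int[tuple_measure mu k]_t f t =
   (c ^+ k)%:E * \int[tuple_measure mu k]_t f (map_tuple phi t))%E.
Proof.
elim: k f => [|k IHk] f mf f0.
  rewrite expr0 mul1e; apply: eq_integral => t _; congr f.
  by apply: eq_from_tnth => -[].
have mfc : measurable_fun setT (fun p : T * k.-tuple T => f [tuple of p.1 :: p.2]).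
  exact: measurableT_comp mf (@measurable_tuple_cons _ T k).
have mfm : measurable_fun setT (f \o map_tuple phi).
  exact: measurableT_comp mf (@measurable_tuple_map _).
rewrite (integral_tuple_cons mu mf f0) (integral_tuple_cons mu mfm (fun=> f0 _)).
rewrite phiE; last 2 first.
- exact: (measurable_integral_snd mfc (fun=> f0 _) (tuple_measure mu k)).
- by move=> x; apply: integral_ge0 => t _.
rewrite exprS EFinM -muleA; congr (_ * _)%E.
have mI := measurable_integral_snd (measurableT_comp mfm (@measurable_tuple_cons _ T k))
  (fun=> f0 _) (tuple_measure mu k).
rewrite -ge0_integralZl//; last 2 first.
- by move=> x _; apply: integral_ge0 => t _; exact: f0.
- by rewrite lee_fin exprn_ge0.
apply: eq_integral => x _.
rewrite (IHk (fun t => f [tuple of phi x :: t])); last 2 first.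
- exact: measurableT_comp mfc (measurable_pair1 (phi x)).
- by [].
congr (_ * _)%E; apply: eq_integral => t _; congr f.
by apply: val_inj.
Qed.

End tuple_map.

Section apex_integral.
Context (R : realType) (n : nat).
Notation leb := (@lebesgue_measure R).

Lemma integral_tuple_row k (f : k.-tuple (measurableTypeR R) -> \bar R) :
  measurable_fun setT f -> (forall t, 0 <= f t)%E ->
  (\int[tuple_measure leb k]_t f t = \int[lebesgue_rV]_y f (tuple_of_row y))%E.
Proof.
move=> mf f0; rewrite integral_row_tuple//.
  by apply: eq_integral => t _; rewrite row_of_tupleK.
exact: measurableT_comp mf (@measurable_tuple_of_row R k).
Qed.

Definition paraboloid_heights (v : 'I_n.+1 -> 'rV[R]_n) (a : 'rV[R]_n * R) :
    n.+1.-tuple (measurableTypeR R) :=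
  [tuple a.2 - sqnorm (v i - a.1) | i < n.+1].

(** The heights are obtained from apex_coords by the matrix with rows (1, v_i),
    up to the translation by the |v_i|^2; the factor 2^n is due to the
    coordinate 2 w. *)
Lemma integral_apex (v : 'I_n.+1 -> 'rV[R]_n) (f : n.+1.-tuple (measurableTypeR R) -> \bar R) :
  \det (affine_mx v) != 0 -> measurable_fun setT f -> (forall t, 0 <= f t)%E ->
  (\int[tuple_measure leb n.+1]_h f h = (2 ^+ n * `|\det (affine_mx v)|)%:E *
    \int[lebesgue_rV]_w \int[leb]_s f (paraboloid_heights v (w, s)))%E.
Proof.
move=> dv mf f0; rewrite integral_tuple_row//.
pose q : 'rV[R]_n.+1 := \row_i sqnorm (v i).
have mfr : measurable_fun setT (fun y : 'rV[R]_n.+1 => f (tuple_of_row y)).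
  exact: measurableT_comp mf (@measurable_tuple_of_row R n.+1).
rewrite (integral_row_translate (- q) mfr (fun=> f0 _)).
have mfq := measurable_fun_row_add (- q) mfr.
have dvt : \det (affine_mx v)^T != 0 by rewrite det_tr.
rewrite (change_of_variables_unit dvt mfq (fun=> f0 _)) det_tr.
have mfM := measurable_fun_row_mul (affine_mx v)^T mfq.
rewrite (integral_row_cons_swap mfM (fun=> f0 _)).
have two0 : (2 : R) != 0 by [].
have mfC : measurable_fun setT (fun p : measurableTypeR R * 'rV[R]_n =>
    f (tuple_of_row (row_cons p *m (affine_mx v)^T - q))) := measurable_fun_row_cons mfM.
rewrite (integral_row_scale two0 (measurable_integral_fst mfC (fun=> f0 _) leb)); last first.
  by move=> t; apply: integral_ge0 => x _.
rewrite muleA -EFinM normr_nat mulrC; congr (_ * _)%E.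
apply: eq_integral => w _.
rewrite (integral_translate (- sqnorm w) (measurable_fun_row_cons2 _ mfM) (fun=> f0 _)).
apply: eq_integral => s _; congr f; apply: eq_from_tnth => i.
rewrite !tnth_mktuple [LHS]mxE (apex_coords_affine v (w, s)) [(- q) _ _]mxE [q _ _]mxE.
by rewrite addrK.
Qed.

End apex_integral.

(** * The mass of a paraboloid and the integral over the sites *)

Section intensity.
Context (R : realType) (n : nat) (gamma l : R).
Hypotheses (n_gt0 : (0 < n)%N) (gamma_gt0 : 0 < gamma) (l_gt0 : 0 < l).
Notation leb := (@lebesgue_measure R).
Notation a := ((n.+1%:R + 1) / 2 : R).

Definition height_density (h : R) : R := gamma / 2 * h `^ (- a) * (l <= h)%R%:R.

Lemma height_density_ge0 h : 0 <= height_density h.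
Proof. by rewrite !mulr_ge0 ?powR_ge0// ltW// divr_gt0. Qed.

Lemma measurable_height_density : measurable_fun setT height_density.
Proof.
apply: measurable_funM.
  by apply: measurable_funM; [exact: measurable_cst|exact: measurable_powR].
rewrite (_ : (fun h => _) = fun h => 1 - (h < l)%R%:R).
  apply: measurable_funB; first exact: measurable_cst.
  by apply/measurable_EFinP; apply: measurable_bool_lt => //; exact: measurable_cst.
by apply/funext => h; rewrite leNgt; case: ltP; rewrite ?subrr ?subr0.
Qed.

Lemma lebesgue_rV_ball_centered (w : 'rV[R]_n) (r : R) :
  lebesgue_rV [set v | sqnorm (v - w) < r] =
  (ball_volume n * r `^ (n%:R / 2) * (0 < r)%R%:R)%:E.
Proof.
have mB := @measurable_set_ball R n r.
have mBw : measurable [set v : 'rV[R]_n | sqnorm (v - w) < r].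
  apply: measurable_set_lt; last exact: measurable_cst.
  exact: measurableT_comp (@measurable_sqnorm R n) (measurable_row_add (- w)).
transitivity (lebesgue_rV [set v : 'rV[R]_n | sqnorm v < r]).
  rewrite (lebesgue_rVE mBw) (lebesgue_rVE mB).
  rewrite (integral_row_translate w (measurable_indicE mBw) (fun=> indic_ge0E _ _ _)).
  apply: eq_integral => v _; rewrite !indicE; congr (_%:R%:E); congr nat_of_bool.
  by apply/idP/idP => /set_mem/= h; apply/mem_set => /=; rewrite addrK in h *.
case: ltP => [r0|r0]; last by rewrite lebesgue_rV_ball0// mulr0.
by rewrite lebesgue_rV_ball// unit_ball_measureE mulr1 -EFinM mulrC.
Qed.

(** The section at height h of the paraboloid with apex height s is a ball of
    squared radius s - h; by translation invariance the position of the apex is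
    irrelevant. *)
Definition paraboloid_mass (s : R) : \bar R :=
  (\int[leb]_h (height_density h * (ball_volume n * (s - h) `^ (n%:R / 2) *
     (h < s)%R%:R))%:E)%E.

Lemma ball_volume_ge0 : 0 <= ball_volume n :> R.
Proof. by rewrite -lee_fin -unit_ball_measureE measure_ge0. Qed.

Lemma paraboloid_mass_integrand_ge0 s h :
  0 <= height_density h * (ball_volume n * (s - h) `^ (n%:R / 2) * (h < s)%R%:R).
Proof.
apply: mulr_ge0; first exact: height_density_ge0.
by apply: mulr_ge0 => //; apply: mulr_ge0; [exact: ball_volume_ge0|exact: powR_ge0].
Qed.

Lemma measurable_paraboloid_mass_integrand :
  measurable_fun setT (fun p : R * measurableTypeR R =>
    (height_density p.2 * (ball_volume n * (p.1 - p.2) `^ (n%:R / 2) *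
     (p.2 < p.1)%R%:R))%:E).
Proof.
apply/measurable_EFinP; apply: measurable_funM.
  exact: measurableT_comp measurable_height_density measurable_snd.
apply: measurable_funM; last by apply/measurable_EFinP; exact: measurable_bool_lt.
apply: measurable_funM; first exact: measurable_cst.
by apply: (measurableT_comp (measurable_powR _)); exact: measurable_funB.
Qed.

Lemma measurable_paraboloid_mass : measurable_fun setT paraboloid_mass.
Proof.
apply: (measurable_integral_snd measurable_paraboloid_mass_integrand) => p.
by rewrite lee_fin paraboloid_mass_integrand_ge0.
Qed.

Lemma measurable_depth_gt0 (ap : 'rV[R]_n * R) :
  measurable [set p : 'rV[R]_n * R | 0 < depth (ap, p)].
Proof.
apply: measurable_set_lt; first exact: measurable_cst.
apply: measurable_funB; last exact: measurable_snd.
apply: measurable_funB; first exact: measurable_cst.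
apply: (measurableT_comp (@measurable_sqnorm R n)).
exact: measurableT_comp (measurable_row_add (- ap.1)) measurable_fst.
Qed.

Lemma measure_paraboloid (nu : {sigma_finite_measure set ('rV[R]_n * measurableTypeR R)%type -> \bar R})
    (ap : 'rV[R]_n * R) :
  (forall A, measurable A ->
    nu A = \int[lebesgue_rV \x leb]_(p in A) (height_density p.2)%:E)%E ->
  nu [set p | 0 < depth (ap, p)] = paraboloid_mass ap.2.
Proof.
move=> nuE; have mS := measurable_depth_gt0 ap.
have mhd : measurable_fun setT (fun p : 'rV[R]_n * measurableTypeR R => height_density p.2).
  exact: measurableT_comp measurable_height_density measurable_snd.
transitivity (\int[nu]_p (\1_[set p | (0 < depth (ap, p))%R] p)%:E)%E.
  by rewrite integral_indic ?setIT.
rewrite (integral_density_product mhd (fun=> height_density_ge0 _) nuE (measurable_indicE mS)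
  (fun=> indic_ge0E _ _ _)).
rewrite (@fubini_tonelli _ _ _ _ _ lebesgue_rV leb
  (fun p => (\1_[set p | (0 < depth (ap, p))%R] p)%:E * (height_density p.2)%:E)%E); last 2 first.
- by apply: emeasurable_funM; [exact: measurable_indicE|exact/measurable_EFinP].
- by move=> p; rewrite mule_ge0 ?lee_fin ?height_density_ge0.
apply: eq_integral => h _ /=.
have mSh : measurable [set v : 'rV[R]_n | sqnorm (v - ap.1) < ap.2 - h].
  apply: measurable_set_lt; last exact: measurable_cst.
  exact: measurableT_comp (@measurable_sqnorm R n) (measurable_row_add (- ap.1)).
rewrite ge0_integralZr//; last 2 first.
- exact: measurableT_comp (measurable_indicE mS) (measurable_pair2 _).
- by rewrite lee_fin height_density_ge0.
rewrite [RHS]EFinM [LHS]muleC; congr (_ * _)%E.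
rewrite -[(h < ap.2)%R]subr_gt0 -(lebesgue_rV_ball_centered ap.1) (lebesgue_rVE mSh).
apply: eq_integral => v _; rewrite !indicE; congr (_%:R%:E); congr nat_of_bool.
by apply/idP/idP => /set_mem/= H; apply/mem_set => /=; move: H; rewrite /depth/=; lra.
Qed.

Lemma paraboloid_mass0 s : s <= l -> paraboloid_mass s = 0%E.
Proof.
move=> sl; apply: integral0_eq => h _; rewrite /height_density.
case: (leP l h) => [lh|]; last by rewrite mulr0 mul0r.
by rewrite ltNge (le_trans sl lh)/= !mulr0.
Qed.

Lemma exponentE : a = 1 + n%:R / 2.
Proof. by rewrite -natr1; field. Qed.

(** With h = s (1 - u) the integrand becomes u^(a-1) (1 - u)^(-a), and all
    powers of s cancel: the mass depends on l / s only, as it must by the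
    scaling symmetry of hyperbolic space. *)
Lemma paraboloid_massE s : l < s -> paraboloid_mass s =
  (gamma * (ball_volume n / (n.+1%:R + 1)) * (inversion l s) `^ a *
   hypergeometric2F1 a a ((n.+1%:R + 3) / 2) (inversion l s))%:E.
Proof.
move=> ls; have s0 : 0 < s by exact: lt_trans ls.
have t0 : 0 < inversion l s by rewrite subr_gt0 ltr_pdivrMr// mul1r.
have t1 : inversion l s < 1 by rewrite gtrBl divr_gt0.
set t := inversion l s in t0 t1 *.
have -> : (n.+1%:R + 3) / 2 = a + 1 :> R by field.
(* h = s (1 - u) *)
rewrite /paraboloid_mass (@integral_affine R (- s) s); last 3 first.
- by rewrite oppr_eq0 gt_eqF.
- exact: measurableT_comp measurable_paraboloid_mass_integrand (measurable_pair1 s).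
- by move=> h; rewrite lee_fin paraboloid_mass_integrand_ge0.
rewrite normrN gtr0_norm//.
pose g (u : R) := (u `^ (a - 1) * (1 - u) `^ (- a))%:E.
have mg : measurable_fun setT g.
  apply/measurable_EFinP; apply: measurable_funM; first exact: measurable_powR.
  by apply: (measurableT_comp (measurable_powR _)); exact: measurable_funB.
have g0 u : (0 <= g u)%E by rewrite lee_fin mulr_ge0 ?powR_ge0.
pose C := gamma / 2 * ball_volume n.
transitivity (C%:E * \int[leb]_u (g u * ((0 < u < t)%R%:R)%:E))%E; last first.
  have := integral_beta_hypergeometric n_gt0 t0 t1; rewrite /g -exponentE => ->.
  rewrite -EFinM; congr EFin; rewrite /C; field.
  by rewrite gt_eqF// addr_gt0// ltr_pwDl.
(* The endpoint u = t, which corresponds to h = l, is a null set. *)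
have -> : (\int[leb]_u (g u * ((0 < u < t)%R%:R)%:E) =
    \int[leb]_u (g u * (\1_(`]0%R, t]%classic) u)%:E))%E.
  rewrite -integral_mulindic -integral_itv_bndo_bndc; last exact: measurable_funTS.
  rewrite [RHS]integral_mulindic; apply: eq_integral => u _; rewrite indicE; congr (_ * _%:R%:E)%E.
  by congr nat_of_bool; apply/idP/idP; rewrite inE /= in_itv.
transitivity (s%:E * ((C / s)%:E * \int[leb]_u (g u * (\1_(`]0%R, t]%classic) u)%:E)))%E; last first.
  by rewrite muleA -EFinM mulrC divfK// gt_eqF.
congr (_ * _)%E; rewrite -ge0_integralZl//; last 3 first.
- by apply: emeasurable_funM => //; exact: measurable_indicE.
- by move=> u _; rewrite mule_ge0.
- rewrite lee_fin; apply: divr_ge0; last exact: ltW.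
  by apply: mulr_ge0; [apply: divr_ge0 => //; exact: ltW|exact: ball_volume_ge0].
apply: eq_integral => u _; rewrite -!EFinM; congr EFin; rewrite /height_density.
have -> : (- s * u + s < s) = (0 < u) by rewrite gtrDr mulNr oppr_lt0 pmulr_rgt0.
have -> : (l <= - s * u + s) = (u <= t).
  by rewrite /t /inversion lerBrDl -lerBrDr ler_pdivrMr//; apply/idP/idP => h; lra.
have -> : \1_(`]0, t]%classic) u = ((0 < u) && (u <= t))%:R :> R.
  by rewrite indicE; congr (nat_of_bool _)%:R; apply/idP/idP; rewrite inE /= in_itv.
case: (ltP 0 u) => u0; last by rewrite !mulr0.
case: (leP u t) => ut; last by rewrite !(mulr0, mul0r).
have u1 : 0 < 1 - u by rewrite subr_gt0 (le_lt_trans ut).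
have -> : - s * u + s = s * (1 - u) by ring.
have -> : s - s * (1 - u) = s * u by ring.
rewrite !mulr1 powRM 1?ltW// powRM 1?ltW// {3}exponentE.
have -> : 1 + n%:R / 2 - 1 = n%:R / 2 :> R by ring.
have <- : s `^ (- a) * s `^ (n%:R / 2) = s^-1.
  by rewrite -powRD ?(gt_eqF s0) ?implybT// exponentE opprD addrNK powR_inv1 ?ltW.
by rewrite /C; ring.
Qed.

(** Weight of all tuples of sites under a paraboloid with apex (0, s), the
    determinant being the Jacobian of the change to apex coordinates. *)
Definition site_integral (s : R) : \bar R :=
  (\int[tuple_measure (@lebesgue_rV R n) n.+1]_v
     (`|\det (affine_mx (tnth v))| * \prod_i height_density (s - sqnorm (tnth v i)))%:E)%E.

Lemma det_affine_mx_scale (c : R) (v : 'I_n.+1 -> 'rV[R]_n) :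
  \det (affine_mx (fun i => c *: v i)) = c ^+ n * \det (affine_mx v).
Proof.
rewrite !det_affine_mx -detZ; congr (\det _).
by apply/matrixP => i j; rewrite !mxE mulrBr.
Qed.

Lemma det_affine_mx_translate (w : 'rV[R]_n) (v : 'I_n.+1 -> 'rV[R]_n) :
  \det (affine_mx (fun i => v i + w)) = \det (affine_mx v).
Proof.
rewrite !det_affine_mx; congr (\det _).
by apply/matrixP => i j; rewrite !mxE opprD addrACA subrr addr0.
Qed.

Lemma det_affine_mx_cst (v : 'I_n.+1 -> 'rV[R]_n) (i j : 'I_n.+1) :
  i != j -> v i = v j -> \det (affine_mx v) = 0.
Proof.
move=> ij vij; apply: (determinant_alternate ij) => k.
by rewrite !mxE vij.
Qed.

Lemma sqnorm_eq0 (v : 'rV[R]_n) : sqnorm v <= 0 -> v = 0.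
Proof.
move=> v0; apply/rowP => i; rewrite mxE; apply/eqP; rewrite -sqrf_eq0.
have : sqnorm v == 0 by rewrite eq_le v0 sqnorm_ge0.
rewrite /sqnorm psumr_eq0 => [/allP/(_ i)|j _]; last exact: sqr_ge0.
by rewrite mem_index_enum => /(_ isT)/eqP->.
Qed.

(** If no density vanishes, all sites are at the origin, and then the
    determinant is zero: here n > 0 is used. *)
Lemma site_integrand0 s (v : 'I_n.+1 -> 'rV[R]_n) : s <= l ->
  `|\det (affine_mx v)| * \prod_i height_density (s - sqnorm (v i)) = 0.
Proof.
move=> sl; case: (boolP [exists i, s - sqnorm (v i) < l]) => [/existsP[i si]|].
  by rewrite (bigD1 i)//= /height_density leNgt si/= mulr0 mul0r mulr0.
rewrite negb_exists => /forallP h.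
have v0 i : v i = 0 by apply: sqnorm_eq0; have := h i; rewrite -leNgt; lra.
by rewrite (@det_affine_mx_cst v ord0 ord_max) ?normr0 ?mul0r ?v0// -val_eqE/= eq_sym -lt0n.
Qed.

Lemma measurable_site_density d (T : measurableType d) (v : T -> 'I_n.+1 -> 'rV[R]_n)
    (r : T -> 'I_n.+1 -> R) :
  (forall i, measurable_fun setT (v ^~ i)) -> (forall i, measurable_fun setT (r ^~ i)) ->
  measurable_fun setT (fun x => `|\det (affine_mx (v x))| * \prod_i height_density (r x i)).
Proof.
move=> mv mr; apply: measurable_funM.
  by apply: measurableT_comp => //; exact: measurable_det_affine.
by apply: measurable_prod => i _; exact: measurableT_comp measurable_height_density (mr i).
Qed.

Definition I_integrand (p : R * n.+1.-tuple 'rV[R]_n) : \bar R :=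
  (simplex_volume (tnth p.2) * (\prod_(i < n.+1) ((1 - sqnorm (tnth p.2 i)) `^ (- a) *
     \1_[set x | sqnorm x <= p.1] (tnth p.2 i)))%:E)%E.

Lemma I_integrand_ge0 p : (0 <= I_integrand p)%E.
Proof.
apply: mule_ge0; first exact: measure_ge0.
by rewrite lee_fin prodr_ge0// => i _; rewrite mulr_ge0 ?powR_ge0.
Qed.

Lemma measurable_I_integrand : measurable_fun setT I_integrand.
Proof.
have mt i : measurable_fun setT (fun p : R * n.+1.-tuple 'rV[R]_n => tnth p.2 i).
  exact: measurableT_comp (@measurable_tnth _ _ _ i) measurable_snd.
have mq i : measurable_fun setT (fun p : R * n.+1.-tuple 'rV[R]_n => sqnorm (tnth p.2 i)).
  exact: measurableT_comp (@measurable_sqnorm R n) (mt i).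
apply: emeasurable_funM.
  rewrite (_ : (fun p => _) = fun p : R * n.+1.-tuple 'rV[R]_n =>
    (`|\det (affine_mx (tnth p.2))| / n`!%:R)%:E); last first.
    by apply/funext => p; rewrite lebesgue_rV_simplex.
  apply/measurable_EFinP; apply: measurable_funM => //.
  by apply: measurableT_comp => //; exact: measurable_det_affine.
apply/measurable_EFinP; apply: measurable_prod => i _.
apply: measurable_funM.
  by apply: (measurableT_comp (measurable_powR _)); exact: measurable_funB.
rewrite (_ : (fun p => _) = \1_[set p : R * n.+1.-tuple 'rV[R]_n | sqnorm (tnth p.2 i) <= p.1]).
  by apply: measurable_indic; apply: measurable_set_le.
by apply/funext => p; rewrite !indic_set.
Qed.

Lemma measurable_I_integral : measurable_fun setT (I_integral n.+1 : R -> \bar R).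
Proof.
exact: (measurable_integral_snd measurable_I_integrand I_integrand_ge0).
Qed.

Lemma I_integral_ge0 (t : R) : (0 <= I_integral n.+1 t)%E.
Proof. by apply: integral_ge0 => z _; exact: (I_integrand_ge0 (t, z)). Qed.

(** Scaling v = sqrt s u. The condition l <= s - |v|^2 becomes |u|^2 <= 1 - l /
    s, and the powers of s coming from dv, the determinant and the densities
    combine to s^(-a). *)
Lemma site_integralE s : l < s -> site_integral s =
  (((gamma / 2) ^+ n.+1 * s `^ (- a) * n`!%:R)%:E * I_integral n.+1 (inversion l s))%E.
Proof.
move=> ls; have s0 : 0 < s by exact: lt_trans ls.
have q0 : 0 < Num.sqrt s by rewrite sqrtr_gt0.
set q : R := Num.sqrt s in q0.
have qn0 : q != 0 by rewrite gt_eqF.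
have qq : q ^+ 2 = s by rewrite sqr_sqrtr// ltW.
pose phi (v : 'rV[R]_n) := q *: v.
have mphi : measurable_fun setT phi.
  have := @measurable_mulmx R n n q%:M; congr measurable_fun.
  by apply/funext => v; rewrite mul_mx_scalar.
rewrite /site_integral.
rewrite (@integral_tuple_map _ _ _ (@lebesgue_rV R n) phi (q ^+ n) mphi); last 4 first.
- by rewrite exprn_ge0// ltW.
- move=> f mf f0; rewrite (integral_row_scale qn0 mf f0).
  by rewrite gtr0_norm.
- apply/measurable_EFinP; apply: measurable_site_density => i; first exact: measurable_tnth.
  apply: measurable_funB; first exact: measurable_cst.
  exact: measurableT_comp (@measurable_sqnorm R n) (@measurable_tnth _ _ _ i).
- by move=> v; rewrite lee_fin mulr_ge0// prodr_ge0// => i _; exact: height_density_ge0.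
(* The factors of the integrand: q ^+ n from the determinant, n! from the simplex
   volume, and one power of s from each density. *)
pose k : R := q ^+ n * n`!%:R * (gamma / 2 * s `^ (- a)) ^+ n.+1.
have k0 : 0 <= k.
  by rewrite !mulr_ge0 ?exprn_ge0 ?mulr_ge0 ?powR_ge0 ?ltW ?divr_gt0.
transitivity (((q ^+ n) ^+ n.+1)%:E * (k%:E * I_integral n.+1 (inversion l s)))%E; last first.
  rewrite muleA -EFinM; congr (_%:E * _)%E.
  rewrite /k exprMn.
  set X := q ^+ n; set Y := s `^ (- a); set G := (gamma / 2) ^+ n.+1.
  have X0 : X != 0 by rewrite expf_neq0.
  have XY : X * Y = s^-1.
    rewrite /X powR_half_sqrt 1?ltW// -powRD ?(gt_eqF s0) ?implybT//.
    by rewrite exponentE opprD addrCA subrr addr0 powR_inv1 ?ltW.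
  have XX : X * X = s ^+ n by rewrite -expr2 -exprM mulnC exprM qq.
  have YE : Y = s^-1 / X by rewrite -XY mulrC mulKf.
  suff H : X ^+ n.+1 * X * Y ^+ n.+1 = Y by rewrite -[in RHS]H; ring.
  rewrite mulrAC -exprMn XY exprS exprVn -XX YE invfM.
  by field; rewrite X0 gt_eqF.
congr (_ * _)%E; rewrite /I_integral -ge0_integralZl//; last 2 first.
- exact: measurableT_comp measurable_I_integrand (measurable_pair1 (inversion l s)).
- by move=> z _; exact: (I_integrand_ge0 (inversion l s, z)).
apply: eq_integral => z _.
rewrite [simplex_volume _](@lebesgue_rV_simplex R n (tnth z)) -!EFinM; congr EFin.
have -> : \det (affine_mx (tnth (map_tuple phi z))) = q ^+ n * \det (affine_mx (tnth z)).
  rewrite -det_affine_mx_scale; congr (\det (affine_mx _)).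
  by apply/funext => i; rewrite tnth_map.
rewrite normrM [`|q ^+ n|]ger0_norm ?exprn_ge0 ?ltW//.
have -> : \prod_i height_density (s - sqnorm (tnth (map_tuple phi z) i)) =
    (gamma / 2 * s `^ (- a)) ^+ n.+1 * \prod_(i < n.+1) ((1 - sqnorm (tnth z i)) `^ (- a) *
        \1_[set x | sqnorm x <= inversion l s] (tnth z i)).
  set c := gamma / 2 * s `^ (- a).
  have -> : c ^+ n.+1 = \prod_(i < n.+1) c by rewrite prodr_const card_ord.
  rewrite /c -big_split/=; apply: eq_bigr => i _.
  rewrite tnth_map sqnormZ qq /height_density.
  set x := sqnorm (tnth z i).
  have -> : s - s * x = s * (1 - x) by ring.
  have -> : (l <= s * (1 - x)) = (x <= inversion l s).
    by rewrite /inversion lerBrDl -lerBrDr ler_pdivrMr// mulrC.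
  rewrite indic_set -/x.
  case: (leP x (inversion l s)) => xl; last by rewrite !mulr0.
  have x1 : 0 <= 1 - x.
    by rewrite subr_ge0 (le_trans xl)// /inversion gerBl divr_ge0 1?ltW.
  by rewrite (powRM _ (ltW s0) x1) !mulr1 !mulrA.
rewrite /k; set D := \prod_(i < _) _; set E := (_ ^+ n.+1).
by field; rewrite pnatr_eq0 -lt0n fact_gt0.
Qed.

Lemma site_integral0 s : s <= l -> site_integral s = 0%E.
Proof. by move=> sl; apply: integral0_eq => v _; rewrite site_integrand0. Qed.

Lemma site_integral_ge0 s : (0 <= site_integral s)%E.
Proof.
apply: integral_ge0 => v _; rewrite lee_fin mulr_ge0// prodr_ge0// => i _.
exact: height_density_ge0.
Qed.

(** The probability that no point of the process lies below a paraboloid of apex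
    height s. *)
Definition survival (s : R) : R := expR (- fine (paraboloid_mass s)).

Lemma measurable_survival : measurable_fun setT survival.
Proof.
apply: (measurableT_comp (@measurable_expRN R)).
exact: measurableT_comp (@fine_measurable R setT measurableT) measurable_paraboloid_mass.
Qed.

(** The weight s^(-a) ds becomes a power of 1 - t times dt under t = 1 - l / s.
    *)
Lemma integral_survival_site :
  (\int[leb]_s ((survival s)%:E * site_integral s) =
   ((gamma / 2) ^+ n.+1 * n`!%:R * l `^ (1 - a))%:E *
   \int[leb]_(t in `]0%R, 1%R[) (((1 - t) `^ ((n.+1%:R - 3) / 2) *
      expR (- (gamma * (ball_volume n / (n.+1%:R + 1)) * t `^ a *
        hypergeometric2F1 a a ((n.+1%:R + 3) / 2) t)))%:E * I_integral n.+1 t))%E.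
Proof.
have -> : (n.+1%:R - 3) / 2 = a - 2 :> R by field.
pose F (t : R) : \bar R :=
  (((1 - t) `^ (a - 2) * survival (l / (1 - t)))%:E * I_integral n.+1 t)%E.
have F0 t : (0 <= F t)%E.
  by rewrite mule_ge0 ?I_integral_ge0// lee_fin mulr_ge0 ?powR_ge0 ?expR_ge0.
have mF : measurable_fun setT F.
  apply: emeasurable_funM; last exact: measurable_I_integral.
  apply/measurable_EFinP; apply: measurable_funM.
    by apply: (measurableT_comp (measurable_powR _)); exact: measurable_funB.
  exact: measurableT_comp measurable_survival (measurable_inversionK l).
set c := (gamma / 2) ^+ n.+1 * n`!%:R * l `^ (1 - a).
have c0 : 0 <= c by rewrite !mulr_ge0 ?exprn_ge0 ?powR_ge0 ?divr_ge0 1?ltW.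
have mG : measurable_fun setT (fun s : R =>
    (F (inversion l s) * (l / s ^+ 2 * (l < s)%R%:R)%:E)%E).
  apply: emeasurable_funM; first exact: measurableT_comp mF (measurable_inversion l).
  apply/measurable_EFinP; apply: measurable_funM; last first.
    by apply/measurable_EFinP; apply: measurable_bool_lt => //; exact: measurable_cst.
  apply: measurable_funM; first exact: measurable_cst.
  by apply: (measurableT_comp (@measurable_inverse R)); exact: measurable_funX.
transitivity (\int[leb]_s (c%:E * (F (inversion l s) * (l / s ^+ 2 * (l < s)%R%:R)%:E)))%E.
  apply: eq_integral => s _; case: (ltP l s) => [ls|sl]; last first.
    by rewrite site_integral0// mulr0 !mule0.
  have s0 : 0 < s by exact: lt_trans ls.
  have r0 : 0 < l / s by rewrite divr_gt0.
  rewrite site_integralE// /F inversionK//.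
  rewrite [in RHS]muleAC [in RHS]muleA -!EFinM [LHS]muleA -EFinM; congr (_%:E * _)%E.
  have -> : 1 - inversion l s = l / s by rewrite /inversion; ring.
  set r := l / s in r0 *.
  have -> : l / s ^+ 2 = r / s by rewrite /r expr2 invfM mulrA.
  have lE : l = r * s by rewrite /r divfK// gt_eqF.
  rewrite /c {1}lE (powRM _ (ltW r0) (ltW s0)) mulr1.
  have <- : r `^ (a - 2) * r * r `^ (1 - a) * (s^-1 * s `^ (1 - a)) = s `^ (- a).
    rewrite -{2}(powRr1 (ltW r0)) -!powRD ?(gt_eqF r0) ?implybT//.
    rewrite (_ : a - 2 + 1 + (1 - a) = 0); last by ring.
    rewrite powRr0 mul1r -(powR_inv1 (ltW s0)) -powRD ?(gt_eqF s0) ?implybT//.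
    by congr (_ `^ _); ring.
  by ring.
rewrite ge0_integralZl//; last by move=> s _; rewrite mule_ge0// lee_fin mulr_ge0// divr_ge0 ?sqr_ge0// ltW.
rewrite integral_inversion//; congr (_ * _)%E.
rewrite [RHS]integral_mulindic; apply: eq_integral => t _.
rewrite indicE mem_setE in_itv/=; case: (boolP (0 < t < 1)) => [/andP[t0 t1]|]; last by rewrite !mule0.
rewrite !mule1 /F /survival paraboloid_massE; last first.
  by rewrite ltr_pdivlMr ?subr_gt0// -[ltRHS]mulr1 ltr_pM2l// gtrBl.
have -> // : inversion l (l / (1 - t)) = t.
rewrite /inversion invf_div mulrCA divff ?gt_eqF// mulr1; ring.
Qed.

End intensity.

(** * The integral over tuples with apex in W *)

Section apex_tuples.
Context (R : realType) (n : nat) (gamma l : R).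
Hypotheses (n_gt0 : (0 < n)%N) (gamma_gt0 : 0 < gamma) (l_gt0 : 0 < l).
Notation leb := (@lebesgue_measure R).
Notation pt := ('rV[R]_n * measurableTypeR R)%type.
Notation hd := (height_density n gamma l).
Notation V := (survival n gamma l).
Variable (W : set 'rV[R]_n).
Hypothesis mW : measurable W.

Let mV : measurable_fun setT V.
Proof. exact: measurable_survival. Qed.

Definition apex_tuples : set (n.+1.-tuple pt) :=
  [set z | \det (site_mx z) != 0 /\ W (apex_solution z).1].

Lemma measurable_apex_tuples : measurable apex_tuples.
Proof.
have -> : apex_tuples = ~` [set z | \det (site_mx z) = 0] `&` [set z | W (apex_solution z).1].
  by apply/seteqP; split => z /= [h Wz]; split => //; apply/eqP.
apply: measurableI.
  apply: measurableC.
  exact: (measurable_preimage (@measurable_det_site R n) (measurable_set1 0)).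
apply: (measurable_preimage (f := fun z : n.+1.-tuple pt => (apex_solution z).1)) => //.
exact: measurableT_comp measurable_fst (@measurable_apex_solution R n).
Qed.

Lemma apex_solution_heights (v : n.+1.-tuple 'rV[R]_n) (a : pt) :
  \det (affine_mx (tnth v)) != 0 ->
  apex_solution (pair_tuple v (paraboloid_heights (tnth v) a)) = a.
Proof.
set z := pair_tuple v _ => dv.
have siteE : site_mx z = affine_mx (tnth v).
  by congr affine_mx; apply/funext => i; rewrite tnth_mktuple.
have dz : \det (site_mx z) != 0 by rewrite siteE.
apply/esym/(apex_solutionP a dz) => i; rewrite tnth_mktuple /depth/= tnth_mktuple.
by ring.
Qed.

Definition apex_integrand (p : n.+1.-tuple 'rV[R]_n * 'rV[R]_n * R) : R :=
  \1_W p.1.2 * V p.2 * (`|\det (affine_mx (tnth p.1.1))| *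
    \prod_i hd (p.2 - sqnorm (tnth p.1.1 i - p.1.2))).

Lemma apex_integrand_ge0 p : 0 <= apex_integrand p.
Proof.
rewrite mulr_ge0 ?mulr_ge0 ?expR_ge0// ?prodr_ge0// => i _.
exact: height_density_ge0.
Qed.

Lemma measurable_apex_integrand : measurable_fun setT (fun p => (apex_integrand p)%:E).
Proof.
have mv i : measurable_fun setT
    (fun p : n.+1.-tuple 'rV[R]_n * 'rV[R]_n * R => tnth p.1.1 i).
  apply: (measurableT_comp (@measurable_tnth _ _ _ i)).
  exact: measurableT_comp measurable_fst measurable_fst.
apply/measurable_EFinP; apply: measurable_funM.
  apply: measurable_funM.
    apply: (measurableT_comp (measurable_indic mW)).
    exact: measurableT_comp measurable_snd measurable_fst.
  exact: measurableT_comp mV measurable_snd.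
apply: measurable_site_density => // i.
apply: measurable_funB => //; apply: (measurableT_comp (@measurable_sqnorm R n)).
apply/measurable_rowP => j.
rewrite (_ : (fun p => _) = fun p : n.+1.-tuple 'rV[R]_n * 'rV[R]_n * R =>
    tnth p.1.1 i ord0 j - p.1.2 ord0 j); last by apply/funext => p; rewrite !mxE.
apply: measurable_funB.
  exact: measurableT_comp (measurable_row_coord j) (mv i).
apply: (measurableT_comp (measurable_row_coord j)).
exact: measurableT_comp measurable_snd measurable_fst.
Qed.

(** For singular sites both sides vanish. Otherwise the tuple with heights
    paraboloid_heights v (w, s) has apex (w, s), so that the integrand is a
    function of (w, s). *)
Lemma integral_apex_tuple (v : n.+1.-tuple 'rV[R]_n) :
  (\int[tuple_measure leb n.+1]_h
     tuple_integrand (fun p => hd p.2)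
       (fun z => (\1_apex_tuples z)%:E * (V (apex_solution z).2)%:E) (v, h) =
   (2 ^+ n)%:E * \int[lebesgue_rV]_w \int[leb]_s (apex_integrand (v, w, s))%:E)%E.
Proof.
have mF : measurable_fun setT (fun z : n.+1.-tuple pt =>
    ((\1_apex_tuples z)%:E * (V (apex_solution z).2)%:E)%E).
  apply: emeasurable_funM; first by apply: measurable_indicE; exact: measurable_apex_tuples.
  apply/measurable_EFinP; apply: (measurableT_comp mV).
  exact: measurableT_comp measurable_snd (@measurable_apex_solution R n).
have [dv|dv] := eqVneq (\det (affine_mx (tnth v))) 0.
  rewrite [LHS]integral0_eq => [|h _].
    rewrite integral0_eq ?mule0// => w _; apply: integral0_eq => s _.
    by rewrite /apex_integrand/= dv normr0 mul0r mulr0.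
  rewrite /tuple_integrand/= indicE memNset ?mul0e// => -[/eqP + _]; apply.
  rewrite /site_mx -[RHS]dv; congr (\det (affine_mx _)).
  by apply/funext => i; rewrite tnth_mktuple.
have mhd : measurable_fun setT (fun p : 'rV[R]_n * measurableTypeR R => hd p.2).
  exact: measurableT_comp (@measurable_height_density R n gamma l) measurable_snd.
set F := (fun z : n.+1.-tuple pt => _) in mF *.
have F0 z : (0 <= F z)%E by rewrite mule_ge0 ?lee_fin ?expR_ge0.
have mI := measurable_tuple_integrand mhd mF.
have I0 := tuple_integrand_ge0 (fun p => @height_density_ge0 R n gamma l gamma_gt0 p.2) F0.
rewrite (integral_apex dv (measurableT_comp mI (measurable_pair1 v)) (fun=> I0 _)).
have mK := measurable_apex_integrand.
have K0 p : (0 <= (apex_integrand p)%:E)%E by rewrite lee_fin apex_integrand_ge0.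
have D0 : (0 <= (`|\det (affine_mx (tnth v))|^-1)%:E)%E by rewrite lee_fin invr_ge0.
have mKv : measurable_fun setT (fun p : 'rV[R]_n * measurableTypeR R =>
    (apex_integrand (v, p.1, p.2))%:E).
  apply: (measurableT_comp mK); apply: measurable_fun_pair => //.
  by apply: measurable_fun_pair.
transitivity ((2 ^+ n * `|\det (affine_mx (tnth v))|)%:E *
  ((`|\det (affine_mx (tnth v))|^-1)%:E *
   \int[lebesgue_rV]_w \int[leb]_s (apex_integrand (v, w, s))%:E))%E; last first.
  by rewrite muleA -EFinM mulfK// normr_eq0.
congr (_ * _)%E; rewrite -ge0_integralZl//; last 2 first.
- exact: (measurable_integral_snd mKv (fun=> K0 _) leb).
- by move=> w _; apply: integral_ge0.
apply: eq_integral => w _; rewrite -ge0_integralZl//; last first.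
  exact: measurableT_comp mKv (measurable_pair1 w).
apply: eq_integral => s _.
pose z : n.+1.-tuple pt := pair_tuple v (paraboloid_heights (tnth v) (w, s)).
have zE : apex_solution z = (w, s) by exact: apex_solution_heights.
have siteE : site_mx z = affine_mx (tnth v).
  by congr affine_mx; apply/funext => i; rewrite tnth_mktuple.
transitivity ((\1_apex_tuples z)%:E * (V (apex_solution z).2)%:E *
    (\prod_(i < n.+1) hd (s - sqnorm (tnth v i - w)))%:E)%E.
  congr (_ * _%:E)%E; apply: eq_bigr => i _; congr height_density.
  by rewrite /= tnth_mktuple.
have -> : \1_apex_tuples z = \1_W w :> R.
  rewrite !indicE; congr (nat_of_bool _)%:R; apply/idP/idP => /set_mem h; apply/mem_set.
    by move: h => [_]; rewrite zE.
  by split; [rewrite siteE|rewrite zE].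
rewrite zE -!EFinM /apex_integrand/=; congr EFin.
set D := `|_|; have D1 : D != 0 by rewrite normr_eq0.
by rewrite mulrCA mulKf.
Qed.

Let mK : measurable_fun setT (fun p : n.+1.-tuple 'rV[R]_n * 'rV[R]_n * measurableTypeR R =>
  (apex_integrand p)%:E).
Proof. exact: measurable_apex_integrand. Qed.

Let K0 p : (0 <= (apex_integrand p)%:E)%E.
Proof. by rewrite lee_fin apex_integrand_ge0. Qed.

(** Translation of all sites by w leaves the determinant unchanged. *)
Lemma integral_sites (w : 'rV[R]_n) (s : R) :
  (\int[tuple_measure lebesgue_rV n.+1]_v (apex_integrand (v, w, s))%:E =
   (\1_W w)%:E * ((V s)%:E * site_integral n gamma l s))%E.
Proof.
pose f (v : n.+1.-tuple 'rV[R]_n) : \bar R :=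
  (`|\det (affine_mx (tnth v))| * \prod_i hd (s - sqnorm (tnth v i - w)))%:E.
have mt i : measurable_fun setT (fun v : n.+1.-tuple 'rV[R]_n => tnth v i).
  exact: measurable_tnth.
have mf : measurable_fun setT f.
  apply/measurable_EFinP; apply: measurable_site_density => // i.
  apply: measurable_funB => //; apply: (measurableT_comp (@measurable_sqnorm R n)).
  exact: measurableT_comp (measurable_row_add (- w)) (mt i).
have f0 v : (0 <= f v)%E.
  by rewrite lee_fin mulr_ge0// prodr_ge0// => i _; exact: height_density_ge0.
transitivity (\int[tuple_measure lebesgue_rV n.+1]_v ((\1_W w * V s)%:E * f v))%E.
  by apply: eq_integral => v _; rewrite -EFinM.
rewrite ge0_integralZl//; last by rewrite lee_fin mulr_ge0// expR_ge0.
rewrite EFinM -muleA; congr (_ * (_ * _))%E.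
rewrite (@integral_tuple_map _ _ _ (@lebesgue_rV R n) (fun v => v + w) 1 (measurable_row_add w))//.
  rewrite expr1n mul1e; apply: eq_integral => v _; rewrite /f; congr EFin.
  have -> : \det (affine_mx (tnth (map_tuple (fun v => v + w) v))) = \det (affine_mx (tnth v)).
    rewrite -[RHS](det_affine_mx_translate w); congr (\det (affine_mx _)).
    by apply/funext => i; rewrite tnth_map.
  by congr (_ * _); apply: eq_bigr => i _; rewrite tnth_map addrK.
by move=> g mg g0; rewrite mul1e (integral_row_translate w mg g0).
Qed.

Lemma measurable_site_integral : measurable_fun setT (site_integral n gamma l).
Proof.
have mt i : measurable_fun setT (fun p : R * n.+1.-tuple 'rV[R]_n => tnth p.2 i).
  exact: measurableT_comp (@measurable_tnth _ _ _ i) measurable_snd.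
have mS : measurable_fun setT (fun p : R * n.+1.-tuple 'rV[R]_n =>
    (`|\det (affine_mx (tnth p.2))| * \prod_i hd (p.1 - sqnorm (tnth p.2 i)))%:E).
  apply/measurable_EFinP; apply: measurable_site_density => // i.
  by apply: measurable_funB => //; exact: measurableT_comp (@measurable_sqnorm R n) (mt i).
apply: (measurable_integral_snd mS) => p.
by rewrite lee_fin mulr_ge0// prodr_ge0// => i _; exact: height_density_ge0.
Qed.

(** Integrate over the sites first: what remains is constant in w on W, and a
    function of the apex height. *)
Lemma integral_apex_tuples (nu : {sigma_finite_measure set pt -> \bar R}) :
  (forall A, measurable A -> nu A = \int[lebesgue_rV \x leb]_(p in A) (hd p.2)%:E)%E ->
  (\int[tuple_measure nu n.+1]_(z in apex_tuples) (V (apex_solution z).2)%:E =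
   (2 ^+ n)%:E * (lebesgue_rV W * \int[leb]_s ((V s)%:E * site_integral n gamma l s)))%E.
Proof.
move=> nuE.
have mF : measurable_fun setT (fun z : n.+1.-tuple pt =>
    ((\1_apex_tuples z)%:E * (V (apex_solution z).2)%:E)%E).
  apply: emeasurable_funM; first by apply: measurable_indicE; exact: measurable_apex_tuples.
  apply/measurable_EFinP; apply: (measurableT_comp mV).
  exact: measurableT_comp measurable_snd (@measurable_apex_solution R n).
have F0 (z : n.+1.-tuple pt) : (0 <= (\1_apex_tuples z)%:E * (V (apex_solution z).2)%:E)%E.
  by rewrite mule_ge0 ?lee_fin ?expR_ge0.
have mhd : measurable_fun setT (fun p : 'rV[R]_n * measurableTypeR R => hd p.2).
  exact: measurableT_comp (@measurable_height_density R n gamma l) measurable_snd.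
rewrite integral_mulindic; under eq_integral do rewrite muleC.
rewrite (@integral_tuple_density _ _ 'rV[R]_n (measurableTypeR R) R (@lebesgue_rV R n) leb nu
  _ mhd (fun p => @height_density_ge0 R n gamma l gamma_gt0 p.2) nuE n.+1 _ mF F0).
rewrite (eq_integral (fun v => (2 ^+ n)%:E *
  \int[lebesgue_rV]_w \int[leb]_s (apex_integrand (v, w, s))%:E)%E); last first.
  by move=> v _; exact: integral_apex_tuple.
have mKs := measurable_integral_snd mK K0 leb.
have Ks0 p : (0 <= \int[leb]_s (apex_integrand (p, s))%:E)%E.
  by apply: integral_ge0.
rewrite ge0_integralZl//; last 2 first.
- exact: (measurable_integral_snd mKs Ks0 lebesgue_rV).
- by move=> v _; apply: integral_ge0 => w _.
congr (_ * _)%E.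
rewrite (@fubini_tonelli _ _ _ _ _ (tuple_measure lebesgue_rV n.+1) lebesgue_rV _ mKs Ks0)/=.
rewrite (eq_integral (fun w => (\1_W w)%:E * \int[leb]_s ((V s)%:E * site_integral n gamma l s))%E).
  rewrite ge0_integralZr//; last 2 first.
  - exact: measurable_indicE.
  - by apply: integral_ge0 => s _; rewrite mule_ge0 ?lee_fin ?expR_ge0// site_integral_ge0.
  by rewrite integral_indic// setIT.
move=> w _.
have mKw : measurable_fun setT (fun p : n.+1.-tuple 'rV[R]_n * measurableTypeR R =>
    (apex_integrand (p.1, w, p.2))%:E).
  apply: (measurableT_comp mK); apply: measurable_fun_pair => //.
  by apply: measurable_fun_pair.
rewrite (@fubini_tonelli _ _ _ _ _ (tuple_measure lebesgue_rV n.+1) leb _ mKw (fun=> K0 _))/=.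
under eq_integral do rewrite integral_sites.
rewrite ge0_integralZl//.
- apply: emeasurable_funM; first exact/measurable_EFinP.
  exact: measurable_site_integral.
- by move=> s _; rewrite mule_ge0 ?lee_fin ?expR_ge0// site_integral_ge0.
Qed.

End apex_tuples.

(** * The cell intensity *)

Section cells.
Context (R : realType) (n : nat) (gamma lambda : R).
Hypotheses (n_gt0 : (0 < n)%N) (gamma_gt0 : 0 < gamma) (lambda_gt0 : 0 < lambda).
Notation leb := (@lebesgue_measure R).
Notation pt := ('rV[R]_n * measurableTypeR R)%type.
Notation l := (lambda ^+ 2).
Notation a := ((n.+1%:R + 1) / 2 : R).
Let l_gt0 : 0 < l. Proof. by rewrite exprn_gt0. Qed.

Lemma horoball_intensity_density (B : set pt) :
  horoball_intensity n.+1 gamma lambda B =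
  (\int[lebesgue_rV \x leb]_(p in B) (height_density n gamma l p.2)%:E)%E.
Proof.
rewrite /horoball_intensity integral_mulindic [RHS]integral_mulindic.
apply: eq_integral => p _; rewrite -!EFinM; congr EFin.
rewrite !indicE in_setI /height_density; case: (p \in B) => /=; last by rewrite !mulr0.
rewrite mulr1; congr (_ * (nat_of_bool _)%:R); apply/idP/idP => [/set_mem[]//|lp].
by apply/mem_set; split => //; exact: lt_le_trans lp.
Qed.

Variables (disp : measure_display) (Omega : measurableType disp) (P : probability Omega R)
  (eta : Omega -> set ('rV[R]_n * R)).
Hypothesis eta_poisson : is_poisson_process P (horoball_intensity n.+1 gamma lambda) eta.
Variables (W : set 'rV[R]_n) (mW : measurable W).

(** Over singular sites there is no tuple to count, and otherwise the apex and
    the interior are given by apex_solution and depth. *)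
Lemma esum_cells w :
  \esum_(z in @distinct_tuples R n n.+1 (eta w))
     (\1_W (apex z).1 * \1_[set z' | (paraboloid (apex z'))° `&` eta w = set0] z)%:E =
  ecard R (empty_tuples eta (apex_tuples W)
    (fun z => [set p : pt | 0 < depth (apex_solution z, p)]) w).
Proof.
rewrite /ecard esum_mkcond [RHS]esum_mkcond; apply: eq_esum => z _.
rewrite distinct_tuplesE; case: ifPn => [/set_mem[ez dz]|zN]; last first.
  rewrite ifN//; apply: contra zN => /set_mem[ez [dz _] _]; apply/mem_set; split => //.
rewrite apexE//.
have -> : (z \in empty_tuples eta (apex_tuples W)
    (fun z => [set p : pt | 0 < depth (apex_solution z, p)]) w) =
  ((apex_solution z).1 \in W) &&
    (z \in [set z' | (paraboloid (apex z'))° `&` eta w = set0]).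
  have SE : (paraboloid (apex z))° `&` eta w =
      eta w `&` [set p : pt | 0 < depth (apex_solution z, p)].
    by rewrite apexE// interior_paraboloid setIC.
  apply/idP/andP => [/set_mem[_ [_ Wz] e]|[/set_mem Wz /set_mem e]].
    by split; apply/mem_set => //=; rewrite SE.
  by apply/mem_set; split => //; rewrite -SE.
rewrite !indicE; case: (_ \in W); case: (z \in _); by rewrite /= ?mulr1 ?mulr0 ?mul0r.
Qed.

Lemma mecke_apex_tuples (nu : {sigma_finite_measure set pt -> \bar R}) :
  @is_poisson_process _ pt _ _ _ P nu eta ->
  (forall A, measurable A ->
    nu A = \int[lebesgue_rV \x leb]_(p in A) (height_density n gamma l p.2)%:E)%E ->
  (\int[P]_w ecard R (empty_tuples eta (apex_tuples W)
      (fun z => [set p : pt | (0 < depth (apex_solution z, p))%R]) w) =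
   \int[tuple_measure nu n.+1]_(z in apex_tuples W) (survival n gamma l (apex_solution z).2)%:E)%E.
Proof.
move=> eta_nu nuE.
have [F FT Ffin] := sigma_finiteT nu.
have mC q : measurable (separating_cell F q : set pt).
  rewrite /separating_cell; case: unpickle => // -[c i]; apply: measurableI.
    exact: measurable_rational_ball.
  by case: (Ffin i).
have LC q : (nu (separating_cell F q) < +oo)%E.
  rewrite /separating_cell; case: unpickle => [[c i]|]; last by rewrite measure0.
  case: (Ffin i) => mFi; apply: le_lt_trans; apply: le_measure; rewrite ?inE//.
  by apply: measurableI => //; exact: measurable_rational_ball.
have Csep (z : n.+1.-tuple pt) : uniq z -> exists f : 'I_n.+1 -> nat,
    trivIset setT (fun i => separating_cell F (f i)) /\
    forall i, separating_cell F (f i) (tnth z i).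
  by apply: separating_cellP; rewrite -FT.
pose U j : set (n.+1.-tuple pt) := (@apex_solution R n) @^-1` apex_cell j.
pose VV j : set pt := point_cell j.
have mU j : measurable (U j).
  apply: (@measurable_preimage _ _ _ _ (@apex_solution R n)).
    exact: measurable_apex_solution.
  exact: measurable_apex_cell.
have mVV j : measurable (VV j) by exact: measurable_point_cell.
have coverE (z : n.+1.-tuple pt) : section_all U VV z = [set p : pt | 0 < depth (apex_solution z, p)].
  by apply/seteqP; split => p /=; rewrite apex_point_cellP.
have [_ _] : mecke P nu eta (finite_counts R eta (separating_cell F)) (apex_tuples W) (section_all U VV).
  apply: (mecke_separated eta_nu mC LC Csep mU mVV (measurable_apex_tuples mW)).
  - by move=> z [dz _]; exact: site_mx_uniq.
  - move=> z i [dz _]; rewrite coverE /=.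
    by have /(_ i) -> := (apex_solutionP (apex_solution z) dz).2 erefl; rewrite ltxx.
rewrite (_ : section_all U VV = fun z => [set p : pt | 0 < depth (apex_solution z, p)]); last first.
  by apply/funext => z; exact: coverE.
move=> mE.
rewrite (@integral_full_measure _ _ _ P (finite_counts R eta (separating_cell F))); last 3 first.
- exact: (measurable_finite_counts eta_nu mC).
- exact: (finite_counts_full eta_nu mC LC).
- by move=> w; exact: ecard_ge0.
rewrite mE; apply: eq_integral => z _; rewrite /void_prob.
have massE := measure_paraboloid gamma_gt0 (apex_solution z) nuE.
rewrite (void_probability eta_nu).
- by rewrite massE.
- exact: measurable_depth_gt0.
- rewrite massE; case: (leP (apex_solution z).2 l) => sl.
    by rewrite paraboloid_mass0.
  by rewrite paraboloid_massE ?ltry.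
Qed.

Lemma cell_intensityE : (0 < lebesgue_rV W < +oo)%E -> cell_intensity n.+1 P eta W =
  ((gamma ^+ n.+1 * lambda `^ (1 - n.+1%:R) / (2 * n.+1%:R))%:E *
     \int[leb]_(s in `]0%R, 1%R[)
       (((1 - s) `^ ((n.+1%:R - 3) / 2) *
         expR (- (gamma * (ball_volume n / (n.+1%:R + 1)) *
                  s `^ ((n.+1%:R + 1) / 2) *
                  hypergeometric2F1 ((n.+1%:R + 1) / 2) ((n.+1%:R + 1) / 2)
                    ((n.+1%:R + 3) / 2) s)))%:E *
        I_integral n.+1 s))%E.
Proof.
move=> /andP[W0 Woo].
have mhd : measurable_fun setT (fun p : pt => height_density n gamma l p.2).
  exact: measurableT_comp (@measurable_height_density R n gamma l) measurable_snd.
have [nu nuE] := sigma_finite_density (@sigma_finite_product _ _ _ _ _ (@lebesgue_rV R n) leb)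
  mhd (fun p => @height_density_ge0 R n gamma l gamma_gt0 p.2).
(* The two measurable structures on the line, that of R and that carrying its
   Lebesgue measure, have the same measurable sets but different types. *)
have eta_nu : @is_poisson_process _ pt _ _ _ P nu eta.
  have -> : (nu : set pt -> \bar R) = horoball_intensity n.+1 gamma lambda.
    by rewrite nuE; apply/funext => B; rewrite horoball_intensity_density.
  exact: eta_poisson.
have nuE' (A : set pt) : measurable A ->
    nu A = (\int[lebesgue_rV \x leb]_(p in A) (height_density n gamma l p.2)%:E)%E.
  by move=> _; exact: (congr1 (fun g => g A) nuE).
rewrite /cell_intensity.
under eq_integral do rewrite esum_cells.
rewrite (mecke_apex_tuples eta_nu nuE') (integral_apex_tuples gamma_gt0 mW nuE').
rewrite integral_survival_site//.
set X := (\int[leb]_(s in _) _)%E.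
have Wfin : lebesgue_rV W \is a fin_num by rewrite ge0_fin_numE.
have w0 : fine (lebesgue_rV W) != 0 by rewrite gt_eqF// fine_gt0// W0.
rewrite -{2}(fineK Wfin) !muleA -!EFinM; congr (_%:E * _)%E.
have -> : l `^ (1 - a) = lambda `^ (1 - n.+1%:R).
  by rewrite -(powR_mulrn 2 (ltW lambda_gt0)) -powRrM; congr (_ `^ _); field.
rewrite exprMn exprVn [2 ^+ n.+1]exprS factS natrM.
have f0 : (n`!%:R : R) != 0 by rewrite pnatr_eq0 -lt0n fact_gt0.
have p0 : (2 ^+ n : R) != 0 by rewrite expf_neq0.
by field; rewrite f0 p0 w0/= andbT gt_eqF// ltr_pwDl.
Qed.

End cells.

Theorem theorem4 (R : realType) (d : nat) (hd : (2 <= d)%N)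
    (gamma lambda : R) (gamma_gt0 : 0 < gamma) (lambda_gt0 : 0 < lambda)
    (disp : measure_display) (Omega : measurableType disp)
    (P : probability Omega R) (eta : Omega -> set ('rV[R]_d.-1 * R))
    (eta_poisson : is_poisson_process P (horoball_intensity d gamma lambda) eta)
    (W : set 'rV[R]_d.-1) (W_borel : measurable W) (W_bounded : bounded_set W)
    (W_pos : (0 < lebesgue_rV W < +oo)%E) :
  cell_intensity d P eta W =
    ((gamma ^+ d * lambda `^ (1 - d%:R) / (2 * d%:R))%:E *
     \int[@lebesgue_measure R]_(s in `]0%R, 1%R[)
       (((1 - s) `^ ((d%:R - 3) / 2) *
         expR (- (gamma * (ball_volume d.-1 / (d%:R + 1)) *
                  s `^ ((d%:R + 1) / 2) *
                  hypergeometric2F1 ((d%:R + 1) / 2) ((d%:R + 1) / 2)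
                    ((d%:R + 3) / 2) s)))%:E *
        I_integral d s))%E.
Proof.
case: d hd eta eta_poisson W W_borel W_bounded W_pos => [//|n] n_gt0 eta eta_poisson W mW _ W_pos.
exact: (cell_intensityE n_gt0 gamma_gt0 lambda_gt0 eta_poisson mW W_pos).
Qed.
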